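(* Let $m\ge1$, $d=2+m$, and let $$h_0(y,\lambda,x;\theta)=\omega+\alpha y+\beta\lambda+\gamma^\top x,\qquad \theta=(\omega,\alpha,\beta,\gamma^\top)^\top,$$ with parameter set $\Theta\subset\mathbb R^{3+m}$ such that every $\theta\in\Theta$ satisfies $\omega,\alpha,\beta>0$, $\alpha+\beta<1$ and $\gamma\in(0,\infty)^m$. Let $\Theta_0\subset\Theta$ be compact, and let $\Delta_{T,W}$ be the statistic of the context computed with $h_0$. Assume the following. (1) The true model has link function $h_A:[0,\infty)^{p_A+q_A}\times\mathbb R^{m+K_A}\to(0,\infty)$, $h_A\ne h_0$, with arbitrary integers $p_A\ge1$, $q_A\ge0$, $K_A\ge1$: $\{X_t\}$ is a strictly stationary and ergodic sequence of $m$-dimensional random vectors with non-negative components, $\{\mathcal F_\lambda\}$ satisfies the stochastic order condition of the context, and $\{(Y_t,\lambda_{t,A})\}$ is the stationary and ergodic solution of $Y_t|\mathcal I_{t-1}\sim\mathcal F_{\lambda_{t,A}}$, $\lambda_{t,A}=h_A(Z_{t,A};\theta_A)$, $Z_{t,A}=(Y_{t-1},\dots,Y_{t-p_A},\lambda_{t-1,A},\dots,\lambda_{t-q_A,A},X_{t-1}^\top)^\top$, where $\theta_A\in\mathbb R^{K_A}$ is an interior point of a compact parameter set; and $\mathbb E\|Z_{t,A}\|^2<\infty$. (2) For some $M_1>0$, $|\partial g_\lambda(u)/\partial\lambda|<M_1$ for all $u\in[0,1]$, $\lambda\in(0,\infty)$. (3) There exists $\theta_0\in\mathrm{int}(\Theta_0)$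 such that $\widehat\theta_T\to\theta_0$ in probability as $T\to\infty$. (4) $W(u,v)=w(u)\varpi(v)$ for measurable $w:(0,1)\to(0,\infty)$ and $\varpi:\mathbb R^d\to(0,\infty)$ with $\varpi(v)=\varpi(-v)$ for all $v$, $0<\int_0^1w(u)\,du<\infty$, and $0<\int_{\mathbb R^d}\|v\|^k\varpi(v)\,dv<\infty$ for $k\in\{0,1,2,3,4\}$. Then, as $T\to\infty$, $$\frac1T\Delta_{T,W}\ \xrightarrow{\ P\ }\ \int_0^1\int_{\mathbb R^d}\zeta^2(u,v)\,w(u)\varpi(v)\,dv\,du,\qquad \zeta(u,v)=\mathbb E\big\{[g_{\lambda_{1,A}}(u)-g_{\lambda_{1,0}(\theta_0)}(u)]\,a(Z_{1,0}(\theta_0),v)\big\},$$ where $a(x,y)=\cos(x^\top y)+\sin(x^\top y)$ for $x,y\in\mathbb R^d$, $\{\lambda_{t,0}(\theta_0)\}$ is the stationary sequence given by $$\lambda_{t,0}(\theta)=\frac{\omega}{1-\beta}+\sum_{j=0}^\infty\beta^j[\alpha Y_{t-1-j}+\gamma^\top X_{t-1-j}],$$ and $Z_{t,0}(\theta)=(Y_{t-1},\lambda_{t-1,0}(\theta),X_{t-1}^\top)^\top$.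
   Context: $\{Y_t\}$ is a time series with values in $\mathbb N_0$, $\{X_t\}$ is an $\mathbb R^m$-valued series of exogenous covariates, and $\mathcal I_t$ is the information ($\sigma$-field) generated by $(Y_s,X_s)$, $s\le t$. $\{\mathcal F_\lambda,\lambda>0\}$ is a family of distributions on $\mathbb N_0$, $\mathcal F_\lambda$ having mean $\lambda$; the stochastic order condition is: $\lambda_1\le\lambda_2$ implies $\mathcal F_{\lambda_1}(y)\ge\mathcal F_{\lambda_2}(y)$ for all $y\in\mathbb R$ (distribution functions). $g_\lambda(u)=\sum_{k\ge0}u^k\mathcal F_\lambda(\{k\})$, $u\in[0,1]$, is the probability generating function of $\mathcal F_\lambda$. Stationary and ergodic solution means that the joint process $\{(Y_t,\lambda_{t,A},X_t)\}$ is strictly stationary and ergodic. Test statistic (for the hypothesis that the link is $h_0(\cdot;\theta)$ for some $\theta\in\mathrm{int}(\Theta_0)$). Data $(Y_t,X_{t-1})$, $t=1,\dots,T$, are observed and $\widehat\theta_T$ is a $\Theta$-valued estimator computed from them. Starting from some fixed nonnegative initial values for $Y_0$ and $\widehat\lambda_0$, define recursively for $t=1,\dots,T$: $\widehat Z_t=(Y_{t-1},\widehat\lambda_{t-1},X_{t-1}^\top)^\top$, $\widehat\lambda_t=h_0(\widehat Z_t;\widehat\theta_T)$. Put $\widehat\varepsilon_t(u)=u^{Y_t}-g_{\widehat\lambda_t}(u)$, $D_T(u;v)=\frac1T\sum_{t=1}^T\widehat\varepsilon_t(u)e^{\mathrm i v^\top\widehat Z_t}$ ($\mathrm i=\sqrt{-1}$),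 and $\Delta_{T,W}=T\int_0^1\int_{\mathbb R^d}|D_T(u;v)|^2W(u,v)\,dv\,du$. (The initial values are used only in the statistic; $\zeta$ is defined with the stationary variables.) *)

(* Defs.v *)
From HB Require Import structures.
From mathcomp Require Import all_boot all_order all_algebra complex.
From mathcomp Require Import all_classical all_reals all_analysis measurable_realfun.

Set Implicit Arguments.
Unset Strict Implicit.
Unset Printing Implicit Defensive.

Import Order.TTheory GRing.Theory Num.Theory.
Import numFieldNormedType.Exports.

Local Open Scope classical_set_scope.
Local Open Scope ring_scope.

(* The space 'rV[R]_n carries the product sigma-algebra, which is its Borel
   sigma-algebra; this mirrors the library instance on n.-tuple R. *)

Definition rV_display : measure_display.
Proof. exact. Qed.

Section measurable_rV.
Context {R : realType}.
Variable n : nat.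

Definition rV_coord (i : 'I_n) (v : 'rV[R]_n) : R := v ord0 i.

Let rV_set0 : g_sigma_preimage rV_coord set0.
Proof. exact: sigma_algebra0. Qed.

Let rV_setC A : g_sigma_preimage rV_coord A -> g_sigma_preimage rV_coord (~` A).
Proof. exact: sigma_algebraC. Qed.

Let rV_bigcup (F : (set 'rV[R]_n)^nat) :
  (forall i, g_sigma_preimage rV_coord (F i)) ->
  g_sigma_preimage rV_coord (\bigcup_i (F i)).
Proof. exact: sigma_algebra_bigcup. Qed.

HB.instance Definition _ := @isMeasurable.Build rV_display
  'rV[R]_n (g_sigma_preimage rV_coord) rV_set0 rV_setC rV_bigcup.

Lemma measurable_rV_coord (i : 'I_n) : measurable_fun setT (rV_coord i).
Proof.
move=> _ B mB; rewrite setTI; apply: sub_sigma_algebra => /=.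
rewrite -bigcup_seq/=; exists i => /=; first by rewrite mem_index_enum.
by exists B => //; rewrite setTI.
Qed.

Lemma measurable_fun_rV d (T : measurableType d) (f : T -> 'rV[R]_n) :
  (forall i, measurable_fun setT (rV_coord i \o f)) -> measurable_fun setT f.
Proof.
move=> mf _ A mA; rewrite setTI; move: A mA.
have sf : sigma_algebra setT [set A : set 'rV[R]_n | measurable (f @^-1` A)].
  split=> [|A mA|F mF] /=.
  - by rewrite preimage_set0.
  - by rewrite setTD preimage_setC; exact: measurableC.
  - by rewrite preimage_bigcup; exact: bigcupT_measurable.
change (g_sigma_preimage rV_coord `<=` [set A | measurable (f @^-1` A)]).
apply: (smallest_sub sf) => A; rewrite -bigcup_seq/= => -[i _ [B mB <-]].
by rewrite /= setTI -comp_preimage -[X in measurable X]setTI; exact: mf.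
Qed.

End measurable_rV.

Section lebesgue_rV.
Context {R : realType}.

Definition rV_cons n (p : R * 'rV[R]_n) : 'rV[R]_n.+1 :=
  @row_mx R 1 1 n p.1%:M p.2.

Definition rV_uncons n (v : 'rV[R]_n.+1) : R * 'rV[R]_n :=
  (@lsubmx R 1 1 n v ord0 ord0, @rsubmx R 1 1 n v).

Lemma measurable_rV_cons n : measurable_fun setT (@rV_cons n).
Proof.
apply: measurable_fun_rV => i.
case: (@split_ordP 1 n i) => j ->.
- rewrite (_ : _ \o _ = fst) ?measurable_fst//.
  apply/funext => p /=; rewrite /rV_coord /rV_cons.
  by rewrite (row_mxEl (p.1%:M : 'M[R]_1)) (ord1 j) mxE eqxx mulr1n.
- rewrite (_ : _ \o _ = rV_coord j \o snd).
    by apply: measurableT_comp => //; exact: measurable_rV_coord.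
  by apply/funext => p /=; rewrite /rV_coord /rV_cons (row_mxEr (p.1%:M : 'M[R]_1)).
Qed.

Lemma measurable_rV_uncons n : measurable_fun setT (@rV_uncons n).
Proof.
apply: measurable_fun_pair => /=.
  rewrite (_ : (fun _ => _) = rV_coord (@lshift 1 n ord0)).
    exact: measurable_rV_coord.
  by apply/funext => v; rewrite mxE.
apply: measurable_fun_rV => i.
rewrite (_ : _ \o _ = rV_coord (@rshift 1 n i)).
  exact: measurable_rV_coord.
by apply/funext => v; rewrite /= /rV_coord mxE.
Qed.

Lemma rV_consK n : cancel (@rV_cons n) (@rV_uncons n).
Proof.
move=> [x v]; rewrite /rV_uncons /rV_cons row_mxKl row_mxKr.
by rewrite mxE eqxx mulr1n.
Qed.

Lemma sigma_finite_prod d1 d2 (T1 : measurableType d1) (T2 : measurableType d2)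
    (m1 : {sigma_finite_measure set T1 -> \bar R})
    (m2 : {sigma_finite_measure set T2 -> \bar R}) :
  sigma_finite setT (m1 \x m2)%E.
Proof.
have /sigma_finiteP[F [TF ndF Foo]] := sigma_finiteT m1.
have /sigma_finiteP[G [TG ndG Goo]] := sigma_finiteT m2.
exists (fun n => F n `*` G n).
  rewrite -setXTT TF TG predeqE => -[x y]; split.
    move=> [/= [n _ Fnx] [k _ Gky]]; exists (maxn n k) => //; split.
    - by move: x Fnx; exact/subsetPset/ndF/leq_maxl.
    - by move: y Gky; exact/subsetPset/ndG/leq_maxr.
  by move=> [n _ []/= ? ?]; split; exists n.
move=> k; have [? ?] := Foo k; have [? ?] := Goo k.
split; first exact: measurableX.
by rewrite product_measure1E// lte_mul_pinfty// ge0_fin_numE.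
Qed.

Section step.
Variables (n : nat) (mu : {sigma_finite_measure set 'rV[R]_n -> \bar R}).

Definition lebesgue_rVS : set 'rV[R]_n.+1 -> \bar R :=
  pushforward (@lebesgue_measure R \x mu)%E (@rV_cons n).

Let lebesgue_rVS0 : lebesgue_rVS set0 = 0%E.
Proof. by rewrite /lebesgue_rVS /pushforward preimage_set0 measure0. Qed.

Let lebesgue_rVS_ge0 A : (0 <= lebesgue_rVS A)%E.
Proof. by rewrite /lebesgue_rVS /pushforward measure_ge0. Qed.

Let lebesgue_rVS_sigma_additive : semi_sigma_additive lebesgue_rVS.
Proof.
have mc B : measurable B -> measurable (@rV_cons n @^-1` B).
  by move=> mB; rewrite -[X in measurable X]setTI; exact: measurable_rV_cons.
move=> F mF tF mUF; rewrite /lebesgue_rVS /pushforward preimage_bigcup.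
apply: measure_semi_sigma_additive => [k||]; first exact: mc.
- apply/trivIsetP => /= i j _ _ ij; rewrite -preimage_setI.
  by move/trivIsetP : tF => /(_ _ _ _ _ ij) ->//; rewrite preimage_set0.
- by rewrite -preimage_bigcup; exact: mc.
Qed.

HB.instance Definition _ := isMeasure.Build _ _ _ lebesgue_rVS
  lebesgue_rVS0 lebesgue_rVS_ge0 lebesgue_rVS_sigma_additive.

Let lebesgue_rVS_sigma_finite : sigma_finite setT lebesgue_rVS.
Proof.
have [F TF Foo] := sigma_finite_prod (@lebesgue_measure R) mu.
exists (fun k => @rV_uncons n @^-1` F k).
  by rewrite -preimage_bigcup -TF preimage_setT.
move=> k; have [mF Fk] := Foo k; split.
  by rewrite -[X in measurable X]setTI; exact: measurable_rV_uncons.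
rewrite /lebesgue_rVS /pushforward -comp_preimage.
by rewrite (_ : _ \o _ = id)//; apply/funext => p /=; rewrite rV_consK.
Qed.

HB.instance Definition _ := Measure_isSigmaFinite.Build _ _ _ lebesgue_rVS
  lebesgue_rVS_sigma_finite.

End step.

(* Lebesgue measure on R^n, as the n-fold product of Lebesgue measure on R
   (a unit mass at the only point when n = 0). *)
Fixpoint lebesgue_rV (n : nat) : {sigma_finite_measure set 'rV[R]_n -> \bar R} :=
  match n with
  | 0 => \d_(0 : 'rV[R]_0)
  | k.+1 => lebesgue_rVS (lebesgue_rV k)
  end.

End lebesgue_rV.

Section vectors.
Context {R : realType}.

Definition dotv n (u v : 'rV[R]_n) : R := \sum_(i < n) u ord0 i * v ord0 i.

(* The norm that the library puts on 'rV[R]_n is the maximum norm. *)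
Definition enorm n (v : 'rV[R]_n) : R := Num.sqrt (dotv v v).

Definition cis (x : R) : R[i] := (cos x +i* sin x)%C.

Definition cas n (x y : 'rV[R]_n) : R := cos (dotv x y) + sin (dotv x y).

End vectors.

Section probability_notions.
Local Open Scope ereal_scope.
Context d (Omega : measurableType d) (R : realType) (P : probability Omega R).

(* The variables are extended-real valued so that the integral statistic needs
   no truncation; against a finite limit, an infinite value counts as a
   deviation larger than any eps. *)
Definition cvg_in_probability (X : nat -> Omega -> \bar R) (l : \bar R) :=
  forall eps : R, (0 < eps)%R ->
    P [set w | eps%:E <= `|X n w - l|] @[n --> \oo] --> 0.

(* The product sigma-algebra on the two-sided path space S^Z. *)
Definition path_measurable d' (S : measurableType d') : set (set (int -> S)) :=
  <<s [set C | exists t (B : set S), measurable B /\ C = [set x | B (x t)]] >>.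

Definition strictly_stationary d' (S : measurableType d')
    (Z : int -> Omega -> S) :=
  forall (C : set (int -> S)) (h : int), path_measurable C ->
    P [set w | C (fun t => Z (t + h)%R w)] = P [set w | C (fun t => Z t w)].

Definition ergodic d' (S : measurableType d') (Z : int -> Omega -> S) :=
  forall C : set (int -> S), path_measurable C ->
    (forall x, C (fun t => x (t + 1)%R) <-> C x) ->
    P [set w | C (fun t => Z t w)] = 0 \/ P [set w | C (fun t => Z t w)] = 1.

Definition information d' (S : measurableType d') (Z : int -> Omega -> S)
    (t : int) : set (set Omega) :=
  <<s [set A | exists s (B : set S),
        [/\ (s <= t)%R, measurable B & A = Z s @^-1` B]] >>.

(* Q is a version of the conditional distribution of Y given G. *)
Definition conditional_law d' (S : measurableType d') (Y : Omega -> S)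
    (G : set (set Omega)) (Q : Omega -> set S -> \bar R) :=
  forall B : set S, measurable B ->
    (forall D : set (\bar R), measurable D -> G [set w | D (Q w B)]) /\
    (forall A, G A -> P (A `&` Y @^-1` B) = \int[P]_(w in A) Q w B).

End probability_notions.

Section count_families.
Context {R : realType}.
Implicit Type F : R -> probability nat R.

Definition has_mean_parameter F := forall l : R, 0 < l ->
  (\int[F l]_k (k%:R : R)%:E = l%:E)%E.

Definition stochastically_ordered F := forall l1 l2 : R, 0 < l1 -> l1 <= l2 ->
  forall y : R, (F l2 [set k | (k%:R <= y)%R] <= F l1 [set k | (k%:R <= y)%R])%E.

Definition pgf F (l u : R) : R :=
  fine (\sum_(0 <= k <oo) (u ^+ k)%:E * F l [set k])%E.

End count_families.

Section linear_model.
Context {R : realType} (m : nat).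

(* theta = (omega, alpha, beta, gamma) *)
Definition omega_of (th : 'rV[R]_(3 + m)) : R := lsubmx th ord0 0.
Definition alpha_of (th : 'rV[R]_(3 + m)) : R := lsubmx th ord0 1.
Definition beta_of (th : 'rV[R]_(3 + m)) : R := lsubmx th ord0 2.
Definition gamma_of (th : 'rV[R]_(3 + m)) : 'rV[R]_m := rsubmx th.

Definition admissible (th : 'rV[R]_(3 + m)) :=
  [/\ 0 < omega_of th, 0 < alpha_of th, 0 < beta_of th,
      alpha_of th + beta_of th < 1 & forall i, 0 < gamma_of th ord0 i].

Definition zvec (y l : R) (x : 'rV[R]_m) : 'rV[R]_(2 + m) :=
  row_mx (\row_(i < 2) if i == 0 then y else l) x.

Definition h0 (z : 'rV[R]_(2 + m)) (th : 'rV[R]_(3 + m)) : R :=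
  omega_of th + alpha_of th * lsubmx z ord0 0 + beta_of th * lsubmx z ord0 1
  + dotv (gamma_of th) (rsubmx z).

End linear_model.

Section statistic.
Context {R : realType} (m : nat).
Variables (F : R -> probability nat R) (th : 'rV[R]_(3 + m)).
(* y0 and l0 are the initial values; y t (t >= 1) and x t (t >= 0) the data. *)
Variables (y0 l0 : R) (y : nat -> nat) (x : nat -> 'rV[R]_m).

Definition ylag (s : nat) : R := if s is 0 then y0 else (y s)%:R.

Fixpoint lam_hat (t : nat) : R :=
  match t with
  | 0 => l0
  | s.+1 => h0 (zvec (ylag s) (lam_hat s) (x s)) th
  end.

Definition z_hat (t : nat) : 'rV[R]_(2 + m) :=
  zvec (ylag t.-1) (lam_hat t.-1) (x t.-1).

Definition eps_hat (t : nat) (u : R) : R := u ^+ y t - pgf F (lam_hat t) u.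

Definition D_stat (T : nat) (u : R) (v : 'rV[R]_(2 + m)) : R[i] :=
  ((T%:R^-1)%:C * \sum_(1 <= t < T.+1) (eps_hat t u)%:C * cis (dotv v (z_hat t)))%C.

Definition Delta_stat (W : R -> 'rV[R]_(2 + m) -> R) (T : nat) : \bar R :=
  (T%:R%:E * \int[@lebesgue_measure R]_(u in `]0%R, 1%R[)
     \int[lebesgue_rV (2 + m)]_v
       ((Normc.normc (D_stat T u v)) ^+ 2 * W u v)%R%:E)%E.

End statistic.

Section stationary_quantities.
Context d (Omega : measurableType d) (R : realType) (P : probability Omega R).
Context (m : nat) (F : R -> probability nat R).
Variables (Y : int -> Omega -> nat) (X : int -> Omega -> 'rV[R]_m).

(* Value at w of an estimator computed from (Y_t, X_{t-1}), t = 1, ..., T. *)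
Definition theta_hat (est : forall T : nat,
    ('I_T -> nat * 'rV[R]_m) -> 'rV[R]_(3 + m)) (T : nat) (w : Omega) :=
  est T (fun i : 'I_T => (Y (i.+1)%:Z w, X i%:Z w)).

Definition lam_stat (th : 'rV[R]_(3 + m)) (t : int) (w : Omega) : R :=
  omega_of th / (1 - beta_of th) +
  limn (series (fun j : nat => beta_of th ^+ j *
    (alpha_of th * (Y (t - 1 - j%:Z) w)%:R
     + dotv (gamma_of th) (X (t - 1 - j%:Z) w)))).

Definition z_stat (th : 'rV[R]_(3 + m)) (t : int) (w : Omega) : 'rV[R]_(2 + m) :=
  zvec (Y (t - 1) w)%:R (lam_stat th (t - 1) w) (X (t - 1) w).

Definition z_alt (pA qA : nat) (lamA : int -> Omega -> R) (t : int) (w : Omega) :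
    'rV[R]_(pA + qA + m) :=
  row_mx (row_mx (\row_(i < pA) (Y (t - 1 - i%:Z) w)%:R)
                 (\row_(j < qA) lamA (t - 1 - j%:Z) w))
         (X (t - 1) w).

Definition zeta (lamA : int -> Omega -> R) (th : 'rV[R]_(3 + m)) (u : R)
    (v : 'rV[R]_(2 + m)) : R :=
  fine ('E_P[fun w => ((pgf F (lamA 1 w) u - pgf F (lam_stat th 1 w) u)
                       * cas (z_stat th 1 w) v)%R])%E.

End stationary_quantities.

(* The link hA of orders (pA, qA) with K_A parameters is the linear link: the
   orders and the number of parameters agree, and so do the values on the
   nonnegative (y, l), all covariate values and all parameters in Theta. *)
Definition is_linear_link {R : realType} (m pA qA KA : nat)
    (Theta : set 'rV[R]_(3 + m))
    (hA : 'rV[R]_(pA + qA + m) -> 'rV[R]_KA -> R) :=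
  [/\ pA = 1%N, qA = 1%N & exists eK : (3 + m)%N = KA,
    forall (y l : R) (x : 'rV[R]_m) (th : 'rV[R]_(3 + m)),
      0 <= y -> 0 <= l -> Theta th ->
      hA (row_mx (row_mx (const_mx y) (const_mx l)) x)
         (castmx (erefl 1%N, eK) th) = h0 (zvec y l x) th].

(* Main.v *)
Require Import Defs.
From HB Require Import structures.
From mathcomp Require Import all_boot all_order all_algebra complex.
From mathcomp Require Import all_classical all_reals all_analysis measurable_realfun.
From mathcomp Require Import ring lra zify.

Set Implicit Arguments.
Unset Strict Implicit.
Unset Printing Implicit Defensive.

Import Order.TTheory GRing.Theory Num.Theory.
Import numFieldNormedType.Exports.

Local Open Scope classical_set_scope.
Local Open Scope ring_scope.

(** The fitted intensities follow a linear recursion whose contraction factor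
    is bounded away from 1 once the estimator is close to its limit.  Summing
    the recursion shows that the average distance between the fitted and the
    stationary intensities is at most a constant times
    (estimation error) * (average of regressors) + O(1/T); since [pgf F] is
    Lipschitz in the intensity, the statistic may be replaced by its stationary
    version.  For fixed [(u, v)] the ergodic theorem sends the real and the
    imaginary part of the stationary version of [D_T(u; v)] to their
    expectations [C] and [S], and Tonelli together with dominated convergence
    makes this convergence hold in mean for the weighted integral.
    Conditioning on the past replaces [u ^+ Y] by the generating function at
    the true intensity, so that [zeta = C + S]; the cross term of [zeta ^+ 2]
    is odd in [v] and integrates to 0, which leaves [C ^+ 2 + S ^+ 2], the
    squared modulus of the limit of [D_T]. *)

(** * Birkhoff averages of bounded functions under an ergodic map *)

(** Stationarity and ergodicity are properties of the law of the process, while [Omega] carries no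
    shift. The summands are therefore written as functions of a two-sided path, so that each later
    one is the first evaluated at a shifted path; the infinite past is part of the path because
    [lam_stat] is an infinite series. Residuals are bounded, so an ergodic theorem for bounded
    functions suffices, and Garsia's maximal inequality gives it. The estimator depends on the whole
    sample, which puts the fitted summands out of reach of the ergodic theorem. Hence the comparison
    with the stationary version is a deterministic inequality on each path with convergent past
    series, and probability enters through first moments and Markov's inequality. The average of the
    regressors only has bounded mean, so its product with the estimation error is made small by
    fixing a radius [eta] around [th0] before the sample size grows. The weighted statistic is kept
    as a nonnegative extended-real integral, to which Tonelli applies directly. *)

Section bounded_functions.
Context d (T : measurableType d) (R : realType) (mu : {finite_measure set T -> \bar R}).

Lemma integrable_bounded (D : set T) (f : T -> R) (B : R) : measurable D ->
  measurable_fun D f -> (forall x, D x -> `|f x| <= B) ->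
  mu.-integrable D (EFin \o f).
Proof.
move=> mD mf fB; apply: (@le_integrable _ _ _ mu D mD (EFin \o f) (EFin \o cst B)).
- exact/measurable_EFinP.
- move=> x Dx /=; rewrite lee_fin (le_trans (fB _ Dx))//; exact: ler_norm.
- exact: finite_measure_integrable_cst.
Qed.

End bounded_functions.

Section ergodic_theorem.
Context d (T : measurableType d) (R : realType) (mu : probability T R).
Variable tau : T -> T.
Hypothesis mtau : measurable_fun setT tau.
Hypothesis tau_mu : forall A, measurable A -> mu (tau @^-1` A) = mu A.

Implicit Types (f : T -> R) (B : R) (n : nat) (x : T).

Lemma Rintegral_preserved (f : T -> R) (B : R) : measurable_fun setT f ->
  (forall x, `|f x| <= B) ->
  (\int[mu]_x f (tau x) = \int[mu]_x f x)%R.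
Proof.
move=> mf fB; rewrite /Rintegral; congr fine.
rewrite -(@integral_pushforward _ _ _ _ _ tau mtau mu setT (EFin \o f))//=; last 2 first.
- exact/measurable_EFinP.
- rewrite preimage_setT; apply: (@integrable_bounded _ _ _ _ _ (f \o tau) B) => //=.
  exact: (measurableT_comp mf mtau).
by apply: eq_measure_integral => A mA _; exact: tau_mu.
Qed.

Definition birkhoff_sum (f : T -> R) n x := \sum_(i < n) f (iter i tau x).

(** Equals the maximum of [birkhoff_sum f k x] over k <= n, the empty sum included; the recursive
    form makes Garsia's identity hold by reduction. *)
Fixpoint maxsum (f : T -> R) n (x : T) : R :=
  if n is k.+1 then Num.max 0 (f x + maxsum f k (tau x)) else 0.

Lemma measurable_iter_tau n : measurable_fun setT (iter n tau).
Proof.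
elim: n => [|n IH]; first exact: measurable_id.
exact: (measurableT_comp mtau IH).
Qed.

Lemma measurable_birkhoff_sum f n : measurable_fun setT f -> measurable_fun setT (birkhoff_sum f n).
Proof.
move=> mf; apply: measurable_sum => i.
exact: (measurableT_comp mf (measurable_iter_tau _)).
Qed.

Lemma measurable_maxsum f n :
  measurable_fun setT f -> measurable_fun setT (maxsum f n).
Proof.
move=> mf; elim: n => [|n IH] /=; first exact: measurable_cst.
apply: measurable_maxr => //; apply: measurable_funD => //.
exact: (measurableT_comp IH mtau).
Qed.

Lemma maxsum_ge0 f n x : 0 <= maxsum f n x.
Proof. by case: n => [//|n] /=; rewrite le_max lexx. Qed.

Lemma maxsum_leS f n x : maxsum f n x <= maxsum f n.+1 x.
Proof.
elim: n x => [|n IH] x; first exact: maxsum_ge0.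
by rewrite [leLHS]/= [leRHS]/= ge_max le_max lexx/= le_max lerD2l IH orbT.
Qed.

Lemma birkhoff_sumS f n x : birkhoff_sum f n.+1 x = f x + birkhoff_sum f n (tau x).
Proof.
rewrite /birkhoff_sum big_ord_recl/=; congr (_ + _).
by apply: eq_bigr => i _; rewrite -iterSr.
Qed.

Lemma birkhoff_sum_le_maxsum f n x : birkhoff_sum f n x <= maxsum f n x.
Proof.
elim: n x => [|n IH] x; first by rewrite /birkhoff_sum big_ord0.
by rewrite birkhoff_sumS/= le_max lerD2l IH orbT.
Qed.

Lemma maxsum_bound f B n x : (forall x, `|f x| <= B) -> `|maxsum f n x| <= n%:R * B.
Proof.
move=> fB; have B0 : 0 <= B by exact: le_trans (fB x).
rewrite ger0_norm ?maxsum_ge0//.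
elim: n x => [|n IH] x /=; first by rewrite mul0r.
rewrite ge_max mulr_ge0//= -natr1 mulrDl mul1r addrC lerD//.
by rewrite (le_trans (ler_norm _)).
Qed.

(* Garsia's argument: on [0 < maxsum f n.+1], that maximum is
   [f + maxsum f n \o tau], hence at most [f + maxsum f n.+1 \o tau]. *)
Lemma maximal_ergodic f B n : measurable_fun setT f -> (forall x, `|f x| <= B) ->
  0 <= \int[mu]_x ((f \_ [set x | (0 < maxsum f n x)%R]) x).
Proof.
move=> mf fB; set D := [set x | _].
have mD : measurable D.
  rewrite [D](_ : _ = maxsum f n @^-1` `]0, +oo[).
    by rewrite -[X in measurable X]setTI; exact: measurable_maxsum.
  by apply/seteqP; split => x /=; rewrite in_itv/= andbT.
have mM := @measurable_maxsum f n mf.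
have MB x := @maxsum_bound f B n x fB.
have iM : mu.-integrable setT (EFin \o maxsum f n).
  by apply: (@integrable_bounded _ _ _ _ _ _ (n%:R * B)) => // x _; exact: MB.
have iMt : mu.-integrable setT (EFin \o (maxsum f n \o tau)).
  apply: (@integrable_bounded _ _ _ _ _ (maxsum f n \o tau) (n%:R * B)) => //.
    exact: (measurableT_comp mM mtau).
  by move=> x _; exact: MB.
(* Zero is the integral of a coboundary, by invariance of [mu], and the coboundary lies below
   [f \_ D] pointwise. *)
have -> : 0 = \int[mu]_x (maxsum f n x - maxsum f n (tau x)).
  by rewrite RintegralB// (Rintegral_preserved mM MB) subrr.
apply: le_Rintegral => //.
- rewrite [EFin \o _](_ : _ = (EFin \o maxsum f n) \- (EFin \o (maxsum f n \o tau)))%E //.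
  exact: integrableB.
- apply: (@integrable_bounded _ _ _ _ _ (f \_ D) B) => //.
    apply/(measurable_restrictT _ mD).
    exact: measurable_funS mf.
  move=> x _; rewrite patchE; case: ifP => // _.
  by rewrite normr0 (le_trans _ (fB x)).
move=> x _; rewrite patchE; case: ifPn => [/set_mem|].
  rewrite /D/=; case: n {D mD mM MB iM iMt} => [|n]; first by rewrite /= ltxx.
  move=> Mx; rewrite lerBlDr.
  suff -> : maxsum f n.+1 x = f x + maxsum f n (tau x) by rewrite lerD2l maxsum_leS.
  move: Mx => /=; rewrite lt_max ltxx/= => Mx.
  by rewrite max_r// ltW.
move=> /negP xD; rewrite subr_le0 (le_trans _ (maxsum_ge0 _ _ _))// leNgt.
by apply/negP => Mx; apply: xD; exact: mem_set.
Qed.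

(** The sets where [maxsum f n] is positive grow with n and exhaust the space up to a null set, so
    the restricted integrals, all nonnegative, tend to the full one. *)
Lemma maximal_ergodic_full f B : measurable_fun setT f -> (forall x, `|f x| <= B) ->
  {ae mu, forall x, exists n, 0 < maxsum f n x} -> 0 <= \int[mu]_x f x.
Proof.
move=> mf fB Hf; pose D n := [set x | 0 < maxsum f n x].
have mD n : measurable (D n).
  rewrite [D n](_ : _ = maxsum f n @^-1` `]0, +oo[).
    by rewrite -[X in measurable X]setTI; exact: measurable_maxsum.
  by apply/seteqP; split => x /=; rewrite in_itv/= andbT.
have ifD n : mu.-integrable setT (EFin \o (f \_ (D n))).
  apply: (@integrable_bounded _ _ _ _ _ (f \_ (D n)) B) => //.
    apply/(measurable_restrictT _ (mD n)); exact: measurable_funS mf.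
  move=> x _; rewrite patchE; case: ifP => // _.
  by rewrite normr0 (le_trans _ (fB x)).
have nd x n k : (n <= k)%N -> 0 < maxsum f n x -> 0 < maxsum f k x.
  move=> /subnK <- Mx; elim: (k - n)%N => [//|j IH].
  by rewrite addSn (lt_le_trans IH)// maxsum_leS.
have [] := @dominated_convergence _ _ _ mu setT measurableT
  (fun n => EFin \o (f \_ (D n))) (EFin \o f) (EFin \o cst B).
- by move=> n; case/integrableP : (ifD n).
- exact/measurable_EFinP.
- apply: filterS Hf => x [n Mx] _; apply: cvg_near_cst.
  exists n => // k /= nk; rewrite patchE mem_set//.
  exact: nd Mx.
- exact: finite_measure_integrable_cst.
- apply: aeW => x n _ /=; rewrite lee_fin patchE; case: ifP => // _.
  by rewrite normr0 (le_trans _ (fB x)).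
move=> _ _ lim; rewrite /Rintegral fine_ge0//.
rewrite -(cvg_lim _ lim)//; apply: lime_ge.
  by apply/cvg_ex; eexists; exact: lim.
apply: nearW => n /=.
have := @maximal_ergodic f B n mf fB.
by rewrite /Rintegral -lee_fin fineK//; exact: (integrable_fin_num measurableT (ifD n)).
Qed.

Hypothesis tau_ergodic : forall A, measurable A -> tau @^-1` A = A ->
  mu A = 0%E \/ mu A = 1%E.

(* The partial sums of [f - a] are unbounded above on a set that is exactly
   invariant, since the shift changes them by a bounded quantity only. *)
Lemma birkhoff_sum_le_ae f B a : measurable_fun setT f -> (forall x, `|f x| <= B) ->
  \int[mu]_x f x < a ->
  {ae mu, forall x, exists K : nat, forall n, birkhoff_sum f n x <= K%:R + n%:R * a}.
Proof.
move=> mf fB fa; pose g x := f x - a.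
have mg : measurable_fun setT g by exact: measurable_funB.
have gB x : `|g x| <= B + `|a|.
  by rewrite (le_trans (ler_normB _ _))// lerD2r.
have bg n x : birkhoff_sum g n x = birkhoff_sum f n x - n%:R * a.
  rewrite /birkhoff_sum sumrB; congr (_ - _).
  by rewrite sumr_const card_ord mulr_natl.
pose E := [set x | forall K : nat, exists n, K%:R < birkhoff_sum g n x].
have EE : E = \bigcap_K \bigcup_n (birkhoff_sum g n @^-1` `]K%:R, +oo[).
  apply/seteqP; split => x.
    by move=> Ex K _; have [n ?] := Ex K; exists n => //=; rewrite in_itv/= andbT.
  move=> Ex K; have [n _] := Ex K I; rewrite /= in_itv/= andbT => ?.
  by exists n.
have mE : measurable E.
  rewrite EE; apply: bigcapT_measurable => K; apply: bigcupT_measurable => n.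
  by rewrite -[X in measurable X]setTI; exact: measurable_birkhoff_sum.
have tE : tau @^-1` E = E.
  have [C BC] : exists C : nat, B + `|a| <= C%:R.
    by exists (Num.truncn (B + `|a|)).+1; rewrite ltW// truncnS_gt.
  have gC x : `|g x| <= C%:R by exact: le_trans BC.
  apply/seteqP; split => x /= Ex K; have [n] := Ex (K + C)%N; rewrite natrD => nK.
    exists n.+1; rewrite birkhoff_sumS.
    by have := gC x; rewrite ler_norml => /andP[? _]; lra.
  case: n nK => [|n]; first by rewrite /birkhoff_sum big_ord0 -natrD ltrn0.
  rewrite birkhoff_sumS => nK; exists n.
  by have := gC x; rewrite ler_norml => /andP[_ ?]; lra.
have [E0|E1] := tau_ergodic mE tE.
  exists E; split => // x /=; apply: contra_notP => nE.
  have [K nK] : exists K : nat, forall n, ~ K%:R < birkhoff_sum g n x.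
    apply: contrapT => h; apply: nE => K; apply: contrapT => hK.
    by apply: h; exists K => n ?; apply: hK; exists n.
  exists K => n; have /negP := nK n; rewrite -leNgt bg; lra.
(* If the partial sums of [g] were unbounded almost everywhere, the maximal inequality would make
   the integral of [g] nonnegative, yet it equals the integral of [f] minus [a], which is
   negative. *)
exfalso.
have : 0 <= \int[mu]_x g x.
  apply: (maximal_ergodic_full mg gB); exists (~` E); split.
  - exact: measurableC.
  - by rewrite probability_setC// E1 subee//.
  move=> x /= nx Ex; apply: nx; have [n n0] := Ex 0%N.
  by exists n; rewrite (lt_le_trans n0)// birkhoff_sum_le_maxsum.
rewrite /g RintegralB//.
- rewrite Rintegral_cst// (_ : fine _ = 1) ?mulr1 ?subr_ge0; first lra.
  by rewrite -[RHS]/(fine 1%E); congr fine; exact: probability_setT.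
- by apply: (@integrable_bounded _ _ _ _ _ _ B).
- exact: finite_measure_integrable_cst.
Qed.

(** The one-sided bound applies to [f] and to [- f] with slack 1/(k+1) above the mean; countably
    many slacks keep the exceptional set null. *)
Lemma ergodic_ae f B : measurable_fun setT f -> (forall x, `|f x| <= B) ->
  {ae mu, forall x, (n%:R^-1 * birkhoff_sum f n x) @[n --> \oo] --> \int[mu]_x f x}.
Proof.
move=> mf fB; set c := Rintegral _ _ _.
have fNB x : `|- f x| <= B by rewrite normrN.
have cN : \int[mu]_x (- f x) = - c.
  transitivity (\int[mu]_x (-1 * f x)).
    by apply: eq_Rintegral => x _; rewrite mulN1r.
  by rewrite RintegralZl ?mulN1r//; apply: (@integrable_bounded _ _ _ _ _ _ B).
have H1 k := @birkhoff_sum_le_ae f B (c + k.+1%:R^-1) mf fB.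
have H2 k := @birkhoff_sum_le_ae (fun x => - f x) B (- c + k.+1%:R^-1)
  (measurableT_comp (@oppr_measurable _ _) mf) fNB.
have {}H1 : {ae mu, forall x, forall k : nat,
    exists K : nat, forall n, birkhoff_sum f n x <= K%:R + n%:R * (c + k.+1%:R^-1)}.
  apply/ae_foralln => k; apply: H1; by rewrite ltrDl invr_gt0 ltr0n.
have {}H2 : {ae mu, forall x, forall k : nat,
    exists K : nat, forall n, - birkhoff_sum f n x <= K%:R + n%:R * (- c + k.+1%:R^-1)}.
  apply/ae_foralln => k.
  have /H2 : \int[mu]_x (- f x) < - c + k.+1%:R^-1.
    by rewrite cN ltrDl invr_gt0 ltr0n.
  apply: filterS => x [K HK]; exists K => n; move: (HK n).
  by rewrite /birkhoff_sum sumrN.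
apply: filterS2 H1 H2 => x H1 H2; apply/cvgrPdist_le => e e0.
have [k ke] : exists k : nat, k.+1%:R^-1 <= e / 2.
  exists (Num.truncn (e / 2)^-1); rewrite invf_ple ?posrE ?divr_gt0// ?ltr0n//.
  by rewrite ltW// truncnS_gt.
have [K1 HK1] := H1 k; have [K2 HK2] := H2 k.
(* Beyond this index the additive constants, divided by n, stay below [e / 2]; the slack takes the
   other half. *)
exists (Num.truncn ((K1 + K2)%:R / (e / 2))).+1 => // n /= nK.
have n0 : 0 < n%:R :> R by rewrite ltr0n (leq_trans _ nK).
have Kn : (K1 + K2)%:R <= n%:R * (e / 2).
  rewrite -ler_pdivrMr ?divr_gt0// (le_trans (ltW (truncnS_gt _)))//.
  by rewrite ler_nat.
rewrite natrD in Kn.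
have K10 : 0 <= K1%:R :> R by []. have K20 : 0 <= K2%:R :> R by [].
have h1 := HK1 n; have h2 := HK2 n.
have hk : n%:R * k.+1%:R^-1 <= n%:R * (e / 2) by rewrite ler_pM2l.
rewrite !mulrDr mulrN in h1 h2.
move: n0 Kn K10 K20 h1 h2 hk.
move: (n%:R) (K1%:R) (K2%:R) (k.+1%:R^-1) (birkhoff_sum f n x) => {HK1 HK2 nK ke}N k1 k2 q b.
move=> n0 Kn K10 K20 h1 h2 hk.
rewrite ler_distl; apply/andP; split.
  rewrite lerBlDr mulrC ler_pdivrMr//; nra.
rewrite -lerBlDr mulrC ler_pdivlMr//; nra.
Qed.

Lemma birkhoff_sum_bound f B n x : (forall x, `|f x| <= B) -> `|n%:R^-1 * birkhoff_sum f n x| <= B.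
Proof.
move=> fB; have B0 : 0 <= B by exact: le_trans (fB x).
case: n => [|n]; first by rewrite invr0 mul0r normr0.
rewrite normrM ger0_norm ?invr_ge0// mulrC ler_pdivrMr ?ltr0n//.
rewrite (le_trans (ler_norm_sum _ _ _))// (le_trans (ler_sum _ (fun i _ => fB _)))//.
by rewrite sumr_const card_ord mulr_natr.
Qed.

Lemma ergodic_L1 f B : measurable_fun setT f -> (forall x, `|f x| <= B) ->
  (\int[mu]_x (`| n%:R^-1 * birkhoff_sum f n x - \int[mu]_y f y |)%:E)%E @[n --> \oo]
    --> 0%E.
Proof.
move=> mf fB; set c := Rintegral _ _ _.
have mb n : measurable_fun setT (fun x => n%:R^-1 * birkhoff_sum f n x).
  by apply: measurable_funM => //; exact: measurable_birkhoff_sum.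
have [] := @dominated_convergence _ _ _ mu setT measurableT
  (fun n x => (n%:R^-1 * birkhoff_sum f n x)%:E) (cst c%:E) (EFin \o cst B).
- by move=> n; exact/measurable_EFinP.
- exact: measurable_cst.
- apply: filterS (ergodic_ae mf fB) => x cv _.
  by apply/cvg_EFin => //; exact: nearW.
- exact: finite_measure_integrable_cst.
- by apply: aeW => x n _ /=; rewrite lee_fin birkhoff_sum_bound.
by move=> _ + _; apply: cvg_trans; apply: near_eq_cvg; exact: nearW.
Qed.

End ergodic_theorem.

(** * Averages of functions depending on a parameter *)

Section parametrized.
Context d (T : measurableType d) (R : realType) (mu : probability T R).
Context d' (K : measurableType d') (kappa : {sigma_finite_measure set K -> \bar R}).

(** Tonelli gives measurability for nonnegative integrands, so [f] is raised by its bound and the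
    constant is subtracted afterwards. *)
Lemma measurable_Rintegral_param (f : T * K -> R) (B : R) :
  measurable_fun setT f -> (forall z, `|f z| <= B) ->
  measurable_fun setT (fun p => \int[mu]_x f (x, p)).
Proof.
move=> mf fB.
have mfB : measurable_fun setT (fun z => (f z + B)%:E).
  by apply/measurable_EFinP; exact: measurable_funD.
have fB0 z : (0 <= (f z + B)%:E)%E.
  by rewrite lee_fin; have := fB z; rewrite ler_norml => /andP[? _]; lra.
have -> : (fun p => \int[mu]_x f (x, p)) =
    (fun p => fine (fubini_G mu (fun z => (f z + B)%:E) p) - B).
  apply/funext => p; rewrite /fubini_G -/(Rintegral _ _ _).
  have mfp : measurable_fun setT (fun x => f (x, p)).
    by apply: (measurableT_comp mf); exact: measurable_pair2.
  rewrite RintegralD//.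
  - rewrite Rintegral_cst// (_ : fine _ = 1) ?mulr1 ?addrK//.
    by rewrite -[RHS]/(fine 1%E); congr fine; exact: probability_setT.
  - by apply: (@integrable_bounded _ _ _ _ _ _ B).
  - exact: finite_measure_integrable_cst.
apply: measurable_funB => //.
apply: measurableT_comp => //.
exact: (measurable_fun_fubini_tonelli_G (fun z => (f z + B)%:E)).
Qed.

Variable tau : T -> T.
Hypothesis mtau : measurable_fun setT tau.
Hypothesis tau_mu : forall A, measurable A -> mu (tau @^-1` A) = mu A.
Hypothesis tau_ergodic : forall A, measurable A -> tau @^-1` A = A ->
  mu A = 0%E \/ mu A = 1%E.

Variables (f : T * K -> R) (B : R) (k : K -> R).
Hypothesis mf : measurable_fun setT f.
Hypothesis fB : forall z, `|f z| <= B.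
Hypothesis mk : measurable_fun setT k.
Hypothesis k0 : forall p, 0 <= k p.
Hypothesis kfin : (\int[kappa]_p (k p)%:E < +oo)%E.

Let avg n x p := n%:R^-1 * birkhoff_sum tau (fun x => f (x, p)) n x.
Let ave p := \int[mu]_x f (x, p).

Lemma measurable_birkhoff_sum_param n :
  measurable_fun setT (fun z : T * K => birkhoff_sum tau (fun x => f (x, z.2)) n z.1).
Proof.
apply: measurable_sum => i; apply: (measurableT_comp mf).
apply: measurable_fun_pair => //=.
exact: (measurableT_comp (measurable_iter_tau mtau i)).
Qed.

Let F n (z : T * K) := (`|avg n z.1 z.2 - ave z.2| * k z.2)%:E.

Lemma measurable_avg_dev n : measurable_fun setT (F n).
Proof.
apply/measurable_EFinP; apply: measurable_funM; last exact: measurableT_comp.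
apply: measurableT_comp => //; apply: measurable_funB.
  by apply: measurable_funM => //; exact: measurable_birkhoff_sum_param.
apply: (measurableT_comp (measurable_Rintegral_param mf fB)) => //.
Qed.

(** The null set of the pointwise theorem may depend on [p]. After swapping the integrals it matters
    only inside the mean for a fixed [p], which tends to 0, and [(B + B) * k] dominates. *)
Lemma ergodic_L1_param :
  (\int[mu]_x \int[kappa]_p (`|avg n x p - ave p| * k p)%:E)%E
    @[n --> \oo] --> 0%E.
Proof.
have F0 n z : (0 <= F n z)%E by rewrite lee_fin mulr_ge0.
have mfp p : measurable_fun setT (fun x => f (x, p)).
  by apply: (measurableT_comp mf); exact: measurable_pair2.
have aveB p : `|ave p| <= B.
  have ifp : mu.-integrable setT (EFin \o (fun x => f (x, p))).
    by apply: (@integrable_bounded _ _ _ _ _ _ B).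
  rewrite (le_trans (le_normr_Rintegral _ _))//.
  have -> : B = \int[mu]_(x in setT) B.
    rewrite Rintegral_cst// (_ : fine _ = 1) ?mulr1//.
    by rewrite -[RHS]/(fine 1%E); congr fine; exact: probability_setT.
  apply: le_Rintegral => //.
  - by apply: (@integrable_bounded _ _ _ _ _ _ B) => //;
      [exact: measurableT_comp|move=> x _; rewrite normr_id].
  - exact: finite_measure_integrable_cst.
have avgB n x p : `|avg n x p| <= B by apply: birkhoff_sum_bound => y.
have -> : (fun n => \int[mu]_x \int[kappa]_p (`|avg n x p - ave p| * k p)%:E)%E =
    (fun n => \int[kappa]_p ((\int[mu]_x (`|avg n x p - ave p|)%:E) * (k p)%:E))%E.
  apply/funext => n; rewrite (fubini_tonelli (F n) (measurable_avg_dev n) (F0 n)).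
  apply: eq_integral => p _; rewrite -ge0_integralZr//=.
  - apply/measurable_EFinP; apply: measurableT_comp => //.
    apply: measurable_funB => //; apply: measurable_funM => //.
    exact: measurable_birkhoff_sum.
  - by rewrite lee_fin.
have [] := @dominated_convergence _ _ _ kappa setT measurableT
  (fun n p => (\int[mu]_x (`|avg n x p - ave p|)%:E) * (k p)%:E)%E (cst 0%E)
  (fun p => ((B + B)%:E * (k p)%:E)%E).
- move=> n; pose G := fubini_G mu (F n).
  apply: (eq_measurable_fun G); last first.
    exact: (measurable_fun_fubini_tonelli_G (F n) (measurable_avg_dev n)).
  move=> p _; rewrite /G /fubini_G -ge0_integralZr//=.
  - apply/measurable_EFinP; apply: measurableT_comp => //.
    apply: measurable_funB => //; apply: measurable_funM => //.
    exact: measurable_birkhoff_sum.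
  - by rewrite lee_fin.
- exact: measurable_cst.
- apply: aeW => p _; rewrite /= -[X in _ --> X](mul0e (k p)%:E).
  apply: cvgeZr => //.
  exact: (ergodic_L1 mtau tau_mu tau_ergodic (mfp p) (fun x => fB (x, p))).
- apply: integrableZl => //; apply/integrableP; split; first exact/measurable_EFinP.
  by under eq_integral do rewrite /= ger0_norm//.
- apply: aeW => p n _; rewrite abseM (gee0_abs (_ : 0 <= (k p)%:E)%E) ?lee_fin//.
  apply: lee_wpmul2r; first by rewrite lee_fin.
  rewrite gee0_abs ?integral_ge0//.
  rewrite -[leRHS]mule1 -(@probability_setT _ _ _ mu) -integral_cst//.
  apply: ge0_le_integral => //.
  - apply/measurable_EFinP; apply: measurableT_comp => //.
    apply: measurable_funB => //; apply: measurable_funM => //.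
    exact: measurable_birkhoff_sum.
  - by move=> x _; rewrite lee_fin (le_trans (ler_normB _ _))// lerD.
by move=> _ _; rewrite integral0.
Qed.

End parametrized.

(** * Lebesgue measure and measurability on row vectors *)

(** The pushforward agrees with the product measure on rectangles, and a product measure is
    determined by those. *)
Lemma product_measure_preserved (R : realType) d1 d2 (T1 : measurableType d1)
    (T2 : measurableType d2) (m1 : {sigma_finite_measure set T1 -> \bar R})
    (m2 : {sigma_finite_measure set T2 -> \bar R}) (f1 : T1 -> T1) (f2 : T2 -> T2) :
  measurable_fun setT f1 -> measurable_fun setT f2 ->
  (forall A, measurable A -> m1 (f1 @^-1` A) = m1 A) ->
  (forall A, measurable A -> m2 (f2 @^-1` A) = m2 A) ->
  forall A, measurable A ->
  (m1 \x m2)%E ((fun p => (f1 p.1, f2 p.2)) @^-1` A) = (m1 \x m2)%E A.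
Proof.
move=> mf1 mf2 m1f m2f A mA.
have mf : measurable_fun setT (fun p : T1 * T2 => (f1 p.1, f2 p.2)).
  apply: measurable_fun_pair => /=.
    by apply: measurableT_comp => //; exact: measurable_fst.
  by apply: measurableT_comp => //; exact: measurable_snd.
apply: esym.
apply: (@product_measure_unique _ _ _ _ _ m1 m2
  (measure_function_pushforward__canonical__measure_function_Measure (m1 \x m2)%E mf)) => //.
move=> B C mB mC /=; rewrite /pushforward.
have -> : (fun p => (f1 p.1, f2 p.2)) @^-1` (B `*` C) = (f1 @^-1` B) `*` (f2 @^-1` C) by [].
rewrite product_measure1E//; first by congr (_ * _)%E; [exact: m1f|exact: m2f].
- by rewrite -[X in measurable X]setTI; exact: mf1.
- by rewrite -[X in measurable X]setTI; exact: mf2.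
Qed.

Section lebesgue_rV_opp.
Context {R : realType}.

Lemma measurable_rV_opp n : measurable_fun setT (-%R : 'rV[R]_n -> 'rV[R]_n).
Proof.
apply: measurable_fun_rV => i.
rewrite (_ : _ \o _ = -%R \o rV_coord i).
  by apply: measurableT_comp => //; exact: measurable_rV_coord.
by apply/funext => v; rewrite /= /rV_coord mxE.
Qed.

(** Induction on the dimension: negation acts separately on the first coordinate and on the tail,
    and preserves each factor. *)
Lemma lebesgue_rV_opp n (A : set 'rV[R]_n) : measurable A ->
  lebesgue_rV n (-%R @^-1` A) = lebesgue_rV n A.
Proof.
elim: n A => [|n IH] A mA.
  rewrite /= !diracE (_ : (0 \in _ @^-1` A) = (0 \in A))//.
  by apply/idP/idP; rewrite !inE /= oppr0.
have mc B : measurable B -> measurable (@rV_cons R n @^-1` B).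
  by move=> mB; rewrite -[X in measurable X]setTI; exact: measurable_rV_cons.
rewrite /= /lebesgue_rVS /pushforward.
pose opp2 (p : R * 'rV[R]_n) := (- p.1, - p.2).
have opp_cons p : - rV_cons p = rV_cons (opp2 p).
  rewrite /rV_cons /= raddfN; exact: (@opp_row_mx R 1 1 n (p.1%:M) p.2).
have -> : @rV_cons R n @^-1` (-%R @^-1` A) = opp2 @^-1` (@rV_cons R n @^-1` A).
  by apply/seteqP; split => p; rewrite /preimage/= opp_cons.
apply: product_measure_preserved => //.
- exact: measurable_rV_opp.
- by move=> B mB; exact: lebesgue_measureN.
- exact: mc.
Qed.

Lemma ge0_integral_rV_opp n (f : 'rV[R]_n -> \bar R) : measurable_fun setT f ->
  (forall v, 0 <= f v)%E ->
  (\int[lebesgue_rV n]_v f (- v)%R = \int[lebesgue_rV n]_v f v)%E.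
Proof.
move=> mf f0.
have := ge0_integral_pushforward (@measurable_rV_opp n) (lebesgue_rV n) measurableT mf
  (fun v _ => f0 v).
rewrite preimage_setT => <-.
apply: eq_measure_integral => [|mo A mA _]; first exact: measurable_rV_opp.
by rewrite /= /pushforward; exact: lebesgue_rV_opp.
Qed.

End lebesgue_rV_opp.

Section measurable_rV_functions.
Context {R : realType} (m : nat).

Lemma measurable_dotv d (T : measurableType d) n (u v : T -> 'rV[R]_n) :
  measurable_fun setT u -> measurable_fun setT v ->
  measurable_fun setT (fun x => dotv (u x) (v x)).
Proof.
move=> mu mv; apply: measurable_sum => i.
apply: measurable_funM; exact: (measurableT_comp (measurable_rV_coord i)).
Qed.

Lemma measurable_enorm n : measurable_fun setT (@enorm R n).
Proof.
apply: measurableT_comp; first exact: (continuous_measurable_fun (@sqrt_continuous R)).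
by apply: measurable_dotv; exact: measurable_id.
Qed.

Lemma measurable_zvec d (T : measurableType d) (y l : T -> R) (x : T -> 'rV[R]_m) :
  measurable_fun setT y -> measurable_fun setT l -> measurable_fun setT x ->
  measurable_fun setT (fun t => zvec (y t) (l t) (x t)).
Proof.
move=> my ml mx; apply: measurable_fun_rV => i.
case: (@split_ordP 2 m i) => j ->.
- rewrite (_ : _ \o _ = fun t => if j == 0 then y t else l t).
    by case: (j == 0).
  by apply/funext => t; rewrite /= /rV_coord /zvec row_mxEl mxE.
- rewrite (_ : _ \o _ = rV_coord j \o x).
    by apply: measurableT_comp => //; exact: measurable_rV_coord.
  by apply/funext => t; rewrite /= /rV_coord /zvec row_mxEr.
Qed.

Lemma dotvNl n (u v : 'rV[R]_n) : dotv (- u) v = - dotv u v.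
Proof. by rewrite /dotv -sumrN; apply: eq_bigr => i _; rewrite mxE mulNr. Qed.

Lemma dotvC n (u v : 'rV[R]_n) : dotv u v = dotv v u.
Proof. by apply: eq_bigr => i _; rewrite mulrC. Qed.

Lemma coord_le_enorm n (v : 'rV[R]_n) i : `|v ord0 i| <= enorm v.
Proof.
rewrite /enorm -sqrtr_sqr ler_wsqrtr// /dotv (bigD1 i)//= expr2 lerDl.
by apply: sumr_ge0 => j _; rewrite -expr2 sqr_ge0.
Qed.

End measurable_rV_functions.

(** * Probability generating functions *)

(** The level sets of [N] are countably many. This serves powers with a random exponent and the cast
    of counts to reals. *)
Lemma measurable_fun_nat_index d d' (T : measurableType d) (U : measurableType d')
    (f : nat -> T -> U) (N : T -> nat) :
  (forall n, measurable_fun setT (f n)) -> measurable_fun setT N ->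
  measurable_fun setT (fun x => f (N x) x).
Proof.
move=> mf mN _ B mB; rewrite setTI.
have -> : (fun x => f (N x) x) @^-1` B =
    \bigcup_n (N @^-1` [set n] `&` f n @^-1` B).
  apply/seteqP; split => x /=; first by move=> Bx; exists (N x).
  by move=> [n _ [/= -> ]].
apply: bigcupT_measurable => n; apply: measurableI.
  by rewrite -[X in measurable X]setTI; exact: mN.
by rewrite -[X in measurable X]setTI; exact: mf.
Qed.

Section count_families.
Context {R : realType}.
Variable F : R -> probability nat R.

Definition clamp01 (u : R) : R := Num.max 0 (Num.min u 1).

Definition posval (l : R) : R := if 0 < l then l else 1.

(* Agrees with [pgf F] for [0 < l] and [0 <= u <= 1]; the truncation of the
   arguments makes it measurable and bounded everywhere. *)
Definition tpgf (l u : R) : R := pgf F (posval l) (clamp01 u).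

Lemma clamp01_itv u : 0 <= clamp01 u <= 1.
Proof. by rewrite /clamp01 le_max lexx/= ge_max ler01 ge_min lexx orbT. Qed.

Lemma clamp01_id u : 0 <= u <= 1 -> clamp01 u = u.
Proof. by move=> /andP[u0 u1]; rewrite /clamp01 min_l// max_r. Qed.

Lemma measurable_clamp01 : measurable_fun setT clamp01.
Proof. by apply: measurable_maxr => //; exact: measurable_minr. Qed.

Lemma tpgfE l u : 0 < l -> 0 <= u <= 1 -> tpgf l u = pgf F l u.
Proof. by move=> l0 u01; rewrite /tpgf /posval l0 clamp01_id. Qed.

Lemma sum_pmf (l : R) : (\sum_(0 <= k <oo) F l [set k] = 1)%E.
Proof.
rewrite -measure_semi_bigcup//.
- rewrite (_ : \bigcup_n [set n] = setT); first exact: probability_setT.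
  by apply/seteqP; split => // n _; exists n.
- by apply/trivIsetP => i j _ _ ij; apply/seteqP; split => // x [/= -> /eqP];
     rewrite (negbTE ij).
Qed.

Lemma pgf_sum_bounds l u : 0 <= u <= 1 ->
  (0 <= \sum_(0 <= k <oo) (u ^+ k)%:E * F l [set k] <= 1)%E.
Proof.
move=> /andP[u0 u1]; apply/andP; split.
  by apply: nneseries_ge0 => k _ _; rewrite mule_ge0// lee_fin exprn_ge0.
rewrite -(sum_pmf l); apply: lee_nneseries => [k _ _|k _].
  by rewrite mule_ge0// lee_fin exprn_ge0.
by rewrite -[leRHS]mul1e lee_wpmul2r// lee_fin exprn_ile1.
Qed.

Lemma pgf_EFin l u : 0 <= u <= 1 ->
  ((pgf F l u)%:E = \sum_(0 <= k <oo) (u ^+ k)%:E * F l [set k])%E.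
Proof.
move=> /(@pgf_sum_bounds l)/andP[h0 h1]; rewrite /pgf fineK//.
by rewrite ge0_fin_numE// (le_lt_trans h1)// ltry.
Qed.

Lemma pgf_itv l u : 0 <= u <= 1 -> 0 <= pgf F l u <= 1.
Proof.
by move=> u01; have := @pgf_sum_bounds l _ u01; rewrite -pgf_EFin// !lee_fin.
Qed.

Lemma tpgf_itv l u : 0 <= tpgf l u <= 1.
Proof. exact/pgf_itv/clamp01_itv. Qed.

Hypothesis Fmono : stochastically_ordered F.

(** Measurability in the intensity comes from monotonicity: the stochastic order makes the
    distribution function nonincreasing in [l]. *)
Lemma measurable_posval_cdf n :
  measurable_fun setT (fun l => fine (F (posval l) [set k | (k%:R <= n%:R :> R)%R])).
Proof.
pose A := [set k | (k%:R <= n%:R :> R)%R].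
(* The value 1 at nonpositive [l] keeps [c] nonincreasing on the whole line, since a distribution
   function is at most 1. *)
pose c l : R := if 0 < l then fine (F l A) else 1.
have finA l : F l A \is a fin_num by rewrite fin_num_measure.
have c1 l : fine (F l A) <= 1.
  by rewrite -lee_fin fineK// probability_le1.
have mc : measurable_fun setT c.
  apply: nonincreasing_measurable => // l1 l2 l12; rewrite /c.
  case: ifPn => l20; case: ifPn => l10 //.
  - by rewrite fine_le//; exact: Fmono.
  - by rewrite (lt_le_trans l10 l12) in l20.
rewrite [X in measurable_fun _ X](_ : _ =
    fun l => if 0 < l then c l else fine (F 1 A)); last first.
  by apply/funext => l; rewrite /c /posval; case: ifP.
by apply: measurable_fun_ifT => //; exact: measurable_fun_ltr.
Qed.

Lemma measurable_posval_pmf k : measurable_fun setT (fun l => F (posval l) [set k]).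
Proof.
rewrite [X in measurable_fun _ X](_ : _ =
    fun l => (fine (F (posval l) [set k]))%:E); last first.
  by apply/funext => l; rewrite fineK// fin_num_measure.
apply/measurable_EFinP; case: k => [|k].
  rewrite (_ : [set 0%N] = [set k | (k%:R <= 0%:R :> R)%R]).
    exact: measurable_posval_cdf.
  by apply/seteqP; split => j /=; rewrite ler_nat leqn0 => /eqP.
rewrite (_ : [set k.+1] = [set j | (j%:R <= k.+1%:R :> R)%R] `\`
                          [set j | (j%:R <= k%:R :> R)%R]); last first.
  apply/seteqP; split => j /=; rewrite !ler_nat.
    by move=> ->; rewrite leqnn ltnn.
  by move=> [j1 /negP]; rewrite -ltnNge => j2; apply/eqP; rewrite eqn_leq j1.
under eq_fun.
  move=> l; rewrite measureD//; last by rewrite ltey_eq fin_num_measure.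
  rewrite setIidr; last by move=> j /=; rewrite !ler_nat => /leq_trans; apply.
  rewrite fineB ?fin_num_measure//.
  over.
by apply: measurable_funB; exact: measurable_posval_cdf.
Qed.

Lemma measurable_tpgf d (T : measurableType d) (l u : T -> R) :
  measurable_fun setT l -> measurable_fun setT u ->
  measurable_fun setT (fun x => tpgf (l x) (u x)).
Proof.
move=> ml mu; apply: measurableT_comp => //.
apply: ge0_emeasurable_sum => [k x _ _|k _].
  by rewrite mule_ge0// lee_fin exprn_ge0//; case/andP : (clamp01_itv (u x)).
apply: emeasurable_funM.
  apply/measurable_EFinP; apply: measurable_funX.
  exact: (measurableT_comp measurable_clamp01 mu).
exact: (measurableT_comp (measurable_posval_pmf k) ml).
Qed.

Variable M1 : R.
Hypothesis hpgf : forall u l : R, 0 <= u <= 1 -> 0 < l ->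
     derivable (fun l' => pgf F l' u) l 1 /\
     `|derive1 (fun l' => pgf F l' u) l| < M1.

Lemma pgf_lipschitz u l1 l2 : 0 <= u <= 1 -> 0 < l1 -> 0 < l2 ->
  `|pgf F l1 u - pgf F l2 u| <= M1 * `|l1 - l2|.
Proof.
move=> u01; wlog l12 : l1 l2 / l1 <= l2 => [hw|] l10 l20.
  have [l12|/ltW l21] := leP l1 l2; first exact: hw.
  by rewrite distrC (distrC l1); exact: hw.
have dp x : x \in `]l1, l2[ -> is_derive x 1 (fun l => pgf F l u)
    (derive1 (fun l => pgf F l u) x).
  rewrite in_itv/= => /andP[l1x _].
  have [dx _] := hpgf u01 (lt_trans l10 l1x).
  by rewrite derive1E; exact: derivableP.
have cp : {within `[l1, l2], continuous (fun l => pgf F l u)}.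
  apply: derivable_within_continuous => x; rewrite in_itv/= => /andP[l1x _].
  by have [] := hpgf u01 (lt_le_trans l10 l1x).
have [c + E] := MVT_segment l12 dp cp.
rewrite in_itv/= => /andP[l1c _].
rewrite distrC (distrC l1) E normrM ler_wpM2r//.
by have [_ /ltW] := hpgf u01 (lt_le_trans l10 l1c).
Qed.

Lemma tpgf_lipschitz u l1 l2 : 0 < l1 -> 0 < l2 ->
  `|tpgf l1 u - tpgf l2 u| <= M1 * `|l1 - l2|.
Proof.
move=> l10 l20; rewrite /tpgf /posval l10 l20.
by apply: pgf_lipschitz => //; exact: clamp01_itv.
Qed.

End count_families.

(** * Conditioning on the past *)

Section integral_conditioning.
Local Open Scope ereal_scope.
Context d d' (T : measurableType d) (T' : measurableType d') (R : realType).
Variables (mu : {measure set T -> \bar R}) (pi : T -> T').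
Hypothesis mpi : measurable_fun setT pi.

Import HBNNSimple.

Let mfr (f : {nnsfun T' >-> R}) r : measurable (pi @^-1` (f @^-1` [set r])).
Proof. by rewrite -[X in measurable X]setTI; exact: mpi. Qed.

Let ge0_integral_sfun_weight (h : T -> R) (f : {nnsfun T' >-> R}) :
  measurable_fun setT h -> (forall x, 0 <= h x)%R ->
  \int[mu]_x (h x * f (pi x))%:E =
  \sum_(r \in range f) r%:E * \int[mu]_(x in pi @^-1` (f @^-1` [set r])) (h x)%:E.
Proof.
move=> mh h0.
under eq_integral.
  move=> x _; rewrite EFinM fimfunE -fsumEFin// ge0_mule_fsumr; last first.
    by move=> r; rewrite EFinM nnfun_muleindic_ge0.
  over.
have m1 r : measurable_fun setT (fun x => (\1_(f @^-1` [set r]) (pi x) : R)).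
  exact: (measurableT_comp (measurable_indic _) mpi).
rewrite ge0_integral_fsum//; last 2 first.
  - move=> r; apply: emeasurable_funM; first exact/measurable_EFinP.
    by apply/measurable_EFinP; apply: measurable_funM.
  - move=> r x _; rewrite mule_ge0 ?lee_fin//.
    by have := nnfun_muleindic_ge0 f r (pi x); rewrite -EFinM lee_fin.
apply: eq_fsbigr => r /[!inE] -[y _ <-].
rewrite (integral_mkcond (pi @^-1` _)) -ge0_integralZl//.
- apply: eq_integral => x _; rewrite patchE -EFinM mulrCA EFinM indicE.
  rewrite (_ : (x \in pi @^-1` _) = (pi x \in f @^-1` [set f y])); last first.
    by apply/idP/idP; rewrite !inE.
  by case: ifPn => _; rewrite ?mulr1 ?mulr0.
- by apply/(measurable_restrictT _ (mfr _ _)); apply/measurable_EFinP;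
     exact: measurable_funS mh.
- by move=> x _; rewrite patchE; case: ifP; rewrite ?lee_fin.
- by rewrite lee_fin.
Qed.

(** From indicators to simple functions to monotone limits. With [pi] the identity into a coarser
    sigma-algebra this is the step from the defining property of a conditional expectation on sets
    to its use against nonnegative variables. *)
Lemma ge0_integral_weight_eq (h1 h2 : T -> R) (phi : T' -> R) :
  measurable_fun setT h1 -> (forall x, 0 <= h1 x)%R ->
  measurable_fun setT h2 -> (forall x, 0 <= h2 x)%R ->
  measurable_fun setT phi -> (forall y, 0 <= phi y)%R ->
  (forall A, measurable A ->
    \int[mu]_(x in pi @^-1` A) (h1 x)%:E = \int[mu]_(x in pi @^-1` A) (h2 x)%:E) ->
  \int[mu]_x (h1 x * phi (pi x))%:E = \int[mu]_x (h2 x * phi (pi x))%:E.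
Proof.
move=> mh1 h10 mh2 h20 mphi phi0 h12.
have mphiE : measurable_fun setT (EFin \o phi) by exact/measurable_EFinP.
pose f := nnsfun_approx measurableT mphiE.
have key (h : T -> R) : measurable_fun setT h -> (forall x, 0 <= h x)%R ->
  (fun n => \sum_(r \in range (f n)) r%:E *
    \int[mu]_(x in pi @^-1` (f n @^-1` [set r])) (h x)%:E) @ \oo -->
  \int[mu]_x (h x * phi (pi x))%:E.
  move=> mh h0.
  under eq_fun do rewrite -ge0_integral_sfun_weight//.
  have -> : \int[mu]_x (h x * phi (pi x))%:E =
      \int[mu]_x limn (fun n => (h x * f n (pi x))%:E).
    apply: eq_integral => x _; apply/esym/cvg_lim => //.
    under eq_fun do rewrite EFinM.
    rewrite EFinM; apply: cvgeZl => //.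
    by apply: (cvg_nnsfun_approx (measurableT) mphiE) => // y _; rewrite lee_fin.
  apply: cvg_monotone_convergence => //.
  - move=> n; apply/measurable_EFinP; apply: measurable_funM => //.
    exact: (measurableT_comp _ mpi).
  - by move=> n x _; rewrite lee_fin mulr_ge0.
  - move=> x _ m n mn; rewrite lee_fin ler_wpM2l//.
    exact/lefP/nd_nnsfun_approx.
apply: (cvg_unique _ (key h1 mh1 h10)) => //.
have := key h2 mh2 h20; apply: cvg_trans; apply: near_eq_cvg; apply: nearW => n.
by apply: eq_fsbigr => r _; rewrite h12.
Qed.

End integral_conditioning.

Section conditional_pgf.
Context d (Omega : measurableType d) (R : realType) (P : probability Omega R).
Context d' (S : measurableType d') (Z : int -> Omega -> S).
Hypothesis mZ : forall t, measurable_fun setT (Z t).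
Variables (F : R -> probability nat R) (Y : Omega -> nat) (lam : Omega -> R) (t : int).
Hypothesis mY : measurable_fun setT Y.

(** The generators of [information Z t]. Their [g_sigma_algebraType] puts the past as a measurable
    structure on the carrier of [Omega], so that depending on the past becomes an instance of
    [measurable_fun]. *)
Definition past_gen (t : int) : set (set Omega) :=
  [set A | exists s (B : set S), [/\ (s <= t)%R, measurable B & A = Z s @^-1` B]].

Lemma measurable_past_id :
  measurable_fun setT (id : Omega -> g_sigma_algebraType (past_gen t)).
Proof.
move=> _ A mA; rewrite setTI; move: A mA.
apply: smallest_sub.
  split; [by rewrite preimage_set0; exact: measurable0| |].
  - by move=> A mA; rewrite setTD preimage_setC; exact: measurableC.
  - by move=> A mA; rewrite preimage_bigcup; exact: bigcupT_measurable.
move=> A [s [B [_ mB ->]]] /=; rewrite /preimage/=.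
by rewrite -[X in measurable X]setTI; exact: mZ.
Qed.

Lemma measurable_past s : (s <= t)%R ->
  measurable_fun setT (Z s : g_sigma_algebraType (past_gen t) -> S).
Proof.
by move=> st _ B mB; rewrite setTI; apply: sub_sigma_algebra; exists s, B.
Qed.

Hypothesis hlaw : conditional_law P Y (information Z t) (fun w => F (lam w)).

(** The conditional law is applied to the events [Y = k]; the power of [u] is the series of its
    values on these events, and termwise integration is allowed because all terms are
    nonnegative. *)
Lemma ge0_integral_conditional_pgf (u : R) (phi : g_sigma_algebraType (past_gen t) -> R) :
  0 <= u <= 1 -> measurable_fun setT phi -> (forall w, 0 <= phi w) ->
  (\int[P]_w (u ^+ Y w * phi w)%:E = \int[P]_w (pgf F (lam w) u * phi w)%:E)%E.
Proof.
move=> u01 mphi phi0; have /andP[u0 u1] := u01.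
have mphi' : measurable_fun setT (phi : Omega -> R).
  exact: (measurableT_comp mphi measurable_past_id).
have mYk k : measurable (Y @^-1` [set k]).
  by rewrite -[X in measurable X]setTI; exact: mY.
have mG D : information Z t D -> measurable D.
  by move=> GD; have := measurable_past_id measurableT GD; rewrite setTI.
have mp k : measurable_fun setT (fun w => F (lam w) [set k]).
  move=> _ D mD; rewrite setTI; apply: mG.
  by have [h _] := hlaw (B := [set k]) (I : measurable [set k]); exact: h.
have finF w k : F (lam w) [set k] \is a fin_num by rewrite fin_num_measure.
pose h1 k w : R := u ^+ k * \1_(Y @^-1` [set k]) w.
pose h2 k w : R := u ^+ k * fine (F (lam w) [set k]).
have mh1 k : measurable_fun setT (h1 k).
  by apply: measurable_funM => //; exact: measurable_indic.
have mh2 k : measurable_fun setT (h2 k).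
  by apply: measurable_funM => //; exact: measurableT_comp.
have h10 k w : 0 <= h1 k w by rewrite mulr_ge0// exprn_ge0.
have h20 k w : 0 <= h2 k w by rewrite mulr_ge0// ?exprn_ge0// fine_ge0.
have eq12 k : (\int[P]_w (h1 k w * phi w)%:E = \int[P]_w (h2 k w * phi w)%:E)%E.
  apply: (ge0_integral_weight_eq measurable_past_id) => // A mA.
  rewrite /preimage/=.
  have mA' : measurable (A : set Omega) by exact: mG.
  have [_ /(_ A mA) PA] := hlaw (B := [set k]) (I : measurable [set k]).
  transitivity ((u ^+ k)%:E * P (A `&` Y @^-1` [set k]))%E.
    under eq_integral do rewrite EFinM.
    rewrite ge0_integralZl//; [|exact/measurable_EFinP/measurable_funTS/measurable_indic..|].
      by rewrite integral_indic// setIC.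
    by rewrite lee_fin exprn_ge0.
  rewrite PA; under [RHS]eq_integral do rewrite EFinM fineK//.
  rewrite ge0_integralZl//; first exact: measurable_funTS.
  by rewrite lee_fin exprn_ge0.
(* In this series only the term with [k = Y w] survives. *)
transitivity (\int[P]_w (\sum_(0 <= k <oo) (h1 k w * phi w)%:E))%E.
  apply: eq_integral => w _.
  rewrite (nneseriesD1 (n := Y w))//; last by move=> k _; rewrite lee_fin mulr_ge0.
  rewrite eseries0 ?adde0; first by rewrite /h1 indicE mem_set// mulr1.
  move=> k _ /= kY; rewrite /h1 indicE memNset ?mulr0 ?mul0r//.
  by move=> /= Yk; rewrite Yk eqxx in kY.
transitivity (\int[P]_w (\sum_(0 <= k <oo) (h2 k w * phi w)%:E))%E.
  rewrite !integral_nneseries//.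
  - exact: eq_eseriesr.
  - by move=> k; apply/measurable_EFinP; exact: measurable_funM.
  - by move=> k w _; rewrite lee_fin mulr_ge0.
  - by move=> k; apply/measurable_EFinP; exact: measurable_funM.
  - by move=> k w _; rewrite lee_fin mulr_ge0.
apply: eq_integral => w _; rewrite EFinM pgf_EFin//.
under eq_eseriesr do rewrite EFinM muleC.
rewrite nneseriesZl//; last by move=> k _; rewrite lee_fin.
rewrite muleC; congr (_ * _)%E.
by apply: eq_eseriesr => k _; rewrite /h2 EFinM fineK.
Qed.

End conditional_pgf.

(** * Stationary intensity and path space *)

Section lam_stat_theory.
Context {R : realType}.

(** True for divergent series as well, because the real [limn] and [fine] both fall back to 0. So
    [lam_stat] can be studied through extended-real series before summability is known. *)
Lemma limn_series_fine (b : R^nat) : (forall n, 0 <= b n) ->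
  limn (series b) = fine (\sum_(0 <= n <oo) (b n)%:E)%E.
Proof.
move=> b0; have E : (fun n => \sum_(0 <= k < n) (b k)%:E)%E = EFin \o series b.
  by apply/funext => n; rewrite /= /series/= sumEFin.
rewrite E; have [cv|ncv] := pselect (cvgn (series b)).
  by rewrite EFin_lim.
rewrite [LHS](dvgP ncv); case: (boolP (limn (EFin \o series b) \is a fin_num)).
  (* A finite extended limit bounds the increasing partial sums, which then converge. *)
  move=> fn; exfalso; apply: ncv; apply: nondecreasing_is_cvgn.
    exact: nondecreasing_series.
  exists (fine (limn (EFin \o series b))) => _ [n _ <-].
  rewrite -lee_fin fineK//.
  have -> : (series b n)%:E = (\sum_(0 <= k < n) (b k)%:E)%E by rewrite sumEFin.
  by rewrite -E; apply: nneseries_lim_ge => k _ _; rewrite lee_fin.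
by rewrite fin_numE negb_and !negbK => /orP[]/eqP ->.
Qed.

Lemma dotv_ge0 n (u v : 'rV[R]_n) : (forall i, 0 <= u ord0 i) ->
  (forall i, 0 <= v ord0 i) -> 0 <= dotv u v.
Proof. by move=> u0 v0; apply: sumr_ge0 => i _; rewrite mulr_ge0. Qed.

Variables (d : measure_display) (T : measurableType d) (m : nat) (Y : int -> T -> nat) (X : int -> T -> 'rV[R]_m).
Hypothesis X0 : forall t w i, 0 <= X t w ord0 i.
Variable th : 'rV[R]_(3 + m).
Hypothesis ath : admissible th.

Definition input t w : R := alpha_of th * (Y t w)%:R + dotv (gamma_of th) (X t w).

Lemma input_ge0 t w : 0 <= input t w.
Proof.
have [_ a0 _ _ g0] := ath; rewrite addr_ge0//; first by rewrite mulr_ge0// ltW.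
by apply: dotv_ge0 => // i; exact: ltW.
Qed.

Lemma beta_ge0 : 0 <= beta_of th.
Proof. by have [_ _ /ltW] := ath. Qed.

Lemma beta_lt1 : beta_of th < 1.
Proof. by have [_ a0 _ ab _] := ath; lra. Qed.

(** The series inside [lam_stat], in the extended reals. Where it is infinite, [lam_stat] collapses
    to [omega / (1 - beta)] and its recursion can fail. *)
Definition past_input t w : \bar R :=
  (\sum_(0 <= j <oo) (beta_of th ^+ j * input (t - 1 - j%:Z) w)%:E)%E.

Lemma term_ge0 t w j : 0 <= beta_of th ^+ j * input (t - 1 - j%:Z) w.
Proof. by rewrite mulr_ge0 ?exprn_ge0 ?beta_ge0// input_ge0. Qed.

Lemma past_input_ge0 t w : (0 <= past_input t w)%E.
Proof. by apply: nneseries_ge0 => j _ _; rewrite lee_fin term_ge0. Qed.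

Lemma lam_statE t w :
  lam_stat Y X th t w = omega_of th / (1 - beta_of th) + fine (past_input t w).
Proof. by rewrite /lam_stat limn_series_fine//; exact: term_ge0. Qed.

Lemma lam_stat_gt0 t w : 0 < lam_stat Y X th t w.
Proof.
have [w0 _ _ _ _] := ath; rewrite lam_statE ltr_wpDr//.
  by rewrite fine_ge0// past_input_ge0.
by rewrite divr_gt0// subr_gt0 beta_lt1.
Qed.

Lemma past_inputS t w : past_input (t + 1) w =
  ((input t w)%:E + (beta_of th)%:E * past_input t w)%E.
Proof.
rewrite /past_input (nneseries_split 0%N 1%N)/=; last first.
  by move=> j _; rewrite lee_fin term_ge0.
rewrite add0n big_nat1 expr0 mul1r addrK subr0; congr (_ + _)%E.
rewrite -nneseriesZl; last by move=> j _; rewrite lee_fin term_ge0.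
rewrite -[LHS]nneseries_addn; last first.
  by move=> j; rewrite lee_fin mulr_ge0 ?exprn_ge0 ?beta_ge0// input_ge0.
apply: eq_eseriesr => j _; rewrite -EFinM mulrA -exprS addn1; congr (_ * input _ w)%:E.
lia.
Qed.

(** The constant [omega / (1 - beta)] is the fixed point of [r = omega + beta * r]; finiteness lets
    [fine] commute with the sum. *)
Lemma lam_stat_rec t w : (past_input t w < +oo)%E ->
  lam_stat Y X th (t + 1) w = h0 (zvec (Y t w)%:R (lam_stat Y X th t w) (X t w)) th.
Proof.
move=> fn; have b1 := beta_lt1.
have finp : past_input t w \is a fin_num by rewrite ge0_fin_numE// past_input_ge0.
rewrite !lam_statE past_inputS fineD//; last by rewrite fin_numM.
rewrite fineM//= /h0 /zvec row_mxKl row_mxKr !mxE/= /input.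
by clear fn finp; field; lra.
Qed.

(** Finiteness propagates forward along the recursion, so the null set of time 0 serves all later
    times. *)
Lemma past_input_lty n w : (past_input 0 w < +oo)%E -> (past_input n%:Z w < +oo)%E.
Proof.
move=> h; elim: n => [//|n IH]; rewrite -addn1 PoszD past_inputS.
by rewrite lte_add_pinfty ?ltry// lte_mul_pinfty// lee_fin beta_ge0.
Qed.

Lemma lam_stat_natS n w : (past_input 0 w < +oo)%E ->
  lam_stat Y X th n.+1%:Z w =
  h0 (zvec (Y n%:Z w)%:R (lam_stat Y X th n%:Z w) (X n%:Z w)) th.
Proof.
by move=> h; rewrite -(lam_stat_rec (past_input_lty n h)) -addn1 PoszD.
Qed.

Lemma measurable_input t : measurable_fun setT (Y t) -> measurable_fun setT (X t) ->
  measurable_fun setT (input t).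
Proof.
move=> mY mX; apply: measurable_funD.
  apply: measurable_funM => //.
  exact: (measurable_fun_nat_index (f := fun n _ => n%:R : R)).
exact: measurable_dotv.
Qed.

Lemma measurable_past_input t :
  (forall s, s < t -> measurable_fun setT (Y s)) ->
  (forall s, s < t -> measurable_fun setT (X s)) ->
  measurable_fun setT (past_input t).
Proof.
move=> mY mX; apply: ge0_emeasurable_sum => [j w _ _|j _].
  by rewrite lee_fin term_ge0.
apply/measurable_EFinP; apply: measurable_funM => //.
by apply: measurable_input; [apply: mY|apply: mX]; lia.
Qed.

Lemma measurable_lam_stat t :
  (forall s, s < t -> measurable_fun setT (Y s)) ->
  (forall s, s < t -> measurable_fun setT (X s)) ->
  measurable_fun setT (lam_stat Y X th t).
Proof.
move=> mY mX; rewrite (_ : lam_stat Y X th t = fun w =>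
  omega_of th / (1 - beta_of th) + fine (past_input t w)).
  apply: measurable_funD => //; apply: measurableT_comp => //.
  exact: measurable_past_input.
by apply/funext => w; exact: lam_statE.
Qed.

Lemma measurable_z_stat t :
  (forall s, s < t -> measurable_fun setT (Y s)) ->
  (forall s, s < t -> measurable_fun setT (X s)) ->
  measurable_fun setT (z_stat Y X th t).
Proof.
move=> mY mX; apply: measurable_zvec.
- apply: (measurable_fun_nat_index (f := fun n _ => n%:R : R)) => //.
  by apply: mY; lia.
- by apply: measurable_lam_stat => s st; [apply: mY|apply: mX]; lia.
- by apply: mX; lia.
Qed.

Lemma integral_past_input (mu : {measure set T -> \bar R}) (C : R) t :
  (forall s, measurable_fun setT (Y s)) -> (forall s, measurable_fun setT (X s)) ->
  (forall s, \int[mu]_w (input s w)%:E <= C%:E)%E ->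
  (\int[mu]_w past_input t w <= (C / (1 - beta_of th))%:E)%E.
Proof.
move=> mY mX inC; have b0 := beta_ge0; have b1 := beta_lt1.
rewrite integral_nneseries//; last 2 first.
- move=> j; apply/measurable_EFinP; apply: measurable_funM => //.
  exact: measurable_input.
- by move=> j w _; rewrite lee_fin term_ge0.
apply: lime_le.
  apply: is_cvg_nneseries => j _ _; apply: integral_ge0 => w _.
  by rewrite lee_fin term_ge0.
apply: nearW => n; apply: (@le_trans _ _ (\sum_(0 <= j < n) (beta_of th ^+ j * C)%:E)%E).
  apply: lee_sum => j _; under eq_integral do rewrite EFinM.
  rewrite ge0_integralZl//; last 3 first.
  - by apply/measurable_EFinP; exact: measurable_input.
  - by move=> w _; rewrite lee_fin input_ge0.
  - by rewrite lee_fin exprn_ge0.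
  by rewrite EFinM lee_wpmul2l// lee_fin exprn_ge0.
have C0 : 0 <= C.
  rewrite -lee_fin; apply: le_trans (inC 0); apply: integral_ge0 => w _.
  by rewrite lee_fin input_ge0.
rewrite sumEFin lee_fin -mulr_suml mulrC ler_wpM2l//.
rewrite big_mkord -[leRHS]mul1r ler_pdivlMr ?subr_gt0// mulrC.
have := subrX1 (beta_of th) n; set S := \sum_(_ < _) _ => E.
have -> : (1 - beta_of th) * S = 1 - beta_of th ^+ n.
  by rewrite -[LHS]opprK -mulNr opprB -E opprB.
by rewrite gerBl exprn_ge0.
Qed.

End lam_stat_theory.

Section path_space.
Context d (S : measurableType d).

Definition cylinders : set (set (int -> S)) :=
  [set C | exists t (B : set S), measurable B /\ C = [set x | B (x t)]].

Definition paths := g_sigma_algebraType cylinders.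

Lemma measurable_eval t : measurable_fun setT (fun x : paths => x t).
Proof.
move=> _ B mB; rewrite setTI; apply: sub_sigma_algebra.
by exists t, B.
Qed.

Lemma measurable_fun_paths d' (T : measurableType d') (f : T -> paths) :
  (forall t, measurable_fun setT (fun w => f w t)) -> measurable_fun setT f.
Proof.
move=> mf _ A mA; rewrite setTI; move: A mA; apply: smallest_sub.
  split; [by rewrite preimage_set0; exact: measurable0| |].
  - by move=> A mA; rewrite setTD preimage_setC; exact: measurableC.
  - by move=> A mA; rewrite preimage_bigcup; exact: bigcupT_measurable.
move=> A [t [B [mB ->]]] /=.
rewrite [X in measurable X](_ : _ = (fun w => f w t) @^-1` B)//.
by rewrite -[X in measurable X]setTI; exact: mf.
Qed.

Definition path_shift (x : paths) : paths := fun t => x (t + 1).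

Lemma measurable_path_shift : measurable_fun setT path_shift.
Proof. by apply: measurable_fun_paths => t; exact: measurable_eval. Qed.

Lemma iter_path_shift n (x : paths) t : iter n path_shift x t = x (t + n%:Z).
Proof.
elim: n t => [|n IH] t; first by rewrite addr0.
by rewrite iterS /path_shift IH; congr x; lia.
Qed.

Context d' (Omega : measurableType d') (R : realType) (P : probability Omega R).
Variable Z : int -> Omega -> S.
Hypothesis mZ : forall t, measurable_fun setT (Z t).

Definition path_of (w : Omega) : paths := fun t => Z t w.

Lemma measurable_path_of : measurable_fun setT path_of.
Proof. exact: measurable_fun_paths. Qed.

HB.instance Definition _ := isMeasurableFun.Build _ _ _ _ path_of measurable_path_of.

Definition path_law : probability paths R := distribution P path_of.

Lemma path_lawE A : path_law A = P [set w | A (fun t => Z t w)].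
Proof. by []. Qed.

Lemma path_law_shift : strictly_stationary P Z ->
  forall A, measurable A -> path_law (path_shift @^-1` A) = path_law A.
Proof. by move=> st A mA; rewrite !path_lawE -(st A 1 mA). Qed.

Lemma path_law_ergodic : ergodic P Z ->
  forall A, measurable A -> path_shift @^-1` A = A -> path_law A = 0%E \/ path_law A = 1%E.
Proof.
move=> eZ A mA sA; rewrite path_lawE; apply: eZ => // x.
by rewrite -{2}sA.
Qed.

Lemma ge0_integral_marginal (g : S -> \bar R) s : strictly_stationary P Z ->
  measurable_fun setT g -> (forall z, 0 <= g z)%E ->
  (\int[P]_w g (Z s w) = \int[P]_w g (Z 0 w))%E.
Proof.
move=> st mg g0.
have h t : (\int[pushforward P (Z t)]_z g z = \int[P]_w g (Z t w))%E.
  by rewrite (ge0_integral_pushforward (mZ t) P measurableT mg (fun z _ => g0 z)).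
rewrite -!h; apply: eq_measure_integral => A mA _.
have /= := st [set x | A (x 0)] s.
rewrite add0r; apply.
by apply: sub_sigma_algebra; exists 0, A.
Qed.

End path_space.

(** * Stability of the intensity recursion *)

Section trig_lipschitz.
Context {R : realType}.

Lemma lipschitz1_of_derive (f df : R -> R) : (forall x : R, is_derive x 1 f (df x)) ->
  (forall x, `|df x| <= 1) -> forall a b, `|f a - f b| <= `|a - b|.
Proof.
move=> fdf df1 a b; wlog ab : a b / a <= b => [hw|].
  have [/hw//|/ltW/hw] := leP a b; by rewrite distrC (distrC b).
have [|c _ E] := @MVT_segment R f df a b ab (fun x _ => fdf x).
  by apply: derivable_within_continuous => x _; have [] := fdf x.
by rewrite distrC (distrC a) E normrM ler_piMl.
Qed.

(** The flag selects the imaginary part ([true]) or the real part ([false]) of the complex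
    exponential, so that each estimate is made once for both. *)
Definition trig (s : bool) : R -> R := if s then sin else cos.

Lemma trig_le1 s x : `|trig s x| <= 1.
Proof. by rewrite /trig; case: s; [exact: sin_max|exact: cos_max]. Qed.

Lemma trig_lipschitz s a b : `|trig s a - trig s b| <= `|a - b|.
Proof.
rewrite /trig; case: s.
  by apply: (@lipschitz1_of_derive sin cos) => x; exact: cos_max.
apply: (@lipschitz1_of_derive cos (fun x => - sin x)) => x; rewrite normrN; exact: sin_max.
Qed.

Lemma measurable_trig s : measurable_fun setT (trig s).
Proof.
rewrite /trig; case: s; apply: continuous_measurable_fun.
- exact: continuous_sin.
- exact: continuous_cos.
Qed.

End trig_lipschitz.

Section recursion_stability.
Context {R : realType} (m : nat).
Variables (th0 th : 'rV[R]_(3 + m)) (y0 l0 : R) (y : nat -> nat) (x : nat -> 'rV[R]_m).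
Variable l : nat -> R.
Hypothesis ath : admissible th.
Hypothesis x0 : forall t i, 0 <= x t ord0 i.
Hypothesis l_ge0 : forall t, 0 <= l t.
Hypothesis l_rec : forall t, l t.+1 = h0 (zvec (y t)%:R (l t) (x t)) th0.
Variables (e rho : R).
Hypothesis th_e : enorm (th - th0) <= e.
Hypothesis beta_rho : beta_of th <= rho.
Hypothesis rho_lt1 : rho < 1.

(** Times [e], this bounds the effect on one step of [h0] of exchanging [th0] for [th]: every
    coefficient moves by at most [e] and multiplies one of these summands. *)
Definition regressors t : R := 1 + (y t)%:R + \sum_(i < m) x t ord0 i + l t.

Let dl t : R := `|lam_hat th y0 l0 y x t - l t|.
(** Mismatch between the artificial initial value and the actual count at time 0; [ylag] brings it
    in at the first step only. *)
Let q : R := `|y0 - (y 0)%:R|.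

Lemma coord_dist (i : 'I_(3 + m)) : `|th ord0 i - th0 ord0 i| <= e.
Proof. by have := le_trans (coord_le_enorm (th - th0) i) th_e; rewrite !mxE. Qed.

(** In the split difference the coefficient errors multiply the stationary [l t], while the fitted
    [beta_of th] multiplies the previous error. So the regressors are purely stationary and the
    contraction factor is that of the estimator. *)
Lemma lam_hat_step t :
  dl t.+1 <= e * regressors t + rho * dl t + (if t is 0 then q else 0).
Proof.
have [w0 a0 b0 ab g0] := ath.
have e0 : 0 <= e by rewrite (le_trans _ th_e)// sqrtr_ge0.
have b1 : beta_of th < 1 by lra.
have Dw : `|omega_of th - omega_of th0| <= e.
  by rewrite /omega_of !mxE; exact: coord_dist.
have Da : `|alpha_of th - alpha_of th0| <= e.
  by rewrite /alpha_of !mxE; exact: coord_dist.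
have Db : `|beta_of th - beta_of th0| <= e.
  by rewrite /beta_of !mxE; exact: coord_dist.
have Dg : `|dotv (gamma_of th) (x t) - dotv (gamma_of th0) (x t)| <=
    e * \sum_(i < m) x t ord0 i.
  rewrite /dotv -sumrB mulr_sumr (le_trans (ler_norm_sum _ _ _))//.
  apply: ler_sum => i _; rewrite -mulrBl normrM (ger0_norm (x0 t i)).
  by rewrite ler_wpM2r// /gamma_of !mxE; exact: coord_dist.
pose s : R := ylag y0 y t - (y t)%:R.
have sq : `|alpha_of th * s| <= (if t is 0 then q else 0).
  rewrite /s normrM (ger0_norm (ltW a0)).
  case: t {Dg s} => [|t] /=; last by rewrite subrr normr0 mulr0.
  by rewrite ler_piMl//; lra.

have -> : dl t.+1 = `|(omega_of th - omega_of th0) +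
    (alpha_of th - alpha_of th0) * (y t)%:R + alpha_of th * s +
    (beta_of th - beta_of th0) * l t +
    beta_of th * (lam_hat th y0 l0 y x t - l t) +
    (dotv (gamma_of th) (x t) - dotv (gamma_of th0) (x t))|.
  rewrite /dl /= l_rec /h0 /zvec !row_mxKl !row_mxKr !mxE/= /s; congr `|_|.
  by ring.
have tri (a b c f g k : R) : `|a + b + c + f + g + k| <=
    `|a| + `|b| + `|c| + `|f| + `|g| + `|k|.
  by do 5 (apply: le_trans (ler_normD _ _) _; rewrite lerD2r).
apply: le_trans (tri _ _ _ _ _ _) _; rewrite /regressors.
have h2 : `|(alpha_of th - alpha_of th0) * (y t)%:R| <= e * (y t)%:R.
  by rewrite normrM (ger0_norm (ler0n _ _)) ler_wpM2r.
have h4 : `|(beta_of th - beta_of th0) * l t| <= e * l t.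
  by rewrite normrM (ger0_norm (l_ge0 t)) ler_wpM2r.
have h5 : `|beta_of th * (lam_hat th y0 l0 y x t - l t)| <= rho * dl t.
  by rewrite normrM (ger0_norm (ltW b0)) ler_wpM2r.
rewrite (_ : e * _ + _ + _ = e + e * (y t)%:R + (if t is 0 then q else 0) +
    e * l t + rho * dl t + e * \sum_(i < m) x t ord0 i); first by rewrite !lerD.
by case: t {Dg s sq h2 h4 h5} => [|t]; ring.
Qed.

(* Telescoping the contraction: each step gains [(1 - rho) * dl]. *)
Lemma lam_hat_sum n :
  (1 - rho) * (\sum_(t < n) dl t.+1) + rho * dl n <=
  e * (\sum_(t < n) regressors t) + rho * dl 0 + (if n is 0 then 0 else q).
Proof.
elim: n => [|n IH]; first by rewrite !big_ord0 !mulr0 !add0r addr0.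
rewrite !big_ord_recr/=; have := lam_hat_step n; move: IH.
have : (if n is 0 then 0 else q) + (if n is 0 then q else 0) = q.
  by case: n => [|n]; rewrite ?add0r ?addr0.
move: (\sum_(t < n) dl t.+1) (\sum_(t < n) regressors t) => S V.
move: (if n is 0 then 0 else q) (if n is 0 then q else 0) => I J; nra.
Qed.

(** The errors [dl 0] and [q] join the left side because [z_hat] looks one step back; the [+ 1] in
    the constant pays for them. *)
Lemma lam_hat_sum_le n : 0 <= rho ->
  \sum_(t < n) dl t.+1 + dl 0 + q <=
  ((1 - rho)^-1 + 1) * (e * (\sum_(t < n) regressors t) + dl 0 + q).
Proof.
move=> rho0.
have dl0 t : 0 <= dl t by rewrite normr_ge0.
have q0 : 0 <= q by rewrite normr_ge0.
have e0 : 0 <= e by rewrite (le_trans _ th_e)// sqrtr_ge0.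
have r0 : 0 <= \sum_(t < n) regressors t.
  by apply: sumr_ge0 => t _; rewrite !addr_ge0//; exact: sumr_ge0.
have er0 := mulr_ge0 e0 r0.
have := lam_hat_sum n; set S := \sum_(t < n) dl t.+1.
set V := e * _ in er0 *; move=> H.
have HS : (1 - rho) * S <= V + dl 0 + q.
  have h1 : rho * dl 0 <= dl 0 by rewrite ler_piMl// ltW.
  have h2 : 0 <= rho * dl n by rewrite mulr_ge0.
  have h3 : (if n is 0 then 0 else q) <= q by case: (n).
  by apply: (le_trans _ (le_trans H _)); rewrite ?lerDl -?addrA ?lerD2l ?lerD.
rewrite mulrDl mul1r -addrA lerD//; last by rewrite lerD2r lerDr.
by rewrite mulrC ler_pdivlMr ?subr_gt0// mulrC.
Qed.

Variables (g : R -> R) (M1 : R).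
Hypothesis g01 : forall r, 0 <= g r <= 1.
Hypothesis gL : forall r1 r2, 0 < r1 -> 0 < r2 -> `|g r1 - g r2| <= M1 * `|r1 - r2|.
Hypothesis M1_ge0 : 0 <= M1.
Hypothesis l_gt0 : forall t, 0 < l t.
Hypothesis y0_ge0 : 0 <= y0.
Hypothesis l0_ge0 : 0 <= l0.

Lemma lam_hat_ge0 t : 0 <= lam_hat th y0 l0 y x t.
Proof.
have [w0 a0 b0 _ g0] := ath.
elim: t => [//|t IH] /=; rewrite /h0 /zvec row_mxKl row_mxKr !mxE/=.
rewrite !addr_ge0 ?mulr_ge0 ?(ltW a0) ?(ltW b0) ?(ltW w0)//.
  by case: t {IH} => [|t] /=.
by apply: dotv_ge0 => // i; exact: ltW.
Qed.

Lemma lam_hat_gt0 t : 0 < lam_hat th y0 l0 y x t.+1.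
Proof.
have [w0 a0 b0 _ g0] := ath.
rewrite /= /h0 /zvec row_mxKl row_mxKr !mxE/= -!addrA ltr_pwDl// !addr_ge0//.
- rewrite mulr_ge0 ?(ltW a0)//; by case: t => [|t] /=.
- by rewrite mulr_ge0 ?(ltW b0)// lam_hat_ge0.
by apply: dotv_ge0 => // i; exact: ltW.
Qed.

Lemma dotv_zvec (v : 'rV[R]_(2 + m)) (a a' b b' : R) (c : 'rV[R]_m) :
  `|dotv v (zvec a b c) - dotv v (zvec a' b' c)| <= enorm v * (`|a - a'| + `|b - b'|).
Proof.
have -> : dotv v (zvec a b c) - dotv v (zvec a' b' c) =
    v ord0 (lshift m ord0) * (a - a') + v ord0 (lshift m (lift ord0 ord0)) * (b - b').
  rewrite /dotv !big_split_ord/= !big_ord_recl !big_ord0 /zvec !row_mxEl !mxE/=.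
  rewrite (eq_bigr (fun i => v ord0 (rshift 2 i) * c ord0 i)); last first.
    by move=> i _; rewrite row_mxEr.
  rewrite [X in _ - (_ + X)](eq_bigr (fun i => v ord0 (rshift 2 i) * c ord0 i)).
    by ring.
  by move=> i _; rewrite row_mxEr.
apply: le_trans (ler_normD _ _) _; rewrite [leRHS]mulrDr !normrM.
by apply: lerD; apply: ler_wpM2r => //; exact: coord_le_enorm.
Qed.

Variables (s : bool) (u : R) (v : 'rV[R]_(2 + m)).
Hypothesis u01 : 0 <= u <= 1.

(** Both factors of a summand are bounded by 1, so the product moves by at most the sum of the two
    changes: [M1] times the intensity error from the generating function, and [enorm v] times the
    error of the lagged vector from the trigonometric factor. This is the origin of the first moment
    of [varpi]. *)
Lemma statistic_stability n :
  `|n%:R^-1 * (\sum_(t < n) (u ^+ y t.+1 - g (lam_hat th y0 l0 y x t.+1)) *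
        trig s (dotv v (z_hat th y0 l0 y x t.+1))) -
    n%:R^-1 * (\sum_(t < n) (u ^+ y t.+1 - g (l t.+1)) *
        trig s (dotv v (zvec (y t)%:R (l t) (x t))))| <=
  (M1 + enorm v) * (n%:R^-1 * (\sum_(t < n) dl t.+1 + dl 0 + q)).
Proof.
have [u0 u1] := andP u01.
rewrite -mulrBr normrM ger0_norm ?invr_ge0// mulrCA ler_wpM2l ?invr_ge0//.
rewrite -sumrB (le_trans (ler_norm_sum _ _ _))//.
have ev0 : 0 <= enorm v by rewrite sqrtr_ge0.
pose lag t : R := if t is 0 then q else 0.
have step t : `|(u ^+ y t.+1 - g (lam_hat th y0 l0 y x t.+1)) *
        trig s (dotv v (z_hat th y0 l0 y x t.+1)) -
     (u ^+ y t.+1 - g (l t.+1)) * trig s (dotv v (zvec (y t)%:R (l t) (x t)))| <=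
  M1 * dl t.+1 + enorm v * (lag t + dl t).
  set a := u ^+ _; set g1 := g (lam_hat _ _ _ _ _ _); set g2 := g (l _).
  set c1 := trig _ _; set c2 := trig _ _.
  have -> : (a - g1) * c1 - (a - g2) * c2 = - (g1 - g2) * c1 + (a - g2) * (c1 - c2).
    by ring.
  rewrite (le_trans (ler_normD _ _))// lerD//.
    rewrite normrM normrN (le_trans (_ : _ <= `|g1 - g2|))//.
      by rewrite ler_piMr// trig_le1.
    by apply: gL => //; exact: lam_hat_gt0.
  rewrite normrM (le_trans (_ : _ <= `|c1 - c2|))//.
    rewrite ler_piMl// ler_norml.
    have /andP[? ?] := g01 (l t.+1).
    have ? : 0 <= a by exact: exprn_ge0.
    have ? : a <= 1 by exact: exprn_ile1.
    by apply/andP; split; rewrite /g2; lra.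
  rewrite (le_trans (trig_lipschitz _ _ _))// /z_hat /=.
  rewrite (le_trans (dotv_zvec _ _ _ _ _ _))// ler_wpM2l// lerD2r.
  by case: t {a g1 g2 c1 c2} => [|t] /=; rewrite ?subrr ?normr0.
apply: (@le_trans _ _ (\sum_(t < n) (M1 * dl t.+1 + enorm v * (lag t + dl t)))).
  by apply: ler_sum => t _; exact: step.
rewrite big_split/= -!mulr_sumr big_split/=.
have lagq : \sum_(t < n) lag t <= q.
  case: n => [|n]; first by rewrite big_ord0 /q.
  by rewrite big_ord_recl/= big1 ?addr0.
(* The lagged errors are the same errors shifted by one index; dropping the last one leaves an upper
   bound. *)
have dlS : \sum_(t < n) dl t <= \sum_(t < n) dl t.+1 + dl 0.
  case: n {lagq} => [|n]; first by rewrite !big_ord0 add0r /dl.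
  rewrite big_ord_recl/= addrC lerD2r big_ord_recr/= lerDl.
  by rewrite /dl.
have dl0 : 0 <= dl 0 + q by rewrite addr_ge0// /dl /q.
rewrite mulrDl lerD//.
  by rewrite ler_wpM2l// -addrA lerDl.
rewrite ler_wpM2l// addrC lerD//.
Qed.

End recursion_stability.

(** * Weighted integrals *)

Section sigma_finite_product.
Context {R : realType} d1 d2 (T1 : measurableType d1) (T2 : measurableType d2).
Variables (m1 : {sigma_finite_measure set T1 -> \bar R})
  (m2 : {sigma_finite_measure set T2 -> \bar R}).

(** A name on which sigma-finiteness is registered, so that the product can itself be a factor in
    Tonelli's theorem. *)
Definition prod_measure : set (T1 * T2) -> \bar R := (m1 \x m2)%E.

HB.instance Definition _ := Measure.on prod_measure.

HB.instance Definition _ := Measure_isSigmaFinite.Build _ _ _ prod_measure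
  (sigma_finite_prod m1 m2).

End sigma_finite_product.

Section weighted_integral.
Context {R : realType} d1 d2 (T1 : measurableType d1) (T2 : measurableType d2).
Variables (m1 : {sigma_finite_measure set T1 -> \bar R})
  (m2 : {sigma_finite_measure set T2 -> \bar R}).
Local Notation K := (T1 * T2)%type.
Local Notation kappa := (m1 \x m2)%E.

Variables (D : set T1) (w : T1 -> R) (varpi : T2 -> R).
Hypothesis mD : measurable D.
Hypothesis mw : measurable_fun D w.
Hypothesis w0 : forall u, D u -> 0 < w u.
Hypothesis mvarpi : measurable_fun setT varpi.
Hypothesis varpi0 : forall v, 0 < varpi v.

(** Extending [w] by 0 outside [D] turns the iterated integral over [D] into a single integral over
    the whole product. *)
Definition weight (z : K) : R := (w \_ D) z.1 * varpi z.2.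

Lemma patch_w_ge0 u : 0 <= (w \_ D) u.
Proof. by rewrite patchE; case: ifPn => // /set_mem Du; exact/ltW/w0. Qed.

Lemma measurable_patch_w : measurable_fun setT (w \_ D).
Proof. exact/(measurable_restrictT _ mD). Qed.

Lemma weight_ge0 z : 0 <= weight z.
Proof. by rewrite mulr_ge0 ?patch_w_ge0// ltW. Qed.

Lemma measurable_weight : measurable_fun setT weight.
Proof.
apply: measurable_funM.
  exact: (measurableT_comp measurable_patch_w measurable_fst).
exact: (measurableT_comp mvarpi measurable_snd).
Qed.

Lemma iterated_weight (H : T1 -> T2 -> R) (G : K -> R) :
  (forall u v, D u -> H u v = G (u, v) * (w u * varpi v)) ->
  measurable_fun setT G -> (forall z, 0 <= G z) ->
  (\int[m1]_(u in D) \int[m2]_v (H u v)%:E =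
   \int[kappa]_z (G z * weight z)%:E)%E.
Proof.
move=> HG mG G0.
have mGw : measurable_fun setT (fun z : K => (G z * weight z)%:E).
  by apply/measurable_EFinP; apply: measurable_funM => //; exact: measurable_weight.
have Gw0 (z : K) : (0 <= (G z * weight z)%:E)%E.
  by rewrite lee_fin mulr_ge0// weight_ge0.
rewrite [RHS](fubini_tonelli1 (fun z : K => (G z * weight z)%:E) mGw Gw0).
rewrite integral_mkcond; apply: eq_integral => u _; rewrite patchE /fubini_F.
case: ifPn => u01.
  apply: eq_integral => v _; rewrite /weight/= patchE u01 HG//.
  exact: set_mem.
rewrite integral0_eq// => v _.
by rewrite /weight/= patchE (negbTE u01) mul0r mulr0.
Qed.

Lemma ge0_integral_weight_prod (g : T2 -> R) :
  measurable_fun setT g -> (forall v, 0 <= g v) ->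
  (\int[kappa]_z (g z.2 * weight z)%:E =
   (\int[m1]_(u in D) (w u)%:E) *
   \int[m2]_v (g v * varpi v)%:E)%E.
Proof.
move=> mg g0.
rewrite -(@iterated_weight (fun u v => w u * (g v * varpi v)) (fun z => g z.2))//.
- have mgv : measurable_fun setT (fun v => (g v * varpi v)%:E).
    by apply/measurable_EFinP; exact: measurable_funM.
  rewrite -ge0_integralZr//.
  + apply: eq_integral => u /set_mem Du.
    under eq_integral do rewrite EFinM.
    rewrite ge0_integralZl//.
    * by move=> v _; rewrite lee_fin mulr_ge0// ltW.
    * by rewrite lee_fin ltW// w0.
  + exact/measurable_EFinP.
  + by move=> u Du; rewrite lee_fin ltW// w0.
  + by apply: integral_ge0 => v _; rewrite lee_fin mulr_ge0// ltW.
- by move=> u v _; rewrite mulrCA.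
- exact: (measurableT_comp mg measurable_snd).
Qed.

Variable opp : T2 -> T2.
Hypothesis varpi_even : forall v, varpi v = varpi (opp v).
Hypothesis m2_opp : forall f : T2 -> \bar R, measurable_fun setT f ->
  (forall v, 0 <= f v)%E -> (\int[m2]_v f (opp v) = \int[m2]_v f v)%E.

(* The cross term [2 * C * S] is odd in [v] and integrates to [0]; stated with
   nonnegative integrands only. *)
Lemma integral_even_odd (C S : K -> R) :
  measurable_fun setT C -> measurable_fun setT S ->
  (forall u v, C (u, opp v) = C (u, v)) -> (forall u v, S (u, opp v) = - S (u, v)) ->
  (\int[kappa]_z ((C z + S z) ^+ 2 * weight z)%:E =
   \int[kappa]_z ((C z ^+ 2 + S z ^+ 2) * weight z)%:E)%E.
Proof.
move=> mC mS CN SN.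
have mk := measurable_weight; have k0 := weight_ge0.
have mG (f : K -> R) : measurable_fun setT f ->
    measurable_fun setT (fun z => (f z * weight z)%:E).
  by move=> mf; apply/measurable_EFinP; exact: measurable_funM.
have mf1 : measurable_fun setT (fun z => (C z + S z) ^+ 2).
  by apply: measurable_funX; exact: measurable_funD.
have mf2 : measurable_fun setT (fun z => (C z - S z) ^+ 2).
  by apply: measurable_funX; exact: measurable_funB.
have mf3 : measurable_fun setT (fun z => C z ^+ 2 + S z ^+ 2).
  by apply: measurable_funD; exact: measurable_funX.
(* Reflecting [v] leaves the weight and [C] unchanged and flips the sign of [S]. *)
have I12 : (\int[kappa]_z ((C z + S z) ^+ 2 * weight z)%:E =
            \int[kappa]_z ((C z - S z) ^+ 2 * weight z)%:E)%E.
  rewrite [LHS](fubini_tonelli1 _ (mG _ mf1)); last first.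
    by move=> z; rewrite lee_fin mulr_ge0// sqr_ge0.
  rewrite [RHS](fubini_tonelli1 _ (mG _ mf2)); last first.
    by move=> z; rewrite lee_fin mulr_ge0// sqr_ge0.
  apply: eq_integral => u _; rewrite /fubini_F.
  rewrite -(m2_opp (f := fun v => ((C (u, v) + S (u, v)) ^+ 2 * weight (u, v))%:E)).
  - apply: eq_integral => v _; rewrite CN SN; congr (_ * _)%:E.
    by rewrite /weight/= -varpi_even.
  - exact: (measurableT_comp (mG _ mf1) (measurable_pair1 u)).
  - by move=> v; rewrite lee_fin mulr_ge0// sqr_ge0.
set I := (X in X = _); set J := (X in _ = X).
(* Parallelogram identity: the squares of [C + S] and [C - S] add up to twice [C ^+ 2 + S ^+ 2].
   Halving is then legitimate since both integrals are nonnegative, possibly infinite. *)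
have IJ : (I + I = J + J)%E.
  rewrite {2}/I I12 /I /J -!ge0_integralD//;
    try exact: mG; try by move=> z _; rewrite lee_fin mulr_ge0// ?addr_ge0 ?sqr_ge0.
  apply: eq_integral => z _; rewrite -!EFinD; congr EFin; ring.
have I0 : (0 <= I)%E.
  by apply: integral_ge0 => z _; rewrite lee_fin mulr_ge0// sqr_ge0.
have J0 : (0 <= J)%E.
  by apply: integral_ge0 => z _; rewrite lee_fin mulr_ge0// addr_ge0// sqr_ge0.
move: I J I0 J0 IJ => [x| |] [y| |]// _ _.
by rewrite -!EFinD => -[xy]; congr EFin; lra.
Qed.

End weighted_integral.

(** * Residuals *)

Section residuals.
Context {R : realType} (m : nat).
Variables (F : R -> probability nat R) (th0 : 'rV[R]_(3 + m)).
Hypothesis Fmono : stochastically_ordered F.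
Hypothesis ath0 : admissible th0.

Local Notation S := (nat * R * 'rV[R]_m)%type.
Local Notation K := (measurableTypeR R * 'rV[R]_(2 + m))%type.

Definition absrow (v : 'rV[R]_m) : 'rV[R]_m := \row_i `|v ord0 i|.

Lemma absrow_id (v : 'rV[R]_m) : (forall i, 0 <= v ord0 i) -> absrow v = v.
Proof. by move=> v0; apply/rowP => i; rewrite mxE ger0_norm. Qed.

Lemma measurable_absrow : measurable_fun setT absrow.
Proof.
apply: measurable_fun_rV => i.
rewrite (_ : _ \o _ = Num.norm \o rV_coord i).
  by apply: measurableT_comp => //; exact: measurable_rV_coord.
by apply/funext => v; rewrite /= /rV_coord mxE.
Qed.

Definition pathY (t : int) (x : paths S) : nat := (x t).1.1.
(* The absolute value keeps [lam_stat] well behaved on all of path space; the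
   covariates are nonnegative along the actual process. *)
Definition pathX (t : int) (x : paths S) : 'rV[R]_m := absrow (x t).2.

(** The summand at time 1 of the stationary statistic as a function of the path, so that the one at
    time n + 1 is its value at the n-th shift. Truncated arguments keep it bounded by 1 for every
    real [u]. *)
Definition residual (s : bool) (z : paths S * K) : R :=
  (clamp01 z.2.1 ^+ pathY 1 z.1 - tpgf F (lam_stat pathY pathX th0 1 z.1) z.2.1) *
  trig s (dotv z.2.2 (z_stat pathY pathX th0 1 z.1)).

Lemma pathX_ge0 t x i : 0 <= pathX t x ord0 i.
Proof. by rewrite mxE. Qed.

Lemma measurable_pathY t : measurable_fun setT (pathY t).
Proof.
apply: (measurableT_comp measurable_fst).
exact: (measurableT_comp measurable_fst (measurable_eval t)).
Qed.

Lemma measurable_pathX t : measurable_fun setT (pathX t).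
Proof.
apply: (measurableT_comp measurable_absrow).
exact: (measurableT_comp measurable_snd (measurable_eval t)).
Qed.

Lemma residual_factor_le1 u l k : `|clamp01 u ^+ k - tpgf F l u| <= 1.
Proof.
have /andP[u0 u1] := clamp01_itv u; have /andP[g0 g1] := tpgf_itv F l u.
have c0 : 0 <= clamp01 u ^+ k by exact: exprn_ge0.
have c1 : clamp01 u ^+ k <= 1 by exact: exprn_ile1.
by rewrite ler_norml; apply/andP; split; lra.
Qed.

Lemma residual_bound s z : `|residual s z| <= 1.
Proof.
rewrite normrM -[leRHS]mulr1 ler_pM// ?trig_le1//.
exact: residual_factor_le1.
Qed.

Lemma measurable_residual_gen d (T : measurableType d) s (k : T -> nat)
    (l u : T -> R) (v z : T -> 'rV[R]_(2 + m)) :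
  measurable_fun setT k -> measurable_fun setT l -> measurable_fun setT u ->
  measurable_fun setT v -> measurable_fun setT z ->
  measurable_fun setT (fun x =>
    (clamp01 (u x) ^+ k x - tpgf F (l x) (u x)) * trig s (dotv (v x) (z x))).
Proof.
move=> mk ml mu mv mz; apply: measurable_funM.
  apply: measurable_funB; last exact: measurable_tpgf.
  apply: (measurable_fun_nat_index (f := fun n x => clamp01 (u x) ^+ n)) => // n.
  apply: measurable_funX; exact: (measurableT_comp measurable_clamp01 mu).
apply: (measurableT_comp (measurable_trig s)); exact: measurable_dotv.
Qed.

Lemma measurable_residual s : measurable_fun setT (residual s).
Proof.
apply: measurable_residual_gen.
- exact: (measurableT_comp (measurable_pathY 1) measurable_fst).
- apply: (measurableT_comp _ measurable_fst).
  apply: measurable_lam_stat => // [t x i|t _|t _].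
  + exact: pathX_ge0.
  + exact: measurable_pathY.
  + exact: measurable_pathX.
- exact: (measurableT_comp measurable_fst measurable_snd).
- exact: (measurableT_comp measurable_snd measurable_snd).
- apply: (measurableT_comp _ measurable_fst).
  apply: measurable_z_stat => // [t x i|t _|t _].
  + exact: pathX_ge0.
  + exact: measurable_pathY.
  + exact: measurable_pathX.
Qed.

Context d (Omega : measurableType d) (P : probability Omega R).
Variables (Y : int -> Omega -> nat) (X : int -> Omega -> 'rV[R]_m) (lamA : int -> Omega -> R).
Hypothesis mY : forall t, measurable_fun setT (Y t).
Hypothesis mX : forall t, measurable_fun setT (X t).
Hypothesis mlamA : forall t, measurable_fun setT (lamA t).
Hypothesis X0 : forall t w i, 0 <= X t w ord0 i.

Definition process (t : int) (w : Omega) : S := (Y t w, lamA t w, X t w).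

Lemma measurable_process t : measurable_fun setT (process t).
Proof.
apply: measurable_fun_pair => //=.
by apply: measurable_fun_pair.
Qed.

Lemma lam_stat_path t n w :
  lam_stat pathY pathX th0 t (iter n (@path_shift _ S) (path_of process w)) =
  lam_stat Y X th0 (t + n%:Z) w.
Proof.
rewrite /lam_stat; congr (_ + limn (series _)); apply/funext => j.
rewrite /pathY /pathX !iter_path_shift /path_of /process/= absrow_id//.
by rewrite (_ : t - 1 - j%:Z + n%:Z = t + n%:Z - 1 - j%:Z)//; lia.
Qed.

Lemma residual_path s n w (u : measurableTypeR R) v :
  residual s (iter n (@path_shift _ S) (path_of process w), (u, v)) =
  (clamp01 u ^+ Y n.+1%:Z w - tpgf F (lam_stat Y X th0 n.+1%:Z w) u) *
  trig s (dotv v (zvec (Y n%:Z w)%:R (lam_stat Y X th0 n%:Z w) (X n%:Z w))).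
Proof.
rewrite /residual /z_stat/= !lam_stat_path subrr add0r.
rewrite /pathY /pathX !iter_path_shift /path_of /process/= absrow_id// !add0r.
Qed.

Lemma Rintegral_residual s (p : K) :
  \int[path_law P measurable_process]_x residual s (x, p) =
  \int[P]_w residual s (path_of process w, p).
Proof.
have mp : measurable_fun setT (fun x => residual s (x, p)).
  exact: (measurableT_comp (measurable_residual s) (measurable_pair2 p)).
rewrite /Rintegral; congr fine.
apply: (integral_pushforward (measurable_path_of measurable_process)) => //.
  exact/measurable_EFinP.
rewrite preimage_setT.
apply: (@integrable_bounded _ _ _ _ _ _ 1) => //.
  exact: (measurableT_comp mp (measurable_path_of measurable_process)).
by move=> w _ /=; exact: residual_bound.
Qed.

End residuals.

(** * Conditional expectations and the function zeta *)

Section zeta_residual.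
Context {R : realType} (m : nat).
Variables (F : R -> probability nat R) (th0 : 'rV[R]_(3 + m)).
Hypothesis Fmono : stochastically_ordered F.
Hypothesis ath0 : admissible th0.
Context d (Omega : measurableType d) (P : probability Omega R).
Variables (Y : int -> Omega -> nat) (X : int -> Omega -> 'rV[R]_m) (lamA : int -> Omega -> R).
Hypothesis mY : forall t, measurable_fun setT (Y t).
Hypothesis mX : forall t, measurable_fun setT (X t).
Hypothesis mlamA : forall t, measurable_fun setT (lamA t).
Hypothesis X0 : forall t w i, 0 <= X t w ord0 i.
Hypothesis lamA0 : forall t w, 0 < lamA t w.
Hypothesis hlaw : conditional_law P (Y 1)
     (information (fun s w => (Y s w, X s w)) (1 - 1)) (fun w => F (lamA 1 w)).

Let Z (s : int) (w : Omega) := (Y s w, X s w).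
Let G := g_sigma_algebraType (past_gen Z (1 - 1)).

Let mZ t : measurable_fun setT (Z t).
Proof. exact: measurable_fun_pair. Qed.

(** [z_stat] at time 1 involves counts and covariates at times at most 0, which qualifies it as a
    weight when conditioning on the past. *)
Let measurable_z_past : measurable_fun setT (z_stat Y X th0 1 : G -> _).
Proof.
have mZG s : s < 1 -> measurable_fun setT (Z s : G -> _).
  by move=> s1; apply: measurable_past; lia.
apply: (@measurable_z_stat _ _ G) => // s s1.
- exact: (measurableT_comp measurable_fst (mZG s s1)).
- exact: (measurableT_comp measurable_snd (mZG s s1)).
Qed.

Let mz : measurable_fun setT (z_stat Y X th0 1).
Proof. by apply: measurable_z_stat. Qed.

Let ml : measurable_fun setT (lam_stat Y X th0 1).
Proof. by apply: measurable_lam_stat. Qed.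

Variables (u : R) (v : 'rV[R]_(2 + m)).
Hypothesis u01 : 0 < u < 1.

Let u01' : 0 <= u <= 1.
Proof. by have /andP[? ?] := u01; apply/andP; split; exact: ltW. Qed.

Let tr s w := trig s (dotv v (z_stat Y X th0 1 w)).

Let mtr s : measurable_fun setT (tr s).
Proof.
apply: (measurableT_comp (measurable_trig s)).
exact: measurable_dotv.
Qed.

Let Yu w : R := u ^+ Y 1 w.
Let gA w : R := tpgf F (lamA 1 w) u.
Let g0 w : R := tpgf F (lam_stat Y X th0 1 w) u.

Let mYu : measurable_fun setT Yu.
Proof. exact: (measurable_fun_nat_index (f := fun n _ => u ^+ n)). Qed.
Let mgA : measurable_fun setT gA. Proof. exact: measurable_tpgf. Qed.
Let mg0 : measurable_fun setT g0. Proof. exact: measurable_tpgf. Qed.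

Let BY w : `|Yu w| <= 1.
Proof. by have /andP[? ?] := u01'; rewrite ger0_norm ?exprn_ge0// exprn_ile1. Qed.
Let BA w : `|gA w| <= 1.
Proof. by have /andP[? ?] := tpgf_itv F (lamA 1 w) u; rewrite ger0_norm. Qed.
Let B0 w : `|g0 w| <= 1.
Proof. by have /andP[? ?] := tpgf_itv F (lam_stat Y X th0 1 w) u; rewrite ger0_norm. Qed.

Let itr (g : Omega -> R) s : measurable_fun setT g -> (forall w, `|g w| <= 1) ->
  P.-integrable setT (EFin \o (fun w => g w * tr s w)).
Proof.
move=> mg gB; apply: (@integrable_bounded _ _ _ _ _ _ 1) => //.
  exact: measurable_funM.
by move=> w _; rewrite normrM -[leRHS]mulr1 ler_pM// trig_le1.
Qed.

Let int1 (g : Omega -> R) : measurable_fun setT g -> (forall w, `|g w| <= 1) ->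
  P.-integrable setT (EFin \o g).
Proof. by move=> mg gB; apply: (@integrable_bounded _ _ _ _ _ _ 1). Qed.

(** The conditioning lemma takes nonnegative weights, and [tr s] changes sign. It is applied to the
    weights [1] and [1 + tr s], and the two identities are subtracted. *)
Lemma Rintegral_conditional s :
  \int[P]_w (Yu w * tr s w) = \int[P]_w (gA w * tr s w).
Proof.
have key (phi : G -> R) : measurable_fun setT phi -> (forall w, 0 <= phi w) ->
    \int[P]_w (Yu w * phi w) = \int[P]_w (gA w * phi w).
  move=> mphi phi0; rewrite /Rintegral.
  rewrite (ge0_integral_conditional_pgf mZ (mY 1) hlaw u01' mphi phi0).
  have -> : gA = (fun w => pgf F (lamA 1 w) u).
    by apply/funext => w; rewrite /gA tpgfE.
  by [].
have k1 := key (fun=> 1) (measurable_cst _) (fun=> ler01).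
have k2 := key (fun w => 1 + tr s w).
have {k1} k1 : \int[P]_w Yu w = \int[P]_w gA w.
  transitivity (\int[P]_w (Yu w * 1)); first by apply: eq_Rintegral => w _; rewrite mulr1.
  by rewrite k1; apply: eq_Rintegral => w _; rewrite mulr1.
have E (g : Omega -> R) : measurable_fun setT g -> (forall w, `|g w| <= 1) ->
    \int[P]_w (g w * (1 + tr s w)) = \int[P]_w g w + \int[P]_w (g w * tr s w).
  move=> mg gB; rewrite -RintegralD//; [|exact: int1|exact: itr].
  by apply: eq_Rintegral => w _; rewrite mulrDr mulr1.
move: k2; rewrite !E// k1 => /(_ _ _)/addrI; apply.
- apply: measurable_funD => //; apply: (measurableT_comp (measurable_trig s)).
  exact: measurable_dotv.
- by move=> w; have := trig_le1 s (dotv v (z_stat Y X th0 1 w));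
    rewrite ler_norml -/(tr s w) => /andP[? _]; lra.
Qed.

Lemma zeta_residual : zeta P F Y X lamA th0 u v =
  \int[P]_w residual F th0 false (path_of (process Y X lamA) w, (u, v)) +
  \int[P]_w residual F th0 true (path_of (process Y X lamA) w, (u, v)).
Proof.
have E s : \int[P]_w residual F th0 s (path_of (process Y X lamA) w, (u, v)) =
    \int[P]_w ((gA w - g0 w) * tr s w).
  transitivity (\int[P]_w (Yu w * tr s w - g0 w * tr s w)).
    apply: eq_Rintegral => w _.
    have := residual_path F th0 Y lamA X0 s 0 w u v; rewrite /= => ->.
    by rewrite clamp01_id// -mulrBl /tr /z_stat subrr.
  rewrite RintegralB//; [|exact: itr|exact: itr].
  rewrite Rintegral_conditional -RintegralB//; [|exact: itr|exact: itr].
  by apply: eq_Rintegral => w _; rewrite mulrBl.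
rewrite !E -RintegralD//.
- rewrite /zeta unlock /Rintegral; congr fine; apply: eq_integral => w _.
  rewrite /cas dotvC -mulrDr /gA /g0 !tpgfE//.
  exact: lam_stat_gt0.
- rewrite (_ : EFin \o _ = (EFin \o (fun w => (gA w * tr false w)%R)) \-
    (EFin \o (fun w => (g0 w * tr false w)%R)))%E; last first.
    by apply/funext => w; rewrite /= mulrBl.
  by apply: integrableB => //; exact: itr.
- rewrite (_ : EFin \o _ = (EFin \o (fun w => (gA w * tr true w)%R)) \-
    (EFin \o (fun w => (g0 w * tr true w)%R)))%E; last first.
    by apply/funext => w; rewrite /= mulrBl.
  by apply: integrableB => //; exact: itr.
Qed.

End zeta_residual.

(** * The statistic *)

Section weighted_deviation.
Context {R : realType} d (K : measurableType d) (kappa : {measure set K -> \bar R}).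
Variable k : K -> R.
Hypothesis mk : measurable_fun setT k.
Hypothesis k0 : forall z, 0 <= k z.
Hypothesis kfin : (\int[kappa]_z (k z)%:E < +oo)%E.

(** The bound [M] makes both integrals finite, so that their extended-real difference is the
    integral of the difference. *)
Lemma weighted_integral_dist (A B : K -> R) (M : R) :
  measurable_fun setT A -> measurable_fun setT B ->
  (forall z, 0 <= A z <= M) -> (forall z, 0 <= B z <= M) ->
  (`| \int[kappa]_z (A z * k z)%:E - \int[kappa]_z (B z * k z)%:E | <=
   \int[kappa]_z (`|A z - B z| * k z)%:E)%E.
Proof.
move=> mA mB AM BM.
have ik : kappa.-integrable setT (EFin \o k).
  apply/integrableP; split; first exact/measurable_EFinP.
  by under eq_integral do rewrite /= ger0_norm//.
have iw (f : K -> R) : measurable_fun setT f -> (forall z, 0 <= f z <= M) ->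
    kappa.-integrable setT (fun z => (f z * k z)%:E).
  move=> mf fM; apply: (@le_integrable _ _ _ kappa setT measurableT _ (fun z => M%:E * (k z)%:E)%E).
  - by apply/measurable_EFinP; exact: measurable_funM.
  - move=> z _ /=; rewrite lee_fin !normrM (ger0_norm (k0 z)) ler_wpM2r//.
    have /andP[f0 fz] := fM z; rewrite !ger0_norm//; exact: le_trans fz.
  - exact: integrableZl.
rewrite -integralB//; [|exact: iw|exact: iw].
apply: le_trans (le_abse_integral _ _ _) _ => //.
  by apply: emeasurable_funB; apply/measurable_EFinP; exact: measurable_funM.
rewrite le_eqVlt; apply/orP; left; apply/eqP; apply: eq_integral => z _.
by rewrite -EFinD /= -mulrBl normrM (ger0_norm (k0 z)).
Qed.

Variables (b : K -> R).
Hypothesis mb : measurable_fun setT b.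
Hypothesis b0 : forall z, 0 <= b z.

Lemma weighted_deviation_le (A B h1 h2 : K -> R) (M q : R) :
  measurable_fun setT A -> measurable_fun setT B ->
  measurable_fun setT h1 -> measurable_fun setT h2 ->
  (forall z, 0 <= h1 z) -> (forall z, 0 <= h2 z) -> 0 <= q ->
  (forall z, 0 <= A z <= M) -> (forall z, 0 <= B z <= M) ->
  (forall z, `|A z - B z| <= h1 z + h2 z + q * b z) ->
  (`| \int[kappa]_z (A z * k z)%:E - \int[kappa]_z (B z * k z)%:E | <=
   \int[kappa]_z (h1 z * k z)%:E + \int[kappa]_z (h2 z * k z)%:E +
   q%:E * \int[kappa]_z (b z * k z)%:E)%E.
Proof.
move=> mA mB mh1 mh2 h10 h20 q0 AM BM AB.
apply: le_trans (weighted_integral_dist mA mB AM BM) _.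
have mw (f : K -> R) : measurable_fun setT f ->
    measurable_fun setT (fun z => (f z * k z)%:E).
  by move=> mf; apply/measurable_EFinP; exact: measurable_funM.
have w0 (f : K -> R) : (forall z, 0 <= f z) -> forall z, setT z -> (0 <= (f z * k z)%:E)%E.
  by move=> f0 z _; rewrite lee_fin mulr_ge0.
rewrite -ge0_integralZl//; [|exact: mw|exact: w0].
have mqb : measurable_fun setT (fun z => (q%:E * (b z * k z)%:E)%E).
  by apply: measurable_funeM; exact: mw.
rewrite -ge0_integralD//; [|exact: w0|exact: mw|exact: w0|exact: mw].
rewrite -ge0_integralD//; last 3 first.
- by move=> z _; rewrite adde_ge0// w0.
- by apply: emeasurable_funD; exact: mw.
- by move=> z _; rewrite mule_ge0// w0.
apply: ge0_le_integral => //.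
- by move=> z _; rewrite lee_fin mulr_ge0.
- apply: mw; apply: measurableT_comp => //; exact: measurable_funB.
- by apply: emeasurable_funD => //; apply: emeasurable_funD; exact: mw.
- move=> z _; rewrite -EFinM -!EFinD lee_fin mulrA -!mulrDl ler_wpM2r//.
Qed.

End weighted_deviation.

Section statistic_real_form.
Context {R : realType}.

Lemma cis_sum n (e x : nat -> R) :
  (\sum_(t < n) (e t)%:C * cis (x t))%C =
  ((\sum_(t < n) e t * cos (x t)) +i* (\sum_(t < n) e t * sin (x t)))%C.
Proof.
elim: n => [|n IH]; first by rewrite !big_ord0.
rewrite !big_ord_recr/= IH /cis; apply/eqP; rewrite eq_complex /=.
by rewrite !mul0r subr0 addr0 !eqxx.
Qed.

Variable (m : nat) (F : R -> probability nat R) (th : 'rV[R]_(3 + m)).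
Variables (y0 l0 : R) (y : nat -> nat) (x : nat -> 'rV[R]_m).

(** The two real components of [D_stat], with truncated arguments that make them bounded by 1 and
    jointly measurable for all [u]. *)
Definition D_part (s : bool) n (u : R) (v : 'rV[R]_(2 + m)) : R :=
  n%:R^-1 * (\sum_(t < n) (clamp01 u ^+ y t.+1 -
       tpgf F (lam_hat th y0 l0 y x t.+1) u) *
     trig s (dotv v (z_hat th y0 l0 y x t.+1))).

Lemma normc_D_stat n u v : 0 < u < 1 ->
  (forall t, 0 < lam_hat th y0 l0 y x t.+1) ->
  Normc.normc (D_stat F th y0 l0 y x n u v) ^+ 2 =
  D_part false n u v ^+ 2 + D_part true n u v ^+ 2.
Proof.
move=> /andP[u0 u1] lh0; have u01 : 0 <= u <= 1 by rewrite !ltW.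
rewrite /D_stat big_add1/= big_mkord.
rewrite (cis_sum n (fun t => eps_hat F th y0 l0 y x t.+1 u)
  (fun t => dotv v (z_hat th y0 l0 y x t.+1))).
set a := \sum_(t < n) _ * cos _; set b := \sum_(t < n) _ * sin _.
have -> : ((n%:R^-1)%:C * (a +i* b) = (n%:R^-1 * a) +i* (n%:R^-1 * b))%C.
  by apply/eqP; rewrite eq_complex /= !mul0r subr0 addr0 !eqxx.
have -> : D_part false n u v = n%:R^-1 * a.
  congr (_ * _); apply: eq_bigr => t _; congr (_ * _).
  by rewrite /eps_hat clamp01_id// tpgfE.
have -> : D_part true n u v = n%:R^-1 * b.
  congr (_ * _); apply: eq_bigr => t _; congr (_ * _).
  by rewrite /eps_hat clamp01_id// tpgfE.
by rewrite /Normc.normc sqr_sqrtr// addr_ge0// sqr_ge0.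
Qed.

Lemma D_part_bound s n u v : `|D_part s n u v| <= 1.
Proof.
rewrite /D_part; case: n => [|n]; first by rewrite invr0 mul0r normr0.
rewrite normrM ger0_norm ?invr_ge0// mulrC ler_pdivrMr ?ltr0n// mul1r.
apply: le_trans (ler_norm_sum _ _ _) _.
have -> : n.+1%:R = \sum_(t < n.+1) (1 : R) by rewrite sumr_const card_ord.
apply: ler_sum => t _; rewrite normrM -[leRHS]mulr1 ler_pM// ?trig_le1//.
exact: residual_factor_le1.
Qed.

End statistic_real_form.

Section measurable_statistic.
Context {R : realType} (m : nat) d (T : measurableType d).
Variables (th : T -> 'rV[R]_(3 + m)) (y0 l0 : R) (y : nat -> T -> nat) (x : nat -> T -> 'rV[R]_m).
Hypothesis mth : measurable_fun setT th.
Hypothesis my : forall t, measurable_fun setT (y t).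
Hypothesis mx : forall t, measurable_fun setT (x t).

Lemma measurable_lsubmx_coord n1 n2 (z : T -> 'rV[R]_(n1 + n2)) i :
  measurable_fun setT z -> measurable_fun setT (fun w => lsubmx (z w) ord0 i).
Proof.
move=> mz; rewrite (_ : (fun _ => _) = rV_coord (lshift n2 i) \o z).
  by apply: measurableT_comp => //; exact: measurable_rV_coord.
by apply/funext => w; rewrite /rV_coord mxE.
Qed.

Lemma measurable_rsubmx n1 n2 (z : T -> 'rV[R]_(n1 + n2)) :
  measurable_fun setT z -> measurable_fun setT (fun w => rsubmx (z w)).
Proof.
move=> mz; apply: measurable_fun_rV => i.
rewrite (_ : _ \o _ = rV_coord (rshift n1 i) \o z).
  by apply: measurableT_comp => //; exact: measurable_rV_coord.
by apply/funext => w; rewrite /= /rV_coord mxE.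
Qed.

Lemma measurable_h0 (z : T -> 'rV[R]_(2 + m)) :
  measurable_fun setT z -> measurable_fun setT (fun w => h0 (z w) (th w)).
Proof.
move=> mz; apply: measurable_funD; last first.
  by apply: measurable_dotv; exact: measurable_rsubmx.
apply: measurable_funD; first apply: measurable_funD.
- exact: measurable_lsubmx_coord.
- by apply: measurable_funM; exact: measurable_lsubmx_coord.
- by apply: measurable_funM; exact: measurable_lsubmx_coord.
Qed.

Lemma measurable_ylag t : measurable_fun setT (fun w => ylag y0 (y ^~ w) t).
Proof.
case: t => [|t]; first exact: measurable_cst.
exact: (measurable_fun_nat_index (f := fun n _ => n%:R : R)).
Qed.

Lemma measurable_lam_hat t :
  measurable_fun setT (fun w => lam_hat (th w) y0 l0 (y ^~ w) (x ^~ w) t).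
Proof.
elim: t => [|t IH]; first exact: measurable_cst.
apply: measurable_h0; apply: measurable_zvec => //; exact: measurable_ylag.
Qed.

Lemma measurable_z_hat t :
  measurable_fun setT (fun w => z_hat (th w) y0 l0 (y ^~ w) (x ^~ w) t).
Proof.
apply: measurable_zvec => //; [exact: measurable_ylag|exact: measurable_lam_hat].
Qed.

Variable F : R -> probability nat R.
Hypothesis Fmono : stochastically_ordered F.

Lemma measurable_D_part s n (u : T -> R) (v : T -> 'rV[R]_(2 + m)) :
  measurable_fun setT u -> measurable_fun setT v ->
  measurable_fun setT
    (fun w => D_part F (th w) y0 l0 (y ^~ w) (x ^~ w) s n (u w) (v w)).
Proof.
move=> mu mv; apply: measurable_funM => //; apply: measurable_sum => t.
apply: (measurable_residual_gen Fmono s (my t.+1) (measurable_lam_hat t.+1) mu mv).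
exact: measurable_z_hat.
Qed.

End measurable_statistic.

(** * Moments *)

Section moments.
Context {R : realType} (m : nat) d (Omega : measurableType d) (P : probability Omega R).
Variables (Y : int -> Omega -> nat) (X : int -> Omega -> 'rV[R]_m) (lamA : int -> Omega -> R).
Hypothesis mY : forall t, measurable_fun setT (Y t).
Hypothesis mX : forall t, measurable_fun setT (X t).
Hypothesis mlamA : forall t, measurable_fun setT (lamA t).
Hypothesis X0 : forall t w i, 0 <= X t w ord0 i.
Hypothesis stat : strictly_stationary P (process Y X lamA).
Variables (pA qA : nat).
Hypothesis pA_gt0 : (1 <= pA)%N.
Hypothesis moment2 :
  ('E_P[fun w => ((enorm (z_alt Y X pA qA lamA 1 w)) ^+ 2)%R] < +oo)%E.

Let base t w : R := 1 + (Y t w)%:R + \sum_(i < m) X t w ord0 i.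

Let mbase t : measurable_fun setT (base t).
Proof.
apply: measurable_funD; first apply: measurable_funD => //.
  exact: (measurable_fun_nat_index (f := fun n _ => n%:R : R)).
apply: measurable_sum => i; exact: (measurableT_comp (measurable_rV_coord i)).
Qed.

Let base_ge0 t w : 0 <= base t w.
Proof. by rewrite !addr_ge0//; apply: sumr_ge0 => i _; exact: X0. Qed.

Let mz : measurable_fun setT (z_alt Y X pA qA lamA 1).
Proof.
apply: measurable_fun_rV => i.
case: (split_ordP i) => j ->.
  case: (split_ordP j) => k ->.
    rewrite (_ : _ \o _ = fun w => (Y (1 - 1 - k%:Z) w)%:R).
      exact: (measurable_fun_nat_index (f := fun n _ => n%:R : R)).
    by apply/funext => w; rewrite /= /rV_coord /z_alt !row_mxEl mxE.
  rewrite (_ : _ \o _ = lamA (1 - 1 - k%:Z))//.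
  by apply/funext => w; rewrite /= /rV_coord /z_alt row_mxEl row_mxEr mxE.
rewrite (_ : _ \o _ = rV_coord j \o X (1 - 1)).
  by apply: measurableT_comp => //; exact: measurable_rV_coord.
by apply/funext => w; rewrite /= /rV_coord /z_alt row_mxEr.
Qed.

Lemma integral_base_fin : (\int[P]_w (base 0 w)%:E < +oo)%E.
Proof.
pose N w := enorm (z_alt Y X pA qA lamA 1 w) ^+ 2.
have fN : (\int[P]_w (N w)%:E < +oo)%E by move: moment2; rewrite unlock.
have mN : measurable_fun setT N.
  by apply: measurable_funX; apply: measurableT_comp => //; exact: measurable_enorm.
have N0 w : 0 <= N w by exact: sqr_ge0.
have cN w i : `|z_alt Y X pA qA lamA 1 w ord0 i| <= 1 + N w.
  apply: le_trans (coord_le_enorm _ i) _; rewrite /N.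
  (* A norm is at most 1 plus its square, which trades the second moment for a first one. *)
  have := sqr_ge0 (enorm (z_alt Y X pA qA lamA 1 w) - 1).
  set e := enorm _; have e0 : 0 <= e by exact: sqrtr_ge0.
  rewrite sqrrB expr2 expr1n; nra.
(* The factor counts the summands of [base]: the constant, the count and the m covariates. By
   [pA_gt0] the count at time 0 is a coordinate of [z_alt] at time 1. *)
have baseN w : base 0 w <= m.+2%:R * (1 + N w).
  have hY : (Y 0 w)%:R <= 1 + N w.
    have := cN w (lshift m (lshift qA (Ordinal pA_gt0))).
    rewrite /z_alt !row_mxEl mxE (_ : _ - _ = 0 :> int)//.
    by rewrite ger0_norm.
  have hX i : X 0 w ord0 i <= 1 + N w.
    have := cN w (rshift (pA + qA) i).
    by rewrite /z_alt row_mxEr (_ : _ - _ = 0 :> int)// ger0_norm.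
  have hS : \sum_(i < m) X 0 w ord0 i <= m%:R * (1 + N w).
    have -> : m%:R * (1 + N w) = \sum_(i < m) (1 + N w).
      by rewrite sumr_const card_ord mulr_natl.
    by apply: ler_sum.
  rewrite /base -addn2 natrD mulrDl addrC lerD// mulr_natl mulr2n lerD//.
  by rewrite lerDl.
apply: (@le_lt_trans _ _ (\int[P]_w (m.+2%:R * (1 + N w))%:E)%E).
  apply: ge0_le_integral => //.
  - by move=> w _; rewrite lee_fin.
  - exact/measurable_EFinP.
  - by apply/measurable_EFinP; apply: measurable_funM => //; exact: measurable_funD.
  - by move=> w _; rewrite lee_fin.
under eq_integral do rewrite EFinM.
rewrite ge0_integralZl//; last 2 first.
- by apply/measurable_EFinP; exact: measurable_funD.
- by move=> w _; rewrite lee_fin addr_ge0.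
apply: lte_mul_pinfty => //.
under eq_integral do rewrite EFinD.
rewrite ge0_integralD//; last 2 first.
- by move=> w _; rewrite lee_fin.
- exact/measurable_EFinP.
rewrite integral_cst// lte_add_pinfty// mul1e.
by rewrite (_ : (_ < _)%E)//; exact: (le_lt_trans (probability_le1 P measurableT) (ltry _)).
Qed.

Lemma base_moment : exists C : R, forall t, (\int[P]_w (base t w)%:E <= C%:E)%E.
Proof.
exists (fine (\int[P]_w (base 0 w)%:E)) => t; rewrite fineK; last first.
  rewrite ge0_fin_numE ?integral_base_fin//.
  by apply: integral_ge0 => w _; rewrite lee_fin.
(* The absolute values make [g] nonnegative on the whole state space, where stationarity is applied;
   along the process they change nothing. *)
pose g (z : nat * R * 'rV[R]_m) : R := 1 + z.1.1%:R + \sum_(i < m) `|z.2 ord0 i|.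
have gE s w : base s w = g (process Y X lamA s w).
  rewrite /g/=; congr (_ + _); apply: eq_bigr => i _; rewrite ger0_norm//.
have mg : measurable_fun setT (fun z => (g z)%:E).
  apply/measurable_EFinP; apply: measurable_funD; first apply: measurable_funD => //.
    apply: (measurable_fun_nat_index (f := fun n _ => n%:R : R)) => //.
    exact: (measurableT_comp measurable_fst measurable_fst).
  apply: measurable_sum => i; apply: measurableT_comp => //.
  exact: (measurableT_comp (measurable_rV_coord i) measurable_snd).
have g0 z : (0 <= (g z)%:E)%E.
  by rewrite lee_fin !addr_ge0//; apply: sumr_ge0.
under eq_integral do rewrite gE.
under [in leRHS]eq_integral do rewrite gE.
by rewrite (ge0_integral_marginal (measurable_process mY mX mlamA) t stat mg g0).
Qed.

Variable th0 : 'rV[R]_(3 + m).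
Hypothesis ath0 : admissible th0.

Lemma past_input_moment : exists C : R, forall t,
  (\int[P]_w past_input Y X th0 t w <= C%:E)%E.
Proof.
have [C hC] := base_moment; have [w0 a0 b0 ab g0] := ath0.
(* [Ga] is at least 1, hence above [alpha_of th0], and at least every coordinate of
   [gamma_of th0]. *)
pose Ga : R := 1 + \sum_(i < m) gamma_of th0 ord0 i.
have Ga1 : 1 <= Ga by rewrite lerDl; apply: sumr_ge0 => i _; exact: ltW.
exists (Ga * C / (1 - beta_of th0)) => t.
apply: (integral_past_input X0 ath0) => // s.
have C0 : 0 <= C.
  rewrite -lee_fin; apply: le_trans (hC 0); apply: integral_ge0 => w _.
  by rewrite lee_fin.
apply: (@le_trans _ _ (\int[P]_w (Ga%:E * (base s w)%:E)%E)%E); last first.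
  rewrite ge0_integralZl//; last 3 first.
  - exact/measurable_EFinP.
  - by move=> w _; rewrite lee_fin.
  - by rewrite lee_fin; lra.
  by rewrite EFinM lee_wpmul2l// lee_fin; lra.
apply: ge0_le_integral => //.
- by move=> w _; rewrite lee_fin; exact: input_ge0.
- by apply/measurable_EFinP; exact: measurable_input.
- by apply: measurable_funeM; exact/measurable_EFinP.
- move=> w _; rewrite -EFinM lee_fin /input /base mulrDr lerD//.
    have Yw : 0 <= (Y s w)%:R :> R by [].
    have : alpha_of th0 * (Y s w)%:R <= (Y s w)%:R by rewrite ler_piMl//; lra.
    by move: Ga1 Yw; move: (_%:R) => yy; nra.
  rewrite /dotv mulr_sumr; apply: ler_sum => i _; rewrite ler_wpM2r//.
  rewrite /Ga (bigD1 i)//= addrCA lerDl addr_ge0//.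
  by apply: sumr_ge0 => j _; exact: ltW.
Qed.

Lemma past_input_ae : {ae P, forall w, (past_input Y X th0 0 w < +oo)%E}.
Proof.
have [C /(_ 0) hC] := past_input_moment.
have mp : measurable_fun setT (past_input Y X th0 0).
  by apply: measurable_past_input.
have ip : P.-integrable setT (past_input Y X th0 0).
  apply/integrableP; split => //.
  under eq_integral do rewrite gee0_abs ?past_input_ge0//.
  exact: le_lt_trans hC (ltry _).
have := integrable_ae measurableT ip; apply: filterS => w /(_ I).
by rewrite ge0_fin_numE// past_input_ge0.
Qed.

Lemma regressors_moment : exists C : R, forall t : nat,
  (\int[P]_w (regressors (fun t => Y t%:Z w) (fun t => X t%:Z w)
     (fun t => lam_stat Y X th0 t%:Z w) t)%:E <= C%:E)%E.
Proof.
have [C1 hC1] := base_moment; have [C2 hC2] := past_input_moment.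
pose a : R := omega_of th0 / (1 - beta_of th0).
have a0 : 0 <= a.
  have [/ltW ? _ _ _ _] := ath0.
  by rewrite divr_ge0// subr_ge0 ltW// beta_lt1.
exists (C1 + (a + C2)) => t.
have mp : measurable_fun setT (past_input Y X th0 t%:Z).
  by apply: measurable_past_input.
apply: (@le_trans _ _ (\int[P]_w ((base t%:Z w)%:E + (a%:E + past_input Y X th0 t%:Z w)))%E).
  apply: ge0_le_integral => //.
  - move=> w _; rewrite lee_fin addr_ge0//; first exact: (base_ge0 t%:Z).
    exact/ltW/lam_stat_gt0.
  - apply/measurable_EFinP; apply: measurable_funD; first exact: (mbase t%:Z).
    exact: measurable_lam_stat.
  - by apply: emeasurable_funD; [exact/measurable_EFinP|exact: emeasurable_funD].
  - move=> w _; rewrite /regressors EFinD leeD2l//.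
    rewrite lam_statE// EFinD leeD2l//.
    (* An inequality is what survives at infinite values, which [fine] sends to 0. *)
    have : (0 <= past_input Y X th0 t%:Z w)%E by exact: past_input_ge0.
    by case: past_input => [r| |]// _; exact: leey.
rewrite ge0_integralD//; last 4 first.
- by move=> w _; rewrite lee_fin.
- exact/measurable_EFinP.
- by move=> w _; rewrite adde_ge0 ?lee_fin// past_input_ge0.
- exact: emeasurable_funD.
rewrite EFinD leeD//.
rewrite ge0_integralD//; last by move=> w _; exact: past_input_ge0.
rewrite EFinD leeD// integral_cst//.
by rewrite -[leRHS]mule1 lee_wpmul2l ?lee_fin// probability_le1.
Qed.

End moments.

(** * Convergence in probability *)

Section cvg_to_zero.
Context {R : realType}.

Lemma cvge0_near_le (u : nat -> \bar R) (e : R) : 0 < e -> u @ \oo --> 0%E ->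
  \forall n \near \oo, (u n <= e%:E)%E.
Proof.
move=> e0 cu; have h : (0 < e%:E)%E by rewrite lte_fin.
have [N _ HN] := cu _ (open_ereal_lt' h).
by exists N => // n /HN /ltW.
Qed.

Lemma cvge0_of_near_le (u : nat -> \bar R) : (forall n, 0 <= u n)%E ->
  (forall e : R, 0 < e -> \forall n \near \oo, (u n <= e%:E)%E) -> u @ \oo --> 0%E.
Proof.
move=> u0 ue; have ufin (e : R) : 0 < e -> \forall n \near \oo, u n \is a fin_num.
  move=> e0; apply: filterS (ue e e0) => n un.
  by rewrite ge0_fin_numE// (le_lt_trans un)// ltry.
apply/fine_cvgP; split; first exact: ufin ltr01.
apply/cvgrPdist_le => e e0; apply: filterS2 (ufin e e0) (ue e e0) => n fn un.
by rewrite sub0r normrN ger0_norm ?fine_ge0// -lee_fin fineK.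
Qed.

End cvg_to_zero.

Lemma ge0_integral_lin3 d (T : measurableType d) (R : realType)
    (mu : {measure set T -> \bar R}) (f g h : T -> \bar R) (a b c : \bar R) :
  measurable_fun setT f -> measurable_fun setT g -> measurable_fun setT h ->
  (forall x, 0 <= f x)%E -> (forall x, 0 <= g x)%E -> (forall x, 0 <= h x)%E ->
  (0 <= a -> 0 <= b -> 0 <= c ->
  \int[mu]_x (a * f x + b * g x + c * h x) =
  a * (\int[mu]_x f x) + b * (\int[mu]_x g x) + c * \int[mu]_x h x)%E.
Proof.
move=> mf mg mh f0 g0 h0 a0 b0 c0.
have mZ (p : \bar R) (q : T -> \bar R) : measurable_fun setT q ->
    measurable_fun setT (fun x => p * q x)%E.
  by move=> mq; exact: measurable_funeM.
have pos (p : \bar R) (q : T -> \bar R) : (0 <= p)%E -> (forall x, 0 <= q x)%E ->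
    forall x, setT x -> (0 <= p * q x)%E.
  by move=> p0 q0 x _; exact: mule_ge0.
rewrite ge0_integralD//; last 4 first.
- by move=> x _; rewrite adde_ge0// pos.
- by apply: emeasurable_funD; exact: mZ.
- exact: pos.
- exact: mZ.
rewrite ge0_integralD//; [|exact: pos|exact: mZ|exact: pos|exact: mZ].
by rewrite !ge0_integralZl.
Qed.

(** * Comparison of the statistic with its limit *)

Section consistency.
Context {R : realType} (m : nat) d (Omega : measurableType d) (P : probability Omega R).
Variables (F : R -> probability nat R) (M1 : R) (th0 : 'rV[R]_(3 + m)).
Hypothesis Fmono : stochastically_ordered F.
Hypothesis M1_gt0 : 0 < M1.
Hypothesis hpgf : forall u l : R, 0 <= u <= 1 -> 0 < l ->
     derivable (fun l' => pgf F l' u) l 1 /\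
     `|derive1 (fun l' => pgf F l' u) l| < M1.
Hypothesis ath0 : admissible th0.
Variables (Y : int -> Omega -> nat) (X : int -> Omega -> 'rV[R]_m) (lamA : int -> Omega -> R).
Hypothesis mY : forall t, measurable_fun setT (Y t).
Hypothesis mX : forall t, measurable_fun setT (X t).
Hypothesis mlamA : forall t, measurable_fun setT (lamA t).
Hypothesis X0 : forall t w i, 0 <= X t w ord0 i.
Hypothesis stat : strictly_stationary P (process Y X lamA).
Hypothesis erg : ergodic P (process Y X lamA).

Local Notation S := (nat * R * 'rV[R]_m)%type.
Local Notation K := (measurableTypeR R * 'rV[R]_(2 + m))%type.
Local Notation kappa := (@lebesgue_measure R \x lebesgue_rV (2 + m))%E.

Variables (w : R -> R) (varpi : 'rV[R]_(2 + m) -> R).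
Hypothesis mw : measurable_fun (`]0%R, 1%R[ : set R) w.
Hypothesis w_gt0 : forall u : R, 0 < u < 1 -> 0 < w u.
Hypothesis mvarpi : measurable_fun setT varpi.
Hypothesis varpi_gt0 : forall v, 0 < varpi v.
Hypothesis w_int : (\int[@lebesgue_measure R]_(u in `]0%R, 1%R[) (w u)%:E < +oo)%E.
Hypothesis varpi_int0 : (\int[lebesgue_rV (2 + m)]_v (varpi v)%:E < +oo)%E.
Hypothesis varpi_int1 : (\int[lebesgue_rV (2 + m)]_v (enorm v * varpi v)%:E < +oo)%E.

Let kap : {sigma_finite_measure set K -> \bar R} :=
  prod_measure (@lebesgue_measure R) (lebesgue_rV (2 + m)).

Local Notation D := (`]0%R, 1%R[%classic : set (measurableTypeR R)).

Let k : K -> R := weight D w varpi.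

Let D_gt0 u : D u -> 0 < w u.
Proof. by rewrite /= in_itv/=; exact: w_gt0. Qed.

Let mD : measurable D. Proof. exact: measurable_itv. Qed.

Let mk : measurable_fun setT k.
Proof. exact: measurable_weight. Qed.

Let k_ge0 z : 0 <= k z.
Proof. exact: weight_ge0. Qed.

Let ge0_fin_mul (x y : \bar R) : (0 <= x -> x < +oo -> 0 <= y -> y < +oo -> x * y < +oo)%E.
Proof.
by move=> x0 xf y0 yf; apply: lte_mul_pinfty => //; rewrite ge0_fin_numE.
Qed.

Lemma weight_moment1 : (\int[kappa]_z ((M1 + enorm z.2) * k z)%:E < +oo)%E.
Proof.
rewrite (@ge0_integral_weight_prod _ _ _ _ _ _ _ D w varpi mD mw D_gt0 mvarpi varpi_gt0
  (fun v => M1 + enorm v)).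
- apply: ge0_fin_mul => //.
  + by apply: integral_ge0 => u Du; rewrite lee_fin ltW// D_gt0.
  + apply: integral_ge0 => v _; rewrite lee_fin mulr_ge0 ?(ltW (varpi_gt0 _))//.
    by rewrite addr_ge0 ?(ltW M1_gt0)// sqrtr_ge0.
  under eq_integral do rewrite mulrDl EFinD.
  rewrite ge0_integralD//.
  + apply: lte_add_pinfty => //.
    under eq_integral do rewrite EFinM.
    rewrite ge0_integralZl//.
    * by rewrite lte_mul_pinfty// lee_fin ltW.
    * exact/measurable_EFinP.
    * by move=> v _; rewrite lee_fin ltW.
    * by rewrite lee_fin ltW.
  + by move=> v _; rewrite lee_fin mulr_ge0// ltW.
  + by apply/measurable_EFinP; exact: measurable_funM.
  + by move=> v _; rewrite lee_fin mulr_ge0 ?sqrtr_ge0// ltW.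
  + by apply/measurable_EFinP; apply: measurable_funM => //; exact: measurable_enorm.
- by apply: measurable_funD => //; exact: measurable_enorm.
- by move=> v; rewrite addr_ge0 ?(ltW M1_gt0)// sqrtr_ge0.
Qed.

Lemma weight_fin : (\int[kappa]_z (k z)%:E < +oo)%E.
Proof.
rewrite (_ : (\int[kappa]_z (k z)%:E = \int[kappa]_z (1 * k z)%:E)%E); last first.
  by apply: eq_integral => z _; rewrite mul1r.
rewrite (@ge0_integral_weight_prod _ _ _ _ _ _ _ D w varpi mD mw D_gt0 mvarpi varpi_gt0
  (fun=> 1))//.
apply: ge0_fin_mul => //.
- by apply: integral_ge0 => u Du; rewrite lee_fin ltW// D_gt0.
- by apply: integral_ge0 => v _; rewrite lee_fin mul1r ltW.
- by under eq_integral do rewrite mul1r.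
Qed.

Let tau := @path_shift _ S.
Let mproc := measurable_process mY mX mlamA.
Let Pl := path_law P mproc.
Let pth := path_of (process Y X lamA).
Let mpth : measurable_fun setT pth := measurable_path_of mproc.

Definition stat_part s n (x : paths S) (p : K) : R :=
  n%:R^-1 * birkhoff_sum tau (fun x => residual F th0 s (x, p)) n x.

(** The cosine part [C] for [false] and the sine part [S] for [true]. *)
Definition limit_part s (p : K) : R := \int[Pl]_x residual F th0 s (x, p).

Definition deviation s n (o : Omega) : \bar R :=
  (\int[kappa]_p (`|stat_part s n (pth o) p - limit_part s p| * k p)%:E)%E.

Let mres s := measurable_residual Fmono ath0 s.
Let res1 s := residual_bound F th0 s.

Let mdevz s n : measurable_fun setT (fun z : paths S * K =>
  (`|stat_part s n z.1 z.2 - limit_part s z.2| * k z.2)%:E).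
Proof. exact: (measurable_avg_dev Pl (measurable_path_shift (S:=S)) (mres s) (res1 s) mk). Qed.

Let devz0 s n (z : paths S * K) :
  (0 <= (`|stat_part s n z.1 z.2 - limit_part s z.2| * k z.2)%:E)%E.
Proof. by rewrite lee_fin mulr_ge0. Qed.

Lemma measurable_deviation s n : measurable_fun setT (deviation s n).
Proof.
have mG := measurable_fun_fubini_tonelli_F (m2 := kap) _ (mdevz s n) (devz0 s n).
exact: (measurableT_comp mG mpth).
Qed.

Lemma deviation_cvg s : (\int[P]_o deviation s n o)%E @[n --> \oo] --> 0%E.
Proof.
have := ergodic_L1_param (kappa := kap) (measurable_path_shift (S:=S))
  (path_law_shift mproc stat) (path_law_ergodic mproc erg) (mres s) (res1 s) mk k_ge0
  weight_fin.
apply: cvg_trans; apply: near_eq_cvg; apply: nearW => n.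
have mG := measurable_fun_fubini_tonelli_F (m2 := kap) _ (mdevz s n) (devz0 s n).
rewrite (ge0_integral_pushforward mpth P measurableT mG)//.
by move=> x _; apply: integral_ge0.
Qed.

Lemma limit_part_bound s p : `|limit_part s p| <= 1.
Proof.
have mp : measurable_fun setT (fun x => residual F th0 s (x, p)).
  exact: (measurableT_comp (mres s) (measurable_pair2 p)).
rewrite /limit_part (le_trans (le_normr_Rintegral _ _))//.
  by apply: (@integrable_bounded _ _ _ _ _ _ 1).
have -> : 1 = \int[Pl]_(x in setT) (1 : R).
  rewrite Rintegral_cst// mul1r -[LHS]/(fine 1%E); congr fine.
  exact/esym/probability_setT.
apply: le_Rintegral => //.
- apply: (@integrable_bounded _ _ _ _ _ _ 1) => //.
    exact: measurableT_comp.
  by move=> x _; rewrite normr_id.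
- exact: finite_measure_integrable_cst.
Qed.

Lemma measurable_limit_part s : measurable_fun setT (limit_part s).
Proof. exact: (measurable_Rintegral_param _ (mres s) (res1 s)). Qed.

Lemma measurable_stat_part s n o : measurable_fun setT (stat_part s n (pth o)).
Proof.
apply: measurable_funM => //; apply: measurable_sum => i.
exact: (measurableT_comp (mres s) (measurable_pair1 _)).
Qed.

Variables (thh : nat -> Omega -> 'rV[R]_(3 + m)) (y0 l0 : R).
Hypothesis mthh : forall n, measurable_fun setT (thh n).
Hypothesis athh : forall n o, admissible (thh n o).
Hypothesis y0_ge0 : 0 <= y0.
Hypothesis l0_ge0 : 0 <= l0.

Let Yn (o : Omega) (t : nat) := Y t%:Z o.
Let Xn (o : Omega) (t : nat) := X t%:Z o.
Let ln (o : Omega) (t : nat) : R := lam_stat Y X th0 t%:Z o.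

Definition stat_density n (z : Omega * K) : R :=
  D_part F (thh n z.1) y0 l0 (Yn z.1) (Xn z.1) false n z.2.1 z.2.2 ^+ 2 +
  D_part F (thh n z.1) y0 l0 (Yn z.1) (Xn z.1) true n z.2.1 z.2.2 ^+ 2.

Lemma stat_density_itv n z : 0 <= stat_density n z <= 2.
Proof.
have h s : D_part F (thh n z.1) y0 l0 (Yn z.1) (Xn z.1) s n z.2.1 z.2.2 ^+ 2 <= 1.
  by rewrite -[leLHS]real_normK ?num_real// expr_le1// D_part_bound.
by rewrite /stat_density addr_ge0 ?sqr_ge0//= lerD.
Qed.

Lemma measurable_stat_density n : measurable_fun setT (stat_density n).
Proof.
have mD_part s : measurable_fun setT (fun z : Omega * K =>
    D_part F (thh n z.1) y0 l0 (Yn z.1) (Xn z.1) s n z.2.1 z.2.2).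
  apply: (@measurable_D_part _ _ _ _ (fun z : Omega * K => thh n z.1) y0 l0
    (fun t z => Y t%:Z z.1) (fun t z => X t%:Z z.1)) => //.
  - exact: (measurableT_comp (mthh n) measurable_fst).
  - by move=> t; exact: (measurableT_comp (mY t%:Z) measurable_fst).
  - by move=> t; exact: (measurableT_comp (mX t%:Z) measurable_fst).
  - exact: (measurableT_comp measurable_fst measurable_snd).
  - exact: (measurableT_comp measurable_snd measurable_snd).
by apply: measurable_funD; apply: measurable_funX; exact: mD_part.
Qed.

Definition limit_density (p : K) : R := limit_part false p ^+ 2 + limit_part true p ^+ 2.

Lemma limit_density_itv p : 0 <= limit_density p <= 2.
Proof.
have h s : limit_part s p ^+ 2 <= 1.
  by rewrite -[leLHS]real_normK ?num_real// expr_le1// limit_part_bound.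
by rewrite /limit_density addr_ge0 ?sqr_ge0//= lerD.
Qed.

Lemma measurable_limit_density : measurable_fun setT limit_density.
Proof.
by apply: measurable_funD; apply: measurable_funX; exact: measurable_limit_part.
Qed.

Definition weighted_stat n o : \bar R := (\int[kap]_p (stat_density n (o, p) * k p)%:E)%E.

Definition weighted_limit : \bar R := (\int[kap]_p (limit_density p * k p)%:E)%E.

Lemma measurable_weighted_stat n : measurable_fun setT (weighted_stat n).
Proof.
apply: (measurable_fun_fubini_tonelli_F (m2 := kap)
  (fun z => (stat_density n z * k z.2)%:E)).
- apply/measurable_EFinP; apply: measurable_funM; first exact: measurable_stat_density.
  exact: (measurableT_comp mk measurable_snd).
- move=> z; rewrite lee_fin mulr_ge0//.
  by case/andP : (stat_density_itv n z).
Qed.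

Lemma Delta_statE (W : R -> 'rV[R]_(2 + m) -> R) n o : (0 < n)%N ->
  (forall u v, 0 < u < 1 -> W u v = w u * varpi v) ->
  (n%:R^-1%:E * Delta_stat F (thh n o) y0 l0 (Yn o) (Xn o) W n = weighted_stat n o)%E.
Proof.
move=> n0 hW; rewrite /Delta_stat muleA -EFinM mulVf ?pnatr_eq0 -?lt0n// mul1e.
rewrite (@iterated_weight _ _ _ _ _ _ _ D w varpi mD mw D_gt0 mvarpi varpi_gt0 _
  (fun p => stat_density n (o, p)))//.
- move=> u v /=; rewrite in_itv/= => u01; rewrite hW//; congr (_ * _).
  apply: normc_D_stat => // t; apply: lam_hat_gt0 => //.
  by move=> s i; exact: X0.
- exact: (measurableT_comp (measurable_stat_density n) (measurable_pair1 o)).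
- by move=> p; case/andP : (stat_density_itv n (o, p)).
Qed.

Let reg o t := regressors (Yn o) (Xn o) (ln o) t.

(** Deterministic, for a single sample point. As the compared quantities are bounded by 1, a
    difference of squares is at most twice the difference: hence the factors 2, and the factor 4
    because both parts share the same remainder. *)
Lemma weighted_stat_dev n o (eta rho : R) : 
  (past_input Y X th0 0 o < +oo)%E -> enorm (thh n o - th0) <= eta ->
  beta_of th0 + eta <= rho -> 0 <= rho -> rho < 1 ->
  (`| weighted_stat n o - weighted_limit | <=
    2%:E * deviation false n o + 2%:E * deviation true n o +
    (4 * ((1 - rho)^-1 + 1) * (n%:R^-1 * (eta * \sum_(t < n) reg o t +
        (l0 + y0 + reg o 0))))%:E * \int[kap]_z ((M1 + enorm z.2) * k z)%:E)%E.
Proof.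
move=> fin0 the brho rho0 rho1.
have eta0 : 0 <= eta by apply: le_trans the; exact: sqrtr_ge0.
have ln_gt0 t : 0 < ln o t by exact: lam_stat_gt0.
have ln_rec t : ln o t.+1 = h0 (zvec (Yn o t)%:R (ln o t) (Xn o t)) th0.
  exact: lam_stat_natS.
have Xn0 t i : 0 <= Xn o t ord0 i by exact: X0.
have reg0 t : 0 <= reg o t.
  apply: addr_ge0 (ltW (ln_gt0 t)); apply: addr_ge0; first exact: addr_ge0.
  by apply: sumr_ge0 => i _; exact: Xn0.
(* Index 2 of the parameter is beta, and one coordinate moves by at most the norm of the
   difference. *)
have brho' : beta_of (thh n o) <= rho.
  have := le_trans (coord_le_enorm (thh n o - th0) (lshift m 2)) the.
  rewrite !mxE ler_norml => /andP[_]; rewrite /beta_of !mxE in brho *.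
  by move=> ?; lra.
pose c : R := (1 - rho)^-1 + 1.
have c0 : 0 <= c by rewrite addr_ge0// invr_ge0 subr_ge0 ltW.
(* The term [l0 + y0 + reg o 0] covers both initial errors, since [reg o 0] contains the stationary
   intensity and the count at time 0. *)
pose r : R := eta * \sum_(t < n) reg o t + (l0 + y0 + reg o 0).
have r0 : 0 <= r.
  apply: addr_ge0; last by apply: addr_ge0 => //; exact: addr_ge0.
  by apply: mulr_ge0 => //; apply: sumr_ge0 => t _; exact: reg0.
pose Q : R := n%:R^-1 * (c * r).
have Q0 : 0 <= Q by rewrite !mulr_ge0// invr_ge0.
have nearD s p : `|D_part F (thh n o) y0 l0 (Yn o) (Xn o) s n p.1 p.2 -
    stat_part s n (pth o) p| <= (M1 + enorm p.2) * Q.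
  case: p => u v /=.
  have gL r1 r2 : 0 < r1 -> 0 < r2 -> `|tpgf F r1 u - tpgf F r2 u| <= M1 * `|r1 - r2|.
    by move=> r10 r20; exact: tpgf_lipschitz.
  have := statistic_stability (Yn o) (athh n o) Xn0 (g := fun r => tpgf F r u)
    (fun r => tpgf_itv F r u) gL (ltW M1_gt0) ln_gt0 y0_ge0 l0_ge0 s v (clamp01_itv u) n.
  have -> : stat_part s n (pth o) (u, v) = n%:R^-1 * (\sum_(t < n)
      (clamp01 u ^+ Yn o t.+1 - tpgf F (ln o t.+1) u) *
      trig s (dotv v (zvec (Yn o t)%:R (ln o t) (Xn o t)))).
    rewrite /stat_part /birkhoff_sum; congr (_ * _); apply: eq_bigr => t _.
    exact: residual_path.
  move=> h; apply: le_trans h _; apply: ler_wpM2l.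
    by rewrite addr_ge0 ?(ltW M1_gt0)// sqrtr_ge0.
  rewrite /Q ler_wpM2l ?invr_ge0//.
  apply: le_trans (lam_hat_sum_le y0 l0 (athh n o) Xn0 (fun t => ltW (ln_gt0 t))
    ln_rec the brho' rho1 n rho0) _.
  rewrite ler_wpM2l// /r -addrA lerD2l.
  have hl : `|lam_hat (thh n o) y0 l0 (Yn o) (Xn o) 0 - ln o 0| <= l0 + ln o 0.
    by rewrite /= (le_trans (ler_normB _ _))// !ger0_norm// ltW.
  have hy : `|y0 - (Yn o 0)%:R| <= y0 + (Yn o 0)%:R.
    by rewrite (le_trans (ler_normB _ _))// !ger0_norm.
  have hx : 0 <= \sum_(i < m) Xn o 0 ord0 i by exact: sumr_ge0.
  by rewrite /reg /regressors; lra.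
pose h s p : R := 2 * `|stat_part s n (pth o) p - limit_part s p|.
have mh s : measurable_fun setT (h s).
  apply: measurable_funM => //; apply: measurableT_comp => //.
  by apply: measurable_funB; [exact: measurable_stat_part|exact: measurable_limit_part].
have mo : measurable_fun setT (fun p => stat_density n (o, p)).
  exact: (measurableT_comp (measurable_stat_density n) (measurable_pair1 o)).
have mM : measurable_fun setT (fun p : K => M1 + enorm p.2).
  by apply: measurable_funD => //; apply: (measurableT_comp (@measurable_enorm _ _)).
have M0 (p : K) : 0 <= M1 + enorm p.2.
  by rewrite addr_ge0 ?(ltW M1_gt0)// sqrtr_ge0.
have h0' s p : 0 <= h s p by rewrite /h mulr_ge0.
have Q40 : 0 <= 4 * Q by rewrite mulr_ge0.
have := @weighted_deviation_le _ _ K kap k mk k_ge0 weight_fin (fun p => M1 + enorm p.2) mM M0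
  (fun p => stat_density n (o, p)) limit_density (h false) (h true) 2 (4 * Q)
  mo measurable_limit_density (mh false) (mh true) (h0' false) (h0' true) Q40
  (fun p => stat_density_itv n (o, p)) limit_density_itv.
have hdev s : (\int[kap]_z (h s z * k z)%:E = 2%:E * deviation s n o)%E.
  rewrite /deviation -ge0_integralZl//.
  - by apply: eq_integral => z _; rewrite -EFinM /h -mulrA.
  - apply/measurable_EFinP; apply: measurable_funM => //; apply: measurableT_comp => //.
    by apply: measurable_funB; [exact: measurable_stat_part|exact: measurable_limit_part].
  - by move=> z _; rewrite lee_fin mulr_ge0.
rewrite !hdev (_ : 4 * _ * _ = 4 * Q); last by rewrite /Q -/r -/c; ring.
apply=> p; rewrite /stat_density /limit_density /=.
have sq s : `|D_part F (thh n o) y0 l0 (Yn o) (Xn o) s n p.1 p.2 ^+ 2 -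
    limit_part s p ^+ 2| <= h s p + 2 * Q * (M1 + enorm p.2).
  rewrite subr_sqr normrM.
  have h1 : `|D_part F (thh n o) y0 l0 (Yn o) (Xn o) s n p.1 p.2 + limit_part s p| <= 2.
    apply: le_trans (ler_normD _ _) _.
    by rewrite -[leRHS]/(1 + 1) lerD ?D_part_bound ?limit_part_bound.
  have h2 : `|D_part F (thh n o) y0 l0 (Yn o) (Xn o) s n p.1 p.2 - limit_part s p| <=
      `|stat_part s n (pth o) p - limit_part s p| + (M1 + enorm p.2) * Q.
    rewrite [leRHS]addrC (le_trans (ler_distD (stat_part s n (pth o) p) _ _))// lerD2r.
    exact: nearD.
  rewrite /h; apply: (@le_trans _ _ ((`|stat_part s n (pth o) p - limit_part s p| +
    (M1 + enorm p.2) * Q) * 2)); first by rewrite ler_pM.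
  by rewrite le_eqVlt; apply/orP; left; apply/eqP; ring.
rewrite opprD addrACA (le_trans (ler_normD _ _))//.
apply: le_trans (lerD (sq false) (sq true)) _.
by rewrite le_eqVlt; apply/orP; left; apply/eqP; ring.
Qed.

Variables (pA qA : nat).
Hypothesis pA_gt0 : (1 <= pA)%N.
Hypothesis moment2 :
  ('E_P[fun w => ((enorm (z_alt Y X pA qA lamA 1 w)) ^+ 2)%R] < +oo)%E.
Hypothesis thh_cvg :
  cvg_in_probability P (fun n o => (enorm (thh n o - th0))%:E) 0%E.

Let Kc := (\int[kap]_z ((M1 + enorm z.2) * k z)%:E)%E.

Let Kc_ge0 : (0 <= Kc)%E.
Proof.
apply: integral_ge0 => z _; rewrite lee_fin mulr_ge0//.
by rewrite addr_ge0 ?(ltW M1_gt0)// sqrtr_ge0.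
Qed.

Let reg_ge0 o t : 0 <= reg o t.
Proof.
apply: addr_ge0; last by apply: ltW; exact: lam_stat_gt0.
apply: addr_ge0; first exact: addr_ge0.
by apply: sumr_ge0 => i _; exact: X0.
Qed.

Let mreg t : measurable_fun setT (fun o => reg o t).
Proof.
apply: measurable_funD; last by apply: measurable_lam_stat.
apply: measurable_funD; first apply: measurable_funD => //.
  apply: (@measurable_fun_nat_index _ _ _ _ (fun n _ => n%:R : R) (Y t%:Z)) => //.
by apply: measurable_sum => i; exact: (measurableT_comp (measurable_rV_coord i) (mX t%:Z)).
Qed.

Let remainder n eta o : R :=
  n%:R^-1 * (eta * (\sum_(t < n) reg o t) + (l0 + y0 + reg o 0)).

Let mremainder n eta : measurable_fun setT (remainder n eta).
Proof.
apply: measurable_funM => //; apply: measurable_funD.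
  by apply: measurable_funM => //; exact: measurable_sum.
exact: measurable_funD.
Qed.

Let remainder_ge0 n eta o : 0 <= eta -> 0 <= remainder n eta o.
Proof.
move=> eta0; apply: mulr_ge0; first by rewrite invr_ge0.
apply: addr_ge0; last by apply: addr_ge0 => //; exact: addr_ge0.
by apply: mulr_ge0 => //; exact: sumr_ge0.
Qed.

Lemma integral_remainder (C eta : R) n : (0 < n)%N -> 0 <= eta ->
  (forall t, \int[P]_o (reg o t)%:E <= C%:E)%E ->
  (\int[P]_o (remainder n eta o)%:E <= (eta * C + (l0 + y0 + C) / n%:R)%:E)%E.
Proof.
move=> n0 eta0 hC.
have S0 o : 0 <= \sum_(t < n) reg o t by exact: sumr_ge0.
have mS : measurable_fun setT (fun o => \sum_(t < n) reg o t) by exact: measurable_sum.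
have a0 : 0 <= l0 + y0 by exact: addr_ge0.
have -> : (\int[P]_o (remainder n eta o)%:E =
    \int[P]_o ((n%:R^-1 * eta)%:E * (\sum_(t < n) reg o t)%:E +
      ((n%:R^-1 * (l0 + y0))%:E + n%:R^-1%:E * (reg o 0)%:E)))%E.
  apply: eq_integral => o _; rewrite -!EFinM -!EFinD /remainder; congr EFin; ring.
have i0 : 0 <= n%:R^-1 :> R by rewrite invr_ge0.
rewrite ge0_integralD//; last 4 first.
- by move=> o _; rewrite -EFinM lee_fin !mulr_ge0.
- by apply: measurable_funeM; exact/measurable_EFinP.
- by move=> o _; rewrite -EFinM -EFinD lee_fin addr_ge0// mulr_ge0.
- by apply: emeasurable_funD => //; apply: measurable_funeM; exact/measurable_EFinP.
rewrite (ge0_integralD _ measurableT); last 4 first.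
- by move=> o _; rewrite lee_fin mulr_ge0.
- exact: measurable_cst.
- by move=> o _; rewrite -EFinM lee_fin mulr_ge0.
- by apply: measurable_funeM; exact/measurable_EFinP.
rewrite !ge0_integralZl//; try exact/measurable_EFinP;
  try (by move=> o _; rewrite lee_fin); try (by rewrite lee_fin ?mulr_ge0).
have hS : (\int[P]_o (\sum_(t < n) reg o t)%:E <= (n%:R * C)%:E)%E.
  under eq_integral do rewrite -sumEFin.
  rewrite ge0_integral_sum//; last 2 first.
  - by move=> t; exact/measurable_EFinP.
  - by move=> t o _; rewrite lee_fin.
  apply: (@le_trans _ _ (\sum_(t < n) C%:E)%E); first exact: lee_sum.
  by rewrite sumEFin sumr_const card_ord mulr_natl.
have -> : (eta * C + (l0 + y0 + C) / n%:R)%:E =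
    ((n%:R^-1 * eta)%:E * (n%:R * C)%:E +
    ((n%:R^-1 * (l0 + y0))%:E + n%:R^-1%:E * C%:E))%E.
  rewrite -!EFinM -!EFinD; congr EFin.
  have : n%:R != 0 :> R by rewrite pnatr_eq0 -lt0n.
  by move=> ?; field.
apply: leeD; first by rewrite lee_wpmul2l// lee_fin mulr_ge0.
apply: leeD; last by rewrite lee_wpmul2l// lee_fin.
rewrite integral_cst// -[leRHS]mule1 lee_wpmul2l ?lee_fin ?mulr_ge0//.
exact: probability_le1.
Qed.

Let c4 (rho : R) : R := 4 * ((1 - rho)^-1 + 1).

Let dominating n eta rho o : \bar R :=
  (2%:E * deviation false n o + 2%:E * deviation true n o +
   Kc * (c4 rho * remainder n eta o)%:E)%E.

Let deviation_ge0 s n o : (0 <= deviation s n o)%E.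
Proof. by apply: integral_ge0 => p _; rewrite lee_fin mulr_ge0. Qed.

Let c4_ge0 rho : rho < 1 -> 0 <= c4 rho.
Proof. by move=> rho1; rewrite mulr_ge0// addr_ge0// invr_ge0 subr_ge0 ltW. Qed.

Lemma integral_dominating (C eta rho : R) n : (0 < n)%N -> 0 <= eta -> rho < 1 ->
  (forall t, \int[P]_o (reg o t)%:E <= C%:E)%E ->
  (\int[P]_o dominating n eta rho o <=
   2%:E * (\int[P]_o deviation false n o) + 2%:E * (\int[P]_o deviation true n o) +
   Kc * (c4 rho * (eta * C + (l0 + y0 + C) / n%:R))%:E)%E.
Proof.
move=> n0 eta0 rho1 hC.
have mr : measurable_fun setT (fun o => (c4 rho * remainder n eta o)%:E).
  by apply/measurable_EFinP; apply: measurable_funM => //; exact: mremainder.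
have r0 o : (0 <= (c4 rho * remainder n eta o)%:E)%E.
  by rewrite lee_fin; apply: mulr_ge0; [exact: c4_ge0|exact: remainder_ge0].
rewrite (ge0_integral_lin3 P (measurable_deviation false n) (measurable_deviation true n) mr
  (deviation_ge0 false n) (deviation_ge0 true n) r0 _ _ Kc_ge0)//.
apply: leeD2l; apply: lee_wpmul2l; first exact: Kc_ge0.
under eq_integral do rewrite EFinM.
rewrite ge0_integralZl//.
- rewrite [leRHS]EFinM; apply: lee_wpmul2l; first by rewrite lee_fin; exact: c4_ge0.
  exact: integral_remainder.
- by apply/measurable_EFinP; exact: mremainder.
- by move=> o _; rewrite lee_fin; exact: remainder_ge0.
- by rewrite lee_fin; exact: c4_ge0.
Qed.

(** The first term pays for samples whose estimator lies outside the radius [eta]. On the others,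
    off the null set where the past series diverges, the deterministic estimate holds and Markov's
    inequality bounds the probability by the mean of [dominating]. *)
Lemma event_bound (C eta rho e : R) n : (0 < n)%N -> 0 < e -> 0 <= eta ->
  beta_of th0 + eta <= rho -> rho < 1 ->
  (forall t, \int[P]_o (reg o t)%:E <= C%:E)%E ->
  (P [set o | e%:E <= `|weighted_stat n o - weighted_limit|] <=
   P [set o | eta%:E <= `|(enorm (thh n o - th0))%:E - 0|] +
   e^-1%:E * (2%:E * (\int[P]_o deviation false n o) +
      2%:E * (\int[P]_o deviation true n o) +
      Kc * (c4 rho * (eta * C + (l0 + y0 + C) / n%:R))%:E))%E.
Proof.
move=> n0 e0 eta0 brho rho1 hC.
have rho0 : 0 <= rho by have := beta_ge0 ath0; lra.
have mdom : measurable_fun setT (dominating n eta rho).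
  apply: emeasurable_funD.
    by apply: emeasurable_funD; apply: measurable_funeM; exact: measurable_deviation.
  by apply: measurable_funeM; apply/measurable_EFinP; exact: measurable_funM.
have dom0 o : (0 <= dominating n eta rho o)%E.
  rewrite adde_ge0 ?adde_ge0 ?mule_ge0// lee_fin mulr_ge0 ?c4_ge0//.
  exact: remainder_ge0.
set E := [set o | _]; set A := [set o | (eta%:E <= _)%E].
pose B := setT `&` [set o | (e%:E <= `|dominating n eta rho o|)%E].
have mE : measurable E.
  rewrite -[E]setTI; apply: emeasurable_fun_c_infty => //.
  apply: measurableT_comp => //; apply: emeasurable_funB => //.
  exact: measurable_weighted_stat.
have mA : measurable A.
  rewrite -[A]setTI; apply: emeasurable_fun_c_infty => //.
  apply: measurableT_comp => //; apply: emeasurable_funB => //.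
  apply/measurable_EFinP; apply: (measurableT_comp (@measurable_enorm _ _)).
  apply: measurable_fun_rV => i.
  rewrite (_ : _ \o _ = fun o => rV_coord i (thh n o) - rV_coord i th0).
    apply: measurable_funB => //.
    exact: (measurableT_comp (measurable_rV_coord i) (mthh n)).
  by apply/funext => o; rewrite /= /rV_coord !mxE.
have mB : measurable B.
  by apply: emeasurable_fun_c_infty => //; exact: measurableT_comp.
have [N [mN N0 subN]] := past_input_ae mY mX mlamA X0 stat pA_gt0 moment2 ath0.
have sub : E `<=` (A `|` B) `|` N.
  move=> o Eo; have [fin0|nfin] := pselect (past_input Y X th0 0 o < +oo)%E; last first.
    by right; apply: subN.
  left; have [the|] := leP (enorm (thh n o - th0)) eta; last first.
    move=> /ltW the.
    have h : (eta%:E <= `|(enorm (thh n o - th0))%:E - 0|)%E.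
      by rewrite sube0 lee_fin ger0_norm//; exact: sqrtr_ge0.
    by left; exact: h.
  right; split => //=; rewrite gee0_abs//.
  have dev := weighted_stat_dev fin0 the brho rho0 rho1.
  rewrite [X in (_ <= _ + X)%E]muleC in dev.
  exact: le_trans Eo dev.
apply: (@le_trans _ _ (P (A `|` B `|` N))).
  by rewrite le_measure ?inE//; apply: measurableU => //; exact: measurableU.
apply: (@le_trans _ _ (P (A `|` B) + P N)%E).
  by apply: measureU2 => //; exact: measurableU.
rewrite [X in (_ + X)%E](_ : _ = 0%E) ?adde0//.
apply: (@le_trans _ _ (P A + P B)%E); first exact: measureU2.
apply: leeD => //.
have := @le_integral_abse _ _ _ P setT measurableT (dominating n eta rho) e mdom e0.
rewrite -/B => PB.
have -> : P B = (e^-1%:E * (e%:E * P B))%E.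
  by rewrite muleA -EFinM mulVf ?mul1e// lt0r_neq0.
apply: lee_wpmul2l; first by rewrite lee_fin invr_ge0 ltW.
apply: le_trans PB _; under eq_integral do rewrite gee0_abs//.
exact: integral_dominating.
Qed.

Lemma weighted_stat_cvg : cvg_in_probability P weighted_stat weighted_limit.
Proof.
move=> e e0; apply: cvge0_of_near_le => // delta delta0.
have [C hC] := regressors_moment mY mX mlamA X0 stat pA_gt0 moment2 ath0.
have b1 := beta_lt1 ath0; have b0 := beta_ge0 ath0.
have C0 : 0 <= C.
  rewrite -lee_fin; apply: le_trans (hC 0%N); apply: integral_ge0 => o _.
  by rewrite lee_fin; exact: reg_ge0.
have Kfin : Kc \is a fin_num by rewrite ge0_fin_numE// weight_moment1.
(* The midpoint between [beta_of th0] and 1 leaves room for the estimation error below the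
   contraction factor. *)
pose rho : R := (1 + beta_of th0) / 2.
have rho1 : rho < 1 by rewrite /rho; lra.
pose q : R := fine Kc * c4 rho.
have q0 : 0 <= q by rewrite mulr_ge0 ?fine_ge0// c4_ge0.
(* The added 1 makes [D1] a positive divisor even when [q * C] vanishes. *)
pose D1 : R := q * C + 1.
have D10 : 0 < D1 by rewrite /D1 ltr_wpDl// mulr_ge0.
(* The first bound gives [beta_of th0 + eta <= rho]; the second holds the contribution of the
   estimation error to the remainder below [delta * e / 8]. *)
pose eta : R := Num.min ((1 - beta_of th0) / 2) (delta * e / (8 * D1)).
have eta0 : 0 < eta.
  by rewrite /eta lt_min !divr_gt0 ?mulr_gt0// subr_gt0.
have etarho : beta_of th0 + eta <= rho.
  have : eta <= (1 - beta_of th0) / 2 by rewrite /eta ge_min lexx.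
  by rewrite /rho; lra.
have etaq : eta * D1 <= delta * e / 8.
  have : eta <= delta * e / (8 * D1) by rewrite /eta ge_min lexx orbT.
  by rewrite invfM mulrA ler_pdivlMr.
(* Budget after division by [e]: [delta / 2] for the estimator, [delta / 4] for the two ergodic
   deviations, each carrying a factor 2, and [delta / 4] for the remainder, shared by [eta] and the
   initial values. *)
have d16 : 0 < delta * e / 16 by rewrite divr_gt0// mulr_gt0.
pose a : R := l0 + y0 + C.
have a0 : 0 <= a by rewrite !addr_ge0.
have [n0 n0_gt0 hn] : exists2 n0 : nat, (0 < n0)%N &
    forall n, (n0 <= n)%N -> q * (a / n%:R) <= delta * e / 8.
  exists (Num.truncn (q * a / (delta * e / 8))).+1; first exact: ltn0Sn.
  move=> n nn; have np : 0 < n%:R :> R by rewrite ltr0n (leq_trans (ltn0Sn _) nn).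
  rewrite mulrA ler_pdivrMr// -ler_pdivrMl ?divr_gt0 ?mulr_gt0// mulrC.
  by rewrite (le_trans (ltW (truncnS_gt _)))// ler_nat.
have N1 := cvge0_near_le (divr_gt0 delta0 (ltr0n R 2 : 0 < 2)) (thh_cvg eta0).
have N2 := cvge0_near_le d16 (deviation_cvg false).
have N3 := cvge0_near_le d16 (deviation_cvg true).
have [k1 _ K1] := N1; have [k2 _ K2] := N2; have [k3 _ K3] := N3.
exists (n0 + k1 + k2 + k3)%N => // n nk.
have {nk} [nn kk1 kk2 kk3] : [/\ n0 <= n, k1 <= n, k2 <= n & k3 <= n]%N.
  move: nk; rewrite /= -!addnA => nk; split.
  - exact: leq_trans (leq_addr _ _) nk.
  - exact: leq_trans (leq_trans (leq_addr _ _) (leq_addl _ _)) nk.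
  - apply: leq_trans nk; apply: leq_trans (leq_addl _ _).
    exact: leq_trans (leq_addr _ _) (leq_addl _ _).
  - apply: leq_trans nk; apply: leq_trans (leq_addl _ _).
    exact: leq_trans (leq_addl _ _) (leq_addl _ _).
have h1 := K1 n kk1; have h2 := K2 n kk2; have h3 := K3 n kk3.
have n_gt0 : (0 < n)%N := leq_trans n0_gt0 nn.
have EB := event_bound n_gt0 e0 (ltW eta0) etarho rho1 hC.
apply: (le_trans EB).
have h4 : (Kc * (c4 rho * (eta * C + a / n%:R))%:E <= (delta * e / 4)%:E)%E.
  rewrite -(fineK Kfin) -EFinM lee_fin mulrA -/q mulrDr.
  have := hn n nn; have : q * (eta * C) <= eta * D1.
    by rewrite mulrCA ler_wpM2l// ?(ltW eta0)// lerDl.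
  by lra.
apply: (@le_trans _ _ ((delta / 2)%:E + e^-1%:E * (2%:E * (delta * e / 16)%:E +
   2%:E * (delta * e / 16)%:E + (delta * e / 4)%:E)))%E.
  apply: leeD; first exact: h1.
  apply: lee_wpmul2l; first by rewrite lee_fin invr_ge0 ltW.
  apply: leeD; last exact: h4.
  apply: leeD; (apply: lee_wpmul2l; first by rewrite lee_fin).
    exact: h2.
  exact: h3.
rewrite !(=^~ EFinM, =^~ EFinD) lee_fin le_eqVlt; apply/orP; left; apply/eqP.
by field; rewrite lt0r_neq0.
Qed.

End consistency.

(** * Identification of the limit *)

Section limit_zeta.
Context {R : realType} (m : nat) d (Omega : measurableType d) (P : probability Omega R).
Variables (F : R -> probability nat R) (th0 : 'rV[R]_(3 + m)).
Hypothesis Fmono : stochastically_ordered F.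
Hypothesis ath0 : admissible th0.
Variables (Y : int -> Omega -> nat) (X : int -> Omega -> 'rV[R]_m) (lamA : int -> Omega -> R).
Hypothesis mY : forall t, measurable_fun setT (Y t).
Hypothesis mX : forall t, measurable_fun setT (X t).
Hypothesis mlamA : forall t, measurable_fun setT (lamA t).
Hypothesis X0 : forall t w i, 0 <= X t w ord0 i.
Hypothesis lamA0 : forall t w, 0 < lamA t w.
Hypothesis hlaw : conditional_law P (Y 1)
     (information (fun s w => (Y s w, X s w)) (1 - 1)) (fun w => F (lamA 1 w)).
Variables (w : R -> R) (varpi : 'rV[R]_(2 + m) -> R).
Hypothesis mw : measurable_fun (`]0%R, 1%R[ : set R) w.
Hypothesis w_gt0 : forall u : R, 0 < u < 1 -> 0 < w u.
Hypothesis mvarpi : measurable_fun setT varpi.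
Hypothesis varpi_gt0 : forall v, 0 < varpi v.
Hypothesis varpi_even : forall v, varpi v = varpi (- v).

Lemma limit_partN s u v : limit_part P F th0 mY mX mlamA s (u, - v) =
  (if s then -1 else 1) * limit_part P F th0 mY mX mlamA s (u, v).
Proof.
have E z : residual F th0 s (z, (u, - v)) =
    (if s then -1 else 1) * residual F th0 s (z, (u, v)).
  rewrite /residual/= dotvNl /trig mulrCA; congr (_ * _).
  by case: s; [rewrite sinN mulN1r|rewrite cosN mul1r].
rewrite /limit_part -RintegralZl//.
  by apply: eq_Rintegral => z _; exact: E.
apply: (@integrable_bounded _ _ _ _ _ _ 1) => //.
  apply: (measurableT_comp (measurable_residual Fmono ath0 s)).
  exact: measurable_pair2.
by move=> z _; exact: residual_bound.
Qed.

Lemma weighted_limit_zeta :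
  (\int[@lebesgue_measure R]_(u in `]0%R, 1%R[) \int[lebesgue_rV (2 + m)]_v
     ((zeta P F Y X lamA th0 u v) ^+ 2 * (w u * varpi v))%R%:E =
   weighted_limit P F th0 mY mX mlamA w varpi)%E.
Proof.
have mD : measurable (`]0%R, 1%R[%classic : set (measurableTypeR R)).
  exact: measurable_itv.
have D0 (u : R) : (`]0%R, 1%R[%classic : set (measurableTypeR R)) u -> 0 < w u.
  by rewrite /= in_itv/=; exact: w_gt0.
pose C := limit_part P F th0 mY mX mlamA false.
pose S := limit_part P F th0 mY mX mlamA true.
have mC : measurable_fun setT C by exact: measurable_limit_part.
have mS : measurable_fun setT S by exact: measurable_limit_part.
rewrite (iterated_weight (@lebesgue_measure R) (lebesgue_rV (2 + m)) mD mw D0 mvarpi varpi_gt0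
  (G := fun z => (C z + S z) ^+ 2)).
- apply: (integral_even_odd (@lebesgue_measure R) mD mw D0 mvarpi varpi_gt0 varpi_even) => //.
  + by move=> f mf f0; exact: ge0_integral_rV_opp.
  + by move=> u v; rewrite /C limit_partN mul1r.
  + by move=> u v; rewrite /S limit_partN mulN1r.
- move=> u v; rewrite /= in_itv/= => u01; congr (_ ^+ 2 * _).
  rewrite (zeta_residual Fmono ath0 mY mX mlamA X0 lamA0 hlaw v u01).
  by rewrite /C /S /limit_part !Rintegral_residual.
- by apply: measurable_funX; exact: measurable_funD.
- by move=> z; exact: sqr_ge0.
Qed.

End limit_zeta.

Theorem theorem4p5 (R : realType) (d : measure_display)
  (Omega : measurableType d) (P : probability Omega R)
  (m : nat) (hm : (1 <= m)%N)
  (* distribution family on the nonnegative integers, indexed by its mean *)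
  (F : R -> probability nat R)
  (hF_mean : has_mean_parameter F)
  (* parameter sets *)
  (Theta Theta0 : set 'rV[R]_(3 + m))
  (hTheta : forall th, Theta th -> admissible th)
  (hTheta0_sub : Theta0 `<=` Theta)
  (hTheta0_compact : compact Theta0)
  (* the time series, the covariates and the true intensities *)
  (Y : int -> {RV P >-> nat}) (X : int -> {RV P >-> 'rV[R]_m})
  (lamA : int -> {RV P >-> R})
  (* estimator, as a function of the data (Y_t, X_{t-1}), t = 1, ..., T *)
  (est : forall T : nat, ('I_T -> nat * 'rV[R]_m) -> 'rV[R]_(3 + m))
  (hest_Theta : forall T data, Theta (est T data))
  (hest_meas : forall T, measurable_fun setT (theta_hat Y X est T))
  (* initial values of the statistic *)
  (y0 l0 : R) (hy0 : 0 <= y0) (hl0 : 0 <= l0)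
  (* the true model *)
  (pA qA KA : nat) (hpA : (1 <= pA)%N) (hKA : (1 <= KA)%N)
  (hA : 'rV[R]_(pA + qA + m) -> 'rV[R]_KA -> R)
  (hA_pos : forall z th, (forall i : 'I_(pA + qA), 0 <= lsubmx z ord0 i) ->
     0 < hA z th)
  (hA_neq : ~ is_linear_link Theta hA)
  (hX_ge0 : forall t omega (i : 'I_m), 0 <= X t omega ord0 i)
  (hX_stationary : strictly_stationary P (fun t w => X t w))
  (hX_ergodic : ergodic P (fun t w => X t w))
  (hF_order : stochastically_ordered F)
  (hlamA_pos : forall t omega, 0 < lamA t omega)
  (hjoint_stationary :
     strictly_stationary P (fun t w => (Y t w, lamA t w, X t w)))
  (hjoint_ergodic : ergodic P (fun t w => (Y t w, lamA t w, X t w)))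
  (hY_law : forall t, conditional_law P (Y t)
     (information (fun s w => (Y s w, X s w)) (t - 1))
     (fun w => F (lamA t w)))
  (ThetaA : set 'rV[R]_KA) (hThetaA_compact : compact ThetaA)
  (thA : 'rV[R]_KA) (hthA : interior ThetaA thA)
  (hlamA_eq : forall t, {ae P, forall w,
     lamA t w = hA (z_alt Y X pA qA lamA t w) thA})
  (hZA_moment : forall t,
     ('E_P[fun w => ((enorm (z_alt Y X pA qA lamA t w)) ^+ 2)%R] < +oo)%E)
  (M1 : R) (hM1 : 0 < M1)
  (hpgf : forall u l : R, 0 <= u <= 1 -> 0 < l ->
     derivable (fun l' => pgf F l' u) l 1 /\
     `|derive1 (fun l' => pgf F l' u) l| < M1)
  (th0 : 'rV[R]_(3 + m)) (hth0 : interior Theta0 th0)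
  (hest_cvg : cvg_in_probability P
     (fun T omega => (enorm (theta_hat Y X est T omega - th0))%:E) 0%E)
  (w : R -> R) (varpi : 'rV[R]_(2 + m) -> R)
  (W : R -> 'rV[R]_(2 + m) -> R)
  (hW : forall (u : R) (v : 'rV[R]_(2 + m)), 0 < u < 1 -> W u v = w u * varpi v)
  (hw_meas : measurable_fun (`]0%R, 1%R[ : set R) w)
  (hw_pos : forall u : R, 0 < u < 1 -> 0 < w u)
  (hvarpi_meas : measurable_fun setT varpi)
  (hvarpi_pos : forall v, 0 < varpi v)
  (hvarpi_even : forall v, varpi v = varpi (- v))
  (hw_int : (0 < \int[@lebesgue_measure R]_(u in `]0%R, 1%R[) (w u)%:E < +oo)%E)
  (hvarpi_int : forall k : nat, (k <= 4)%N ->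
     (0 < \int[lebesgue_rV (2 + m)]_v ((enorm v) ^+ k * varpi v)%R%:E < +oo)%E) :
  cvg_in_probability P
    (fun T omega => ((T%:R^-1)%:E *
       Delta_stat F (theta_hat Y X est T omega) y0 l0
         (fun t => Y t%:Z omega) (fun t => X t%:Z omega) W T)%E)
    (\int[@lebesgue_measure R]_(u in `]0%R, 1%R[)
       \int[lebesgue_rV (2 + m)]_v
         ((zeta P F Y X lamA th0 u v) ^+ 2 * (w u * varpi v))%R%:E)%E.
Proof.
have ath0 : admissible th0 by apply: hTheta; apply: hTheta0_sub; exact: interior_subset hth0.
have mY t : measurable_fun setT (Y t) by [].
have mX t : measurable_fun setT (X t) by [].
have mlamA t : measurable_fun setT (lamA t) by [].
have athh n o : admissible (theta_hat Y X est n o) by exact/hTheta/hest_Theta.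
have /andP[_ w_int] := hw_int.
have varpi_int0 : (\int[lebesgue_rV (2 + m)]_v (varpi v)%:E < +oo)%E.
  have /andP[_] := hvarpi_int 0%N (leq0n 4).
  by under eq_integral do rewrite expr0 mul1r.
have varpi_int1 : (\int[lebesgue_rV (2 + m)]_v (enorm v * varpi v)%:E < +oo)%E.
  have /andP[_] := hvarpi_int 1%N isT.
  by under eq_integral do rewrite expr1.
rewrite (weighted_limit_zeta hF_order ath0 mY mX mlamA hX_ge0 hlamA_pos (hY_law 1)
  hw_meas hw_pos hvarpi_meas hvarpi_pos hvarpi_even).
move=> eps eps0.
have := weighted_stat_cvg hF_order hM1 hpgf ath0 mY mX mlamA hX_ge0 hjoint_stationary
  hjoint_ergodic hw_meas hw_pos hvarpi_meas hvarpi_pos w_int varpi_int0 varpi_int1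
  hest_meas athh hy0 hl0 hpA (hZA_moment 1) hest_cvg eps0.
(* At sample size 0 the factor [T^-1 * T] is 0 instead of 1, so the two sequences are identified
   from 1 on. *)
apply: cvg_trans; apply: near_eq_cvg; exists 1%N => // n n_gt0.
congr (P _); apply/seteqP; split => o /=.
  by rewrite (Delta_statE hF_order mY mX hX_ge0 hw_meas hw_pos hvarpi_meas hvarpi_pos
    hest_meas athh hy0 hl0 o n_gt0 hW).
by rewrite -(Delta_statE hF_order mY mX hX_ge0 hw_meas hw_pos hvarpi_meas hvarpi_pos
    hest_meas athh hy0 hl0 o n_gt0 hW).
Qed.
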